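(* Let $R\in(0,+\infty]$, $s_+>0$, $p,q\in\mathbb{R}$ with $q>0$, and let $F:\mathbb{R}\to\mathbb{R}$ be a $C^1$ function such that $F(0)=F(s_+)=0$, $F'(s_+)>0$, $F(t)<0$ for $t\in(0,s_+)$, $F(t)\ge 0$ for $t\in(s_+,+\infty)$, and $$\frac{F(t)+F(-t)}{2}\le 0\quad\text{for all } t\ge 0.$$ Let $u_*$ denote the unique non-negative solution of the boundary value problem $$u''(r)+\frac{p}{r}u'(r)-\frac{q}{r^2}u(r)=F(u(r))\ \text{ in }(0,R),\qquad u(0)=0,\quad u(R)=s_+ .$$ Then $u_*$ is locally energy minimizing with respect to the energy $E$, i.e. $E[u_*;\omega]\le E[u_*+\varphi;\omega]$ for any compact interval $\omega\subset[0,R]\cap[0,+\infty)$ and any $\varphi\in C_c^\infty(\omega)$. Conversely, if a function $u\in H^1_{loc}(0,R)$ is locally energy minimizing with respect to $E$ and satisfies $u(R)=s_+$, then $u$ is necessarily the non-negative solution $u_*$.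
   Context: For an interval $I\subset[0,+\infty)$, $$E[u;I]=\frac12\int_I\Big[r^p|u'(r)|^2+q\,r^{p-2}u^2(r)+r^p h(u(r))\Big]\,dr,\qquad h(t):=2\int_0^tF(s)\,ds .$$ A function $u$ on $(0,R)$ is locally energy minimizing with respect to $E$ if $E[u;\omega]\le E[u+\varphi;\omega]$ for every compact interval $\omega\subset[0,R]\cap[0,+\infty)$ and every $\varphi\in C_c^\infty(\omega)$ (smooth functions with compact support in the interior of $\omega$). Solutions of the boundary value problem satisfy the ODE in $(0,R)$ together with $u(0)=0$ and $u(R)=s_+$; when $R=+\infty$, $u(+\infty)$ means $\lim_{r\to+\infty}u(r)$. Under the stated hypotheses on $p,q,F$ (even without the condition on $F(t)+F(-t)$) the non-negative solution $u_*$ exists and is unique in the class of non-negative solutions.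
   Formalization: ''Locally energy minimizing'' also requires E[u;ω] to be finite (integrable density) for every compact interval ω in [0,R]∩[0,+∞); otherwise solutions singular at 0, with infinite energy on [0,b], can satisfy the inequality as +∞ ≤ +∞ and violate the converse. *)

(* Defs.v *)
(* MathComp-Analysis, over an abstract [R : realType]. *)
From HB Require Import structures.
From mathcomp Require Import all_boot all_order all_algebra.
From mathcomp Require Import all_classical all_reals all_analysis.

Set Implicit Arguments.
Unset Strict Implicit.
Unset Printing Implicit Defensive.

Import Order.TTheory GRing.Theory Num.Theory.
Import numFieldNormedType.Exports.

Local Open Scope ring_scope.
Local Open Scope classical_set_scope.

Definition interval0 (R : realType) (Rad : \bar R) : set R :=
  [set r | 0 < r /\ (r%:E < Rad)%E].

Definition class_C1 (R : realType) (F : R -> R) : Prop :=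
  (forall x, derivable F x 1) /\ continuous F^`().

(* C_c^oo(U) for an open U, functions being extended by 0 to the whole line *)
Definition test_function (R : realType) (U : set R) (phi : R -> R) : Prop :=
  [/\ forall (n : nat) (x : R), derivable phi^`(n) x 1,
      compact (closure [set x | phi x != 0]) &
      closure [set x | phi x != 0] `<=` U].

Definition L2loc (R : realType) (U : set R) (u : R -> R) : Prop :=
  measurable_fun U u /\ locally_integrable U (fun x => u x ^+ 2).

Definition weak_derivative (R : realType) (U : set R) (u du : R -> R) : Prop :=
  forall phi : R -> R, test_function U phi ->
    \int[@lebesgue_measure R]_(x in U) (u x * phi^`()%classic x) =
    - \int[@lebesgue_measure R]_(x in U) (du x * phi x).

Definition H1loc (R : realType) (U : set R) (u : R -> R) : Prop :=
  L2loc U u /\ exists2 du : R -> R, L2loc U du & weak_derivative U u du.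

(* u(Rad) = s, as a limit from inside (0, Rad); -oo is never used *)
Definition end_value (R : realType) (Rad : \bar R) (u : R -> R) (s : R) : Prop :=
  match Rad with
  | b%:E => u x @[x --> b^'-] --> s
  | +oo%E => u x @[x --> +oo] --> s
  | -oo%E => False
  end.

(* Elements of H^1_loc are classes modulo a.e. equality: their end value is
   that of the continuous representative. *)
Definition end_trace (R : realType) (Rad : \bar R) (u : R -> R) (s : R) : Prop :=
  exists v : R -> R,
    [/\ forall r, interval0 Rad r -> {for r, continuous v},
        ae_eq (@lebesgue_measure R) (interval0 Rad) u v &
        end_value Rad v s].

Definition nonneg_solution (R : realType) (Rad : \bar R) (sp p q : R)
    (F u : R -> R) : Prop :=
  [/\ forall r, interval0 Rad r ->
        [/\ derivable u r 1, derivable u^`() r 1 &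
            u^`(2)%classic r + p / r * u^`()%classic r - q / r ^+ 2 * u r = F (u r)],
      u x @[x --> 0^'+] --> 0,
      end_value Rad u sp &
      forall r, interval0 Rad r -> 0 <= u r].

(* h(t) = 2 \int_0^t F, the integral being oriented *)
Definition potential (R : realType) (F : R -> R) (t : R) : R :=
  2 * (if 0 <= t then \int[@lebesgue_measure R]_(s in `[0, t]) F s
       else - \int[@lebesgue_measure R]_(s in `[t, 0]) F s).

Definition energy_density (R : realType) (p q : R) (F u du : R -> R) (r : R) : R :=
  r `^ p * `|du r| ^+ 2 + q * r `^ (p - 2) * u r ^+ 2
    + r `^ p * potential F (u r).

(* E[u; I], where du is the (weak) derivative of u *)
Definition energy (R : realType) (p q : R) (F u du : R -> R) (I : set R) : \bar R :=
  ((2^-1)%:E *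
   \int[@lebesgue_measure R]_(r in I) (energy_density p q F u du r)%:E)%E.

(* Minimality presupposes that E[u; omega] is a well-defined real number. This
   is only a restriction when omega touches an end of (0, Rad): without it,
   both sides of the inequality may be +oo on every [0, b], as happens for
   solutions of the ODE that are singular at 0. The derivative du is unique up
   to a.e. equality, and du + phi' is the weak derivative of u + phi. *)
Definition locally_energy_minimizing (R : realType) (Rad : \bar R) (p q : R)
    (F u : R -> R) : Prop :=
  exists du : R -> R,
    [/\ L2loc (interval0 Rad) u, L2loc (interval0 Rad) du,
        weak_derivative (interval0 Rad) u du &
        forall a b : R, 0 <= a -> a <= b -> (b%:E <= Rad)%E ->
          (@lebesgue_measure R).-integrable `[a, b]
            (EFin \o energy_density p q F u du) /\
          forall phi : R -> R, test_function `]a, b[ phi ->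
            (energy p q F u du `[a, b] <=
             energy p q F (u \+ phi)%R (du \+ phi^`()%classic)%R `[a, b])%E].

(* Main.v *)
(* Write [w] for the non-negative solution and [e] for the energy density. One has
   [0 < w < sp] and [w] is increasing, so [r * w' r = g (w r)] for some function [g], and
   the dilates [w (lambda r)] form a field of curves of slope [g y / r]. Along this field
   [e v = (2 r^(p-1) G v)' + r^(p-2) ((r v' - g v)^2 + psi r v)] with [G' = g], [G] even;
   the derivative of [psi r (w rho)] in [rho] is [2 w' (r^2 - rho^2) F w], so [psi r] is
   minimal at [w r], and only at [+- w r]. Hence [w] is minimizing, with a definite loss
   of energy for competitors whose absolute value differs from [w].

   Conversely a minimizer [u] solves the ODE (du Bois-Reymond). With [d = u - w] and a
   cutoff [th], compare [u] with [u - th d] and [w] with [w + th d]: where [th = 1] the two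
   functions are exchanged and the total energy does not change, so the two increments of
   energy, the first nonnegative and the second bounded below if [|u| <> w], only come from
   the transition zones of [th]. These contributions tend to [0]: at [0] because the energies
   are finite, at a finite end because [u'] and [w'] are bounded and [d] vanishes there, at
   infinity because [F' sp > 0] makes [r^p d d'] nondecreasing and bounded. *)

(* The field of dilates covers only heights in []0, sp[], while competitors take all values.
   Negative heights are reached by odd reflection of [g]: by the hypothesis on [F t + F (- t)],
   replacing [y] by [|y|] does not increase the potential. For large heights the radii are bounded
   by some [b]: from a height slightly below [sp] on, [q * y ^+ 2 + r ^+ 2 * potential F y] is then
   nondecreasing, and [g] may be brought down linearly to 0. The field thus depends on [b], but the
   loss of energy must be known before the cutoff, hence [b], is chosen; it is bounded below in
   terms of [w] and [F] alone. In the converse only finite energy is known of [u] at 0, so that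
   [u - w] has no boundary value there. The perturbations are cutoffs of a difference of solutions
   and are not smooth, so minimality is first extended from test functions to functions with
   Lipschitz derivative. The comparison only yields [|u| = w]; the sign follows because [w] does not
   vanish and the end value [sp] is positive. *)
Require Import Defs.
From HB Require Import structures.
From mathcomp Require Import all_boot all_order all_algebra.
From mathcomp Require Import all_classical all_reals all_analysis.
From mathcomp Require Import ring lra measurable_realfun.

Set Implicit Arguments.
Unset Strict Implicit.
Unset Printing Implicit Defensive.

Import Order.TTheory GRing.Theory Num.Theory.
Import numFieldNormedType.Exports.

Local Open Scope ring_scope.
Local Open Scope classical_set_scope.

(* [lra] reifies every hypothesis in sight, which is slow next to integrals. *)
Ltac clear_non_orders :=
  repeat match goal with
  | H : ?T |- _ =>
    lazymatch T with
    | is_true (@Order.le _ _ _ _) => fail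
    | is_true (@Order.lt _ _ _ _) => fail
    | @eq bool _ _ => clear H
    | @eq _ _ _ => fail
    | _ => lazymatch type of T with
      | Prop => tryif (match goal with H' := _ |- _ => constr_eq H H' end) then fail else clear H
      | _ => fail
      end
    end
  end.
Ltac arith := clear_non_orders; lra.

(** * Derivatives and integrals of real functions *)

Section Derivatives.
Variable R : realType.
Implicit Types (f g : R -> R) (x a b c : R).

Lemma is_derive_continuous f x a : is_derive x 1 f a -> {for x, continuous f}.
Proof. by case=> /derivable1_diffP/differentiable_continuous. Qed.

Lemma derE f x a b : is_derive x 1 f a -> a = b -> is_derive x 1 f b.
Proof. by move=> + <-. Qed.

Lemma dcst c x : is_derive x 1 (fun _ : R => c) 0.
Proof. exact: is_derive_cst. Qed.

Lemma did x : is_derive x 1 (fun y : R => y) 1.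
Proof. exact: is_derive_id. Qed.

Lemma dD f g x a b : is_derive x 1 f a -> is_derive x 1 g b ->
  is_derive x 1 (fun y => f y + g y) (a + b).
Proof. by move=> ? ?; exact: is_deriveD. Qed.

Lemma dN f x a : is_derive x 1 f a -> is_derive x 1 (fun y => - f y) (- a).
Proof. by move=> ?; exact: is_deriveN. Qed.

Lemma dM f g x a b : is_derive x 1 f a -> is_derive x 1 g b ->
  is_derive x 1 (fun y => f y * g y) (a * g x + f x * b).
Proof.
move=> fa gb; have := @is_deriveM _ _ f g x 1 a b fa gb.
rewrite mulrfctE => /derE; apply.
by rewrite /GRing.scale /=; ring.
Qed.

Lemma dV f x a : f x != 0 -> is_derive x 1 f a ->
  is_derive x 1 (fun y => (f y)^-1) (- a / f x ^+ 2).
Proof.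
move=> fx0 fa; have /derE := @is_deriveV _ f x a 1 fx0 fa; apply.
by rewrite /GRing.scale /=; field; exact: fx0.
Qed.

Lemma dX f n x a : is_derive x 1 f a ->
  is_derive x 1 (fun y => f y ^+ n.+1) (n.+1%:R * f x ^+ n * a).
Proof.
move=> fa; have := @is_deriveX _ _ f n.+1 x 1 a fa.
by rewrite exprfctE => /derE; apply.
Qed.

Lemma dcomp f g x a b : is_derive (g x) 1 f a -> is_derive x 1 g b ->
  is_derive x 1 (fun y => f (g y)) (a * b).
Proof. move=> fa gb; exact: (@is_derive1_comp _ f g x a b fa gb).
Qed.

Lemma dpow (p : R) x : 0 < x ->
  is_derive x 1 (fun y => y `^ p) (p * (x `^ p / x)).
Proof.
move=> x0; apply: derE; first exact: is_derive1_powR.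
by rewrite powRB ?powRr1 ?ltW // lt0r_neq0 // implybT.
Qed.

Lemma derive1P f x : derivable f x 1 -> is_derive x 1 f (f^`() x).
Proof. by move=> ?; split=> //; rewrite derive1E. Qed.

Lemma is_derive_derive1 f x a : is_derive x 1 f a -> f^`() x = a.
Proof. by case=> _ <-; rewrite derive1E. Qed.

Lemma within_itv a b f : (forall x, a <= x -> x <= b -> {for x, continuous f}) ->
  {within `[a, b], continuous f}.
Proof.
move=> cf; apply: continuous_in_subspaceT => x /set_mem /=.
by rewrite in_itv /= => /andP[]; exact: cf.
Qed.

Lemma mvt f (df : R -> R) a b : a < b ->
  (forall x, a <= x -> x <= b -> is_derive x 1 f (df x)) ->
  exists c, [/\ a < c, c < b & f b - f a = df c * (b - a)].
Proof.
move=> ab dfx; have [||c] := @MVT R f df a b ab.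
- by move=> x; rewrite in_itv /= => /andP[/ltW ? /ltW ?]; exact: dfx.
- apply: within_itv => x ax xb; exact: is_derive_continuous (dfx x ax xb).
by rewrite in_itv /= => /andP[ac cb] E; exists c.
Qed.

Lemma nondecr_der f (df : R -> R) a b : a <= b ->
  (forall x, a <= x -> x <= b -> is_derive x 1 f (df x)) ->
  (forall x, a < x -> x < b -> 0 <= df x) -> f a <= f b.
Proof.
rewrite le_eqVlt => /predU1P[->//|ab] dfx df0.
have [c [ac cb E]] := mvt ab dfx.
by rewrite -subr_ge0 E mulr_ge0 ?df0 ?subr_ge0 ?ltW.
Qed.

Lemma nonincr_der f (df : R -> R) a b : a <= b ->
  (forall x, a <= x -> x <= b -> is_derive x 1 f (df x)) ->
  (forall x, a < x -> x < b -> df x <= 0) -> f b <= f a.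
Proof.
move=> ab dfx df0; rewrite -lerN2.
apply: (@nondecr_der (fun y => - f y) (fun y => - df y) a b) => // x ax xb.
  exact: dN (dfx x ax xb).
by rewrite oppr_ge0 df0.
Qed.

Lemma incr_der f (df : R -> R) a b : a < b ->
  (forall x, a <= x -> x <= b -> is_derive x 1 f (df x)) ->
  (forall x, a < x -> x < b -> 0 < df x) -> f a < f b.
Proof.
move=> ab dfx df0; have [c [ac cb E]] := mvt ab dfx.
by rewrite -subr_gt0 E mulr_gt0 ?df0 ?subr_gt0.
Qed.

Lemma max_der f x a e : 0 < e ->
  (forall y, `|y - x| < e -> f y <= f x) -> is_derive x 1 f a ->
  (forall y, `|y - x| < e -> derivable f y 1) -> a = 0.
Proof.
move=> e0 fmax [_ <-] df.
have := @derive1_at_max _ f (x - e) (x + e) x.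
case.
- by rewrite lerD2l; arith.
- move=> t; rewrite in_itv /= => /andP[? ?]; apply: df; rewrite ltr_distl; arith.
- by rewrite in_itv /=; apply/andP; split; arith.
- move=> t; rewrite in_itv /= => /andP[? ?]; apply: fmax; rewrite ltr_distl; arith.
by [].
Qed.

Lemma max_der2 f (df : R -> R) x a e : 0 < e ->
  (forall y, `|y - x| < e -> f y <= f x) ->
  (forall y, `|y - x| < e -> is_derive y 1 f (df y)) ->
  is_derive x 1 df a -> df x = 0 /\ a <= 0.
Proof.
move=> e0 fmax fdf dfa.
have dfx0 : df x = 0.
  apply: (max_der e0 fmax); first by apply: fdf; rewrite subrr normr0.
  by move=> y /fdf [].
split=> //; rewrite leNgt; apply/negP => a0.
have dfa' : h^-1 *: (df (h + x) - df x) @[h --> 0^'] --> a.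
  have [dd <-] := dfa.
  have : (fun h : R => h^-1 *: ((df \o shift x) (h *: 1) - df x)) @ 0^'
         --> 'D_1 df x by exact: dd.
  by under eq_fun do rewrite /= [_ *: 1]mulr1.
have : \forall h \near 0^', 0 < h^-1 *: (df (h + x) - df x).
  exact: (cvgr_gt _ dfa').
rewrite near_withinE => /nbhs_ballP[d /= d0 H].
pose h := Num.min d e / 2.
have h0 : 0 < h by rewrite divr_gt0 // lt_min d0.
have hd : h < d by rewrite /h ltr_pdivrMr // gt_min; apply/orP; left; arith.
have he : h < e by rewrite /h ltr_pdivrMr // gt_min; apply/orP; right; arith.
have dpos y : 0 < y -> y <= h -> 0 < df (y + x).
  move=> y0 yh; have := H y; rewrite /ball /= sub0r normrN gtr0_norm //.
  move=> /(_ (le_lt_trans yh hd)); rewrite gt_eqF //= => /(_ isT).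
  by rewrite dfx0 subr0 /GRing.scale /= pmulr_rgt0 // invr_gt0.
have : f x < f (x + h).
  apply: (@incr_der f df); first by rewrite ltrDl.
  - by move=> y xy yh; apply: fdf; rewrite ger0_norm ?subr_ge0 //; arith.
  - move=> y xy yh; have := dpos (y - x); rewrite subrK; apply; arith.
apply/negP; rewrite -leNgt; apply: fmax.
by rewrite addrAC subrr add0r gtr0_norm.
Qed.

End Derivatives.

(** Differentiates by recursion on the syntax of the body and leaves the nonvanishing of
    denominators as side goals. The computed derivative is an evar; [deriv] uses [derE] to compare
    it afterwards with the claimed one. *)
Ltac der :=
 lazymatch goal with
 | |- is_derive _ _ (fun y => (@?f y + @?g y)%R) _ => eapply (@dD _ f g); der
 | |- is_derive _ _ (fun y => (- @?f y)%R) _ => first [eapply dcst | eapply (@dN _ f); der]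
 | |- is_derive _ _ (fun y => (@?f y * @?g y)%R) _ => first [eapply dcst | eapply (@dM _ f g); der]
 | |- is_derive _ _ (fun y => ((@?f y) ^+ _)%R) _ => first [eapply dcst | eapply (@dX _ f); der]
 | |- is_derive _ _ (fun y => ((@?f y)^-1)%R) _ => first [eapply dcst | eapply (@dV _ f); [ | der]]
 | |- is_derive _ _ (GRing.mul ?k) _ => eapply (@dM _ (fun _ => k) (fun y => y)); der
 | |- is_derive _ _ (fun y => (y `^ ?p)%R) _ => eapply (@dpow _ p)
 | |- is_derive _ _ (fun y => ?f y) _ => first [eapply did | eapply dcst | change (fun y => f y) with f; eauto]
 | |- is_derive _ _ (fun y => ?f (@?g y)) _ => first [eapply dcst | eapply (@dcomp _ f g); der | idtac]
 | |- _ => first [eapply did | eapply dcst | solve [eauto] | idtac]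
 end.
Ltac deriv := eapply derE; [der | cbv beta].

(** * Integrals over intervals and oriented primitives *)

Section Integrals.
Variable R : realType.
Implicit Types (f g : R -> R) (x a b c : R).
Notation mu := (@lebesgue_measure R).

Lemma cont_integrable f a b :
  (forall x, a <= x -> x <= b -> {for x, continuous f}) ->
  mu.-integrable `[a, b] (EFin \o f).
Proof.
move=> cf; apply: continuous_compact_integrable; first exact: segment_compact.
exact: within_itv.
Qed.

Lemma integrable_itvS f a b c e : a <= c -> e <= b ->
  mu.-integrable `[a, b] (EFin \o f) -> mu.-integrable `[c, e] (EFin \o f).
Proof.
move=> ac eb; apply: integrableS => //; apply: subset_itv; rewrite bnd_simp //.
Qed.

Lemma Rint_split f a b c : a <= b -> b <= c ->
  mu.-integrable `[a, c] (EFin \o f) ->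
  \int[mu]_(x in `[a, c]) f x =
  \int[mu]_(x in `[a, b]) f x + \int[mu]_(x in `[b, c]) f x.
Proof.
move=> ab bc fi; rewrite -(@Rintegral_itv_obnd_cbnd _ b (BRight c)).
  by rewrite -(Rintegral_itvB (a := BLeft a)) ?bnd_simp // addrC subrK.
by apply: integrableS fi => //; apply: subset_itvr; rewrite bnd_simp.
Qed.

Lemma ftc2 f (df : R -> R) a b : a <= b ->
  (forall x, a <= x -> x <= b -> is_derive x 1 f (df x)) ->
  (forall x, a <= x -> x <= b -> {for x, continuous df}) ->
  \int[mu]_(x in `[a, b]) df x = f b - f a.
Proof.
rewrite le_eqVlt => /predU1P[-> _ _|ab fd cd].
  by rewrite subrr set_itv1 Rintegral_set1.
rewrite /Rintegral (@continuous_FTC2 R df f a b) //.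
- exact: within_itv.
- split.
  + move=> x; rewrite in_itv /= => /andP[ax xb].
    by have [] := fd x (ltW ax) (ltW xb).
  + apply/cvg_at_right_filter.
    exact: (is_derive_continuous (fd a (lexx _) (ltW ab))).
  + apply/cvg_at_left_filter.
    exact: (is_derive_continuous (fd b (ltW ab) (lexx _))).
- move=> x; rewrite in_itv /= => /andP[ax xb].
  exact: (is_derive_derive1 (fd x (ltW ax) (ltW xb))).
Qed.

(** Same body as in [potential], so that [potentialE] holds by conversion. *)
Definition prim f x : R :=
  if 0 <= x then \int[mu]_(s in `[0, x]) f s else - \int[mu]_(s in `[x, 0]) f s.

Lemma prim0 f : prim f 0 = 0.
Proof. by rewrite /prim lexx set_itv1 Rintegral_set1. Qed.

(** Near [x] the oriented integral is, up to a constant, the integral from a point [- M] to the left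
    of both [x] and 0; this removes the case distinction at 0. *)
Lemma dprim f x : continuous f -> is_derive x 1 (prim f) (f x).
Proof.
move=> cf; pose M : R := `|x| + 1.
have fi a b : mu.-integrable `[a, b] (EFin \o f).
  by apply: cont_integrable => y _ _; exact: cf.
have xM : x < M by rewrite /M (le_lt_trans (ler_norm x)) // ltrDl.
have Mx : - M < x.
  by rewrite ltrNl /M (le_lt_trans (ler_norm (- x))) // normrN ltrDl.
have M0 : 0 < M by rewrite /M ltr_wpDl.
clearbody M.
have E (y : R) : - M < y -> prim f y =
    \int[mu]_(s in `[- M, y]) f s - \int[mu]_(s in `[- M, 0]) f s.
  move=> My; rewrite /prim; case: leP => [y0|y0].
    rewrite (@Rint_split f (- M) 0 y) //; last by rewrite oppr_le0 ltW.
    by rewrite addrC addKr.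
  rewrite (@Rint_split f (- M) y 0) //; try exact: ltW.
  by rewrite opprD addrA subrr sub0r.
apply: (near_eq_is_derive (f := fun y =>
    \int[mu]_(s in `[- M, y]) f s - \int[mu]_(s in `[- M, 0]) f s)).
  have : \forall y \near x, - M < y by exact: lt_nbhsr.
  by apply: filterS => y /E ->.
have [D1 D2] := @continuous_FTC1_closed R f (- M) x M xM (fi _ _) Mx (cf x).
apply: derE; first by der; exact: derive1P.
by rewrite D2 addr0.
Unshelve. all: by end_near. Qed.

Lemma Rint_le f g a b :
  mu.-integrable `[a, b] (EFin \o f) -> mu.-integrable `[a, b] (EFin \o g) ->
  (forall x, a <= x -> x <= b -> f x <= g x) ->
  \int[mu]_(x in `[a, b]) f x <= \int[mu]_(x in `[a, b]) g x.
Proof.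
move=> fi gi fg; apply: le_Rintegral => // x /=.
by rewrite in_itv /= => /andP[]; exact: fg.
Qed.

Lemma eq_Rint f g a b : (forall x, a <= x -> x <= b -> f x = g x) ->
  \int[mu]_(x in `[a, b]) f x = \int[mu]_(x in `[a, b]) g x.
Proof.
move=> fg; apply: eq_Rintegral => x; rewrite inE /= in_itv /= => /andP[].
exact: fg.
Qed.

Lemma integral_EFin f a b : mu.-integrable `[a, b] (EFin \o f) ->
  (\int[mu]_(x in `[a, b]) (f x)%:E = (\int[mu]_(x in `[a, b]) f x)%:E)%E.
Proof. by move=> fi; rewrite /Rintegral fineK // integrable_fin_num. Qed.

Lemma integrable_oo_cc f a b : mu.-integrable `]a, b[ (EFin \o f) ->
  mu.-integrable `[a, b] (EFin \o f).
Proof.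
move=> /integrableP[mf foo]; apply/integrableP; split.
  exact: (@emeasurable_fun_itv_cc _ _ _ false true).
rewrite (@integral_itv_bndoo _ a b (fun x => `|(EFin \o f) x|%E) true false) //.
exact: measurableT_comp.
Qed.

(** On compact subintervals the integral of [dY >= 0] is a difference of values of [Y], hence at
    most [2 * C]; monotone convergence passes to the open interval. No limit of [Y] at the ends is
    required. *)
Lemma integrable_oo_dom f (Y dY : R -> R) (C : R) a b :
  (forall x, a < x -> x < b -> {for x, continuous f}) ->
  (forall x, a < x -> x < b -> is_derive x 1 Y (dY x)) ->
  (forall x, a < x -> x < b -> {for x, continuous dY}) ->
  (forall x, a < x -> x < b -> `|f x| <= dY x) ->
  (forall x, a < x -> x < b -> `|Y x| <= C) ->
  mu.-integrable `]a, b[ (EFin \o f).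
Proof.
move=> cf dYx cdY fdY YC.
have [ab|ba] := ltP a b; last first.
  by rewrite set_itv_ge ?bnd_simp -?leNgt //; exact: integrable_set0.
have mcont g : (forall x, a < x -> x < b -> {for x, continuous g}) ->
    measurable_fun `]a, b[ g.
  move=> cg; apply: open_continuous_measurable_fun; first exact: interval_open.
  by move=> x /set_mem /=; rewrite in_itv /= => /andP[]; exact: cg.
apply: (@le_integrable _ _ _ mu _ _ _ (EFin \o dY)) => //.
- by apply/measurable_EFinP; exact: mcont.
- move=> x /=; rewrite in_itv /= => /andP[ax xb].
  by rewrite lee_fin (le_trans (fdY _ ax xb)) // ler_norm.
apply/integrableP; split; first by apply/measurable_EFinP; exact: mcont.
(* With [n.+2] even the first interval [A 0] is not reversed: it is the midpoint. *)
pose e n : R := (b - a) / n.+2%:R.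
have e0 n : 0 < e n by rewrite divr_gt0 // subr_gt0.
have e2 n : e n <= (b - a) / 2.
  by rewrite ler_pM2l ?subr_gt0 // lef_pV2 ?posrE // ler_nat.
pose A n : set R := `[a + e n, b - e n]%classic.
have Ain n x : a + e n <= x -> x <= b - e n -> a < x /\ x < b.
  by have := e0 n; split; arith.
have UA : \bigcup_n A n = `]a, b[%classic.
  apply/seteqP; split => x /=.
    move=> [n _]; rewrite /A /= !in_itv /= => /andP[] /Ain /[apply] -[-> ->] //.
  rewrite in_itv /= => /andP[ax xb].
  pose d := Num.min (x - a) (b - x).
  have d0 : 0 < d by rewrite lt_min !subr_gt0 ax xb.
  have [n nE] : exists n, e n <= d.
    pose n := Num.truncn ((b - a) / d).
    exists n; rewrite /e ler_pdivrMr // mulrC -ler_pdivrMr //.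
    apply: ltW; apply: lt_le_trans (truncnS_gt _) _.
    by rewrite ler_nat.
  exists n => //; rewrite /A /= in_itv /=.
  by move: nE; rewrite le_min => /andP[? ?]; apply/andP; split; arith.
rewrite -UA; apply: (@le_lt_trans _ _ (2 * C)%:E); last exact: ltry.
have cvgI : (\int[mu]_(x in A i) `|(EFin \o dY) x|)%E @[i --> \oo] -->
    (\int[mu]_(x in \bigcup_i A i) `|(EFin \o dY) x|)%E.
  apply: ge0_nondecreasing_set_cvg_integral; last 1 first.
  - by move=> n x _; exact: abse_ge0.
  - apply/nondecreasing_seqP => n; apply/subsetPset => x; rewrite /A /= !in_itv /=.
    have : e n.+1 <= e n.
      by rewrite ler_pM2l ?subr_gt0 // lef_pV2 ?posrE // ler_nat.
    by move=> ? /andP[? ?]; apply/andP; split; arith.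
  - by move=> n; exact: measurable_itv.
  - move=> n; apply/measurable_EFinP; apply: measurableT_comp => //.
    apply: measurable_funS (mcont _ cdY) => //; rewrite -UA; exact: bigcup_sup.
apply: (cvge_to_le cvgI).
near=> n.
  have en : a + e n <= b - e n by have := e2 n; arith.
  have /= -> : (\int[mu]_(x in A n) `|(EFin \o dY) x| =
      \int[mu]_(x in A n) (dY x)%:E)%E.
    apply: eq_integral => x; rewrite inE /A /= in_itv /= => /andP[].
    move=> /Ain /[apply] -[ax xb]; congr EFin; apply: ger0_norm.
    exact: le_trans (normr_ge0 _) (fdY _ ax xb).
  have cA x : a + e n <= x -> x <= b - e n -> {for x, continuous dY}.
    by move=> /Ain /[apply] -[]; exact: cdY.
  rewrite integral_EFin; last exact: cont_integrable.
  have dA x : a + e n <= x -> x <= b - e n -> is_derive x 1 Y (dY x).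
    by move=> /Ain /[apply] -[]; exact: dYx.
  rewrite lee_fin (ftc2 en dA cA).
  have [? ?] := Ain n _ (lexx _) en.
  have [? ?] := Ain n _ en (lexx _).
  have : `|Y (a + e n)| <= C by exact: YC.
  have : `|Y (b - e n)| <= C by exact: YC.
  by rewrite !ler_norml => /andP[? ?] /andP[? ?]; arith.
Unshelve. all: by end_near. Qed.

Lemma potentialE (F : R -> R) (t : R) : potential F t = 2 * prim F t.
Proof. by []. Qed.

Lemma dpotential (F : R -> R) (t : R) : continuous F ->
  is_derive t 1 (potential F) (2 * F t).
Proof.
move=> cF; rewrite (_ : potential F = fun y => 2 * prim F y) //.
apply: derE; first by der; exact: dprim.
by rewrite mul0r add0r.
Qed.

Lemma potential0 (F : R -> R) : potential F 0 = 0.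
Proof. by rewrite potentialE prim0 mulr0. Qed.

End Integrals.

(** * Continuous functions: bounds, hitting points, one-sided monotonicity *)

Section RealFunctions.
Variable R : realType.
Implicit Types (f g : R -> R) (x a b : R).

Lemma cont_bounded f a b :
  (forall x, a <= x -> x <= b -> {for x, continuous f}) ->
  exists2 C : R, 0 < C & forall x, a <= x -> x <= b -> `|f x| <= C.
Proof.
move=> cf; have [ab|ba] := leP a b; last first.
  by exists 1 => // x ax xb; move: (le_trans ax xb); rewrite leNgt ba.
have [c _ Hc] := EVT_max ab (within_itv cf).
have [d _ Hd] := EVT_min ab (within_itv cf).
exists (`|f c| + `|f d| + 1) => [|x ax xb]; first by rewrite ltr_wpDl // addr_ge0.
have xab : x \in `[a, b]%R by rewrite in_itv /= ax xb.
have /= := Hc x xab; have /= := Hd x xab; rewrite ler_norml.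
have := ler_norm (f c); have := ler_norm (- f d); rewrite normrN.
have := normr_ge0 (f c); have := normr_ge0 (f d) => ? ? ? ? ? ?.
by apply/andP; split; arith.
Qed.

Lemma cont_near f x e : 0 < e -> {for x, continuous f} ->
  exists2 d : R, 0 < d & forall y, `|y - x| < d -> `|f y - f x| < e.
Proof.
move=> e0 /cvgrPdist_lt /(_ _ e0) /nbhs_ballP[d /= d0 H]; exists d => // y yd.
by rewrite distrC; apply: H; rewrite /ball /= distrC.
Qed.

Lemma le_divXn (c a t : R) n : 0 <= c -> 0 < a -> a <= t -> c / t ^+ n <= c / a ^+ n.
Proof.
move=> c0 a0 at_; have t0 := lt_le_trans a0 at_.
apply: ler_wpM2l => //; rewrite lef_pV2 ?posrE ?exprn_gt0 //.
by apply: lerXn2r => //; rewrite nnegrE; exact: ltW.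
Qed.

Lemma sqr_le (x y : R) : 0 <= x -> x <= y -> x ^+ 2 <= y ^+ 2.
Proof. by move=> x0 xy; apply: lerXn2r; rewrite // nnegrE // (le_trans x0). Qed.

Lemma cont_divsq (c x : R) : 0 < x -> {for x, continuous (fun y : R => c / y ^+ 2)}.
Proof.
move=> x0; have x2 : x ^+ 2 != 0 by rewrite sqrf_eq0 gt_eqF.
have D := dV (f := fun y : R => y ^+ 2) x2 (dX 1 (did x)).
exact: (is_derive_continuous (dM (dcst c x) D)).
Qed.

Lemma cont_sq f x : {for x, continuous f} -> {for x, continuous (fun y => f y ^+ 2)}.
Proof.
move=> cf; apply: (@continuous_comp _ _ _ f (fun z : R => z ^+ 2)) => //.
exact: exprn_continuous.
Qed.

Lemma cont_powR (s x : R) : 0 < x -> {for x, continuous (fun y : R => y `^ s)}.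
Proof. by move=> x0; apply: is_derive_continuous; exact: dpow. Qed.

(** [c] is the supremum of the points up to which [f] stays below [M]. The bound on all of [[a, c]],
    which goes beyond the intermediate value theorem, is what the monotonicity of the solution
    requires. *)
Lemma first_hit f a b (M : R) :
  (forall x, a <= x -> x <= b -> {for x, continuous f}) -> a <= b ->
  f a < M -> M <= f b ->
  exists c, [/\ a < c, c <= b, f c = M &
                forall x, a <= x -> x <= c -> f x <= M].
Proof.
move=> cf ab fa fb.
pose S : set R := [set t | [/\ a <= t, t <= b & forall s, a <= s -> s <= t -> f s <= M]].
have Sa : S a.
  by split=> // s ? ?; rewrite (_ : s = a) ?ltW //; apply/eqP; rewrite eq_le; apply/andP.
have hS : has_sup S.
  by split; [exists a|exists b => t []].
pose c : R := sup S.
have ac : a <= c by apply: sup_upper_bound.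
have cb : c <= b by apply: ge_sup => [|t []//]; exists a.
have low t : a <= t -> t < c -> f t <= M.
  move=> at_ tc; have [s [as_ sb Hs] ts] := sup_adherent (eps := c - t) (ltac:(lra)) hS.
  by apply: Hs => //; rewrite /c in ts *; arith.
have fcM : f c <= M.
  rewrite leNgt; apply/negP => Mfc.
  have [d d0 Hd] := cont_near (e := f c - M) (ltac:(lra)) (cf c ac cb).
  have [ca|ca] := leP c a.
    by move: Mfc; rewrite (_ : c = a) ?ltNge ?ltW //; apply/eqP; rewrite eq_le ca.
  pose t := c - Num.min d (c - a) / 2.
  have m0 : 0 < Num.min d (c - a) by rewrite lt_min d0 subr_gt0.
  have md : Num.min d (c - a) <= d by rewrite ge_min lexx.
  have mc : Num.min d (c - a) <= c - a by rewrite ge_min lexx orbT.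
  have := low t (ltac:(rewrite /t; lra)) (ltac:(rewrite /t; lra)).
  have /Hd : `|t - c| < d by rewrite ltr_norml /t; apply/andP; split; arith.
  by rewrite ltr_norml => /andP[? ?] ?; arith.
have fcE : f c = M.
  apply/eqP; rewrite eq_le fcM leNgt; apply/negP => fcM'.
  have [d d0 Hd] := cont_near (e := M - f c) (ltac:(lra)) (cf c ac cb).
  have cb' : c < b by rewrite lt_neqAle cb andbT; apply: contraTneq fcM' => ->; rewrite -leNgt.
  pose t := c + Num.min d (b - c) / 2.
  have m0 : 0 < Num.min d (b - c) by rewrite lt_min d0 subr_gt0.
  have md : Num.min d (b - c) <= d by rewrite ge_min lexx.
  have mc : Num.min d (b - c) <= b - c by rewrite ge_min lexx orbT.
  have St : S t.
    rewrite /t; split; [arith|arith|move=> s as_ st].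
    have [sc|cs] := ltP s c; first exact: low.
    have /Hd : `|s - c| < d by rewrite ltr_norml; apply/andP; split; arith.
    by rewrite ltr_norml => /andP[? ?]; arith.
  have := sup_upper_bound hS St; rewrite -/c /t; arith.
exists c; split=> //.
  by rewrite lt_neqAle ac andbT; apply: contraTneq fa => ->; rewrite fcE ltxx.
move=> x ax; rewrite le_eqVlt => /predU1P[->|xc]; [by rewrite fcE|exact: low].
Qed.

(** Reduces to [first_hit] by the point reflection [y |-> - f (- y)]. *)
Lemma last_hit f a b (M : R) :
  (forall x, a <= x -> x <= b -> {for x, continuous f}) -> a <= b ->
  f a <= M -> M < f b ->
  exists c, [/\ a <= c, c < b, f c = M &
                forall x, c <= x -> x <= b -> M <= f x].
Proof.
move=> cf ab fa fb.
have [||||c [c1 c2 c3 c4]] := @first_hit (fun y => - f (- y)) (- b) (- a) (- M).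
- move=> x xb xa; apply: continuousN; apply: (@continuous_comp _ _ _ -%R f).
    exact: continuousN.
  by apply: cf; arith.
- by rewrite lerN2.
- by rewrite opprK ltrN2.
- by rewrite opprK lerN2.
exists (- c); split; [arith|arith|by rewrite -[f _]opprK c3 opprK|].
by move=> x cx xb; rewrite -lerN2; have := c4 (- x); rewrite opprK; apply; arith.
Qed.

Lemma C1_lipschitz (F : R -> R) a b : class_C1 F ->
  exists2 L : R, 0 < L & forall s t, a <= s -> s <= b -> a <= t -> t <= b ->
    `|F s - F t| <= L * `|s - t|.
Proof.
move=> [dF cF]; have [|L L0 HL] := @cont_bounded (F^`()) a b.
  by move=> x _ _; exact: cF.
exists L => // s t.
wlog ts : s t / t <= s => [W|].
  by move=> ? ? ? ?; have [ts|/ltW st] := leP t s; [exact: W|rewrite distrC [in leRHS]distrC; exact: W].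
move=> as_ sb at_ tb; move: ts; rewrite le_eqVlt => /predU1P[->|ts].
  by rewrite !subrr normr0 mulr0.
have [|c [tc cs ->]] := @mvt R F (F^`()) t s ts.
  by move=> x _ _; exact: derive1P.
by rewrite normrM ler_wpM2r // HL; arith.
Qed.

Lemma powR_bounds (p a b : R) : 0 < a ->
  exists m M : R, [/\ 0 < m, 0 < M &
    forall x, a <= x -> x <= b -> m <= x `^ p /\ x `^ p <= M].
Proof.
move=> a0.
have cp (s x : R) : a <= x -> {for x, continuous (fun y : R => y `^ s)}.
  by move=> ax; apply: is_derive_continuous; exact: (dpow s (lt_le_trans a0 ax)).
have [M M0 HM] := @cont_bounded (fun y => y `^ p) a b (fun x ax _ => cp p x ax).
have [N N0 HN] := @cont_bounded (fun y => y `^ (- p)) a b (fun x ax _ => cp (- p) x ax).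
exists N^-1, M; split=> //; first by rewrite invr_gt0.
move=> x ax xb; have x0 := lt_le_trans a0 ax.
have := HN x ax xb; have := HM x ax xb; rewrite !ger0_norm ?powR_ge0 // => -> H.
by split=> //; rewrite -[leRHS]invrK lef_pV2 ?posrE ?invr_gt0 ?powR_gt0 // -powRN.
Qed.

Lemma nondecr_der_ge0 f x a e : 0 < e -> is_derive x 1 f a ->
  (forall y, x < y -> y < x + e -> f x <= f y) -> 0 <= a.
Proof.
move=> e0 fa fx; rewrite leNgt; apply/negP => a0.
have L : (fun h : R => h^-1 *: (f (h + x) - f x)) @ 0^' --> a.
  have [dd <-] := fa.
  have : (fun h : R => h^-1 *: ((f \o shift x) (h *: 1) - f x)) @ 0^' --> 'D_1 f x.
    exact: dd.
  by under eq_fun do rewrite /= [_ *: 1]mulr1.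
have : \forall h \near 0^', h^-1 *: (f (h + x) - f x) < 0 by exact: (cvgr_lt _ L).
rewrite near_withinE => /nbhs_ballP[d /= d0 H].
pose h := Num.min d e / 2.
have m0 : 0 < Num.min d e by rewrite lt_min d0 e0.
have md : Num.min d e <= d by rewrite ge_min lexx.
have me : Num.min d e <= e by rewrite ge_min lexx orbT.
have h0 : 0 < h by rewrite /h; arith.
have := H h; rewrite /ball /= sub0r normrN gtr0_norm // gt_eqF //=.
move=> /(_ (ltac:(rewrite /h; lra)) isT).
rewrite /GRing.scale /= pmulr_rlt0 ?invr_gt0 // subr_lt0 ltNge fx //.
  by rewrite addrC ltrDl.
by rewrite /h; arith.
Qed.

End RealFunctions.

(** * The ordinary differential equation *)

Section Interval0.
Variables (R : realType) (Rad : \bar R).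
Implicit Types x y : R.
Local Notation I := (interval0 Rad).

Lemma interval0_conv x y z : I x -> I y -> x <= z -> z <= y -> I z.
Proof.
move=> [x0 _] [_ yR] xz zy; split; first exact: lt_le_trans xz.
by apply: le_lt_trans yR; rewrite lee_fin.
Qed.

Lemma interval0_pos x : I x -> 0 < x. Proof. by case. Qed.

Lemma interval0_left x y : I x -> 0 < y -> y <= x -> I y.
Proof. by move=> [_ xR] y0 yx; split=> //; apply: le_lt_trans xR; rewrite lee_fin. Qed.

Lemma interval0_right x : I x -> exists2 y, I y & x < y.
Proof.
move=> [x0]; case: Rad => [b||] // xR.
  by exists ((x + b) / 2); [split|]; rewrite ?lte_fin; move: xR; rewrite lte_fin; arith.
by exists (x + 1); [split; rewrite ?ltry //|]; arith.
Qed.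

Lemma interval0_nbhs x : I x ->
  exists2 e : R, 0 < e & forall y, `|y - x| < e -> I y.
Proof.
move=> Ix; have [y Iy xy] := interval0_right Ix; have x0 := interval0_pos Ix.
exists (Num.min (y - x) (x / 2)) => [|z]; first by rewrite lt_min; apply/andP; split; arith.
rewrite lt_min => /andP[]; rewrite !ltr_norml => /andP[? ?] /andP[? ?].
by apply: (@interval0_left y); [|arith|arith].
Qed.

Lemma open_interval0 : open I.
Proof.
rewrite openE => x /interval0_nbhs[e e0 H]; apply/nbhs_ballP.
by exists e => //= y yx; apply: H; rewrite distrC.
Qed.

Lemma interval0_nonempty : (0 < Rad)%E -> exists x, I x.
Proof.
case: Rad => [b||] //; rewrite ?lte_fin => b0.
  by exists (b / 2); split; rewrite ?lte_fin; arith.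
by exists 1; split; rewrite ?ltry.
Qed.

(** Puts a finite and an infinite end into the same form; only the estimate of the right transition
    zone distinguishes them later. *)
Lemma end_valueP (u : R -> R) (s e : R) : (0 < Rad)%E -> end_value Rad u s ->
  0 < e -> exists2 x, I x & forall y, I y -> x <= y -> `|u y - s| < e.
Proof.
rewrite /end_value /interval0; case: Rad => [b||] //.
- rewrite lte_fin => b0 /cvgrPdist_lt /[apply].
  rewrite near_withinE => /nbhs_ballP[d /= d0 H].
  pose m := Num.min d b.
  have m0 : 0 < m by rewrite lt_min d0.
  have md : m <= d by rewrite ge_min lexx.
  have mb : m <= b by rewrite ge_min lexx orbT.
  exists (b - m / 2) => [|y [y0 yb] my]; rewrite ?lte_fin; first by split; arith.
  rewrite distrC; apply: H; last by rewrite lte_fin in yb.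
  by rewrite /ball /= ger0_norm; rewrite lte_fin in yb; arith.
- move=> _ /cvgrPdist_lt /[apply]; rewrite /= => -[M [Mr H]].
  exists (`|M| + 1) => [|y _ My]; first by split; rewrite ?ltry // ltr_wpDl.
  rewrite distrC; apply: H; rewrite (le_lt_trans (ler_norm M)) //.
  by apply: lt_le_trans My; rewrite ltrDl.
Qed.

Lemma at_rightP (u : R -> R) (s e : R) : u x @[x --> 0^'+] --> s -> 0 < e ->
  exists2 d : R, 0 < d & forall y, 0 < y -> y < d -> `|u y - s| < e.
Proof.
move=> /cvgrPdist_lt /[apply]; rewrite near_withinE => /nbhs_ballP[d /= d0 H].
exists d => // y y0 yd; rewrite distrC; apply: H => //.
by rewrite /ball /= sub0r normrN gtr0_norm.
Qed.

End Interval0.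

(** The equation solved for the second derivative: each use gives at once the differentiability of
    [u] and [u1] and the values of their derivatives. *)
Definition ode (R : realType) (Rad : \bar R) (p q : R) (F u u1 : R -> R) : Prop :=
  forall r, interval0 Rad r ->
    is_derive r 1 u (u1 r) /\
    is_derive r 1 u1 (q / r ^+ 2 * u r - p / r * u1 r + F (u r)).

Section Ode.
Variables (R : realType) (Rad : \bar R) (p q : R) (F : R -> R).
Hypothesis cF : continuous F.
Implicit Types u : R -> R.
Local Notation I := (interval0 Rad).

Lemma ode_cont u (u1 : R -> R) r : ode Rad p q F u u1 -> I r -> {for r, continuous u}.
Proof. by move=> H /H[/is_derive_continuous]. Qed.

Lemma ode_cont1 u (u1 : R -> R) r : ode Rad p q F u u1 -> I r -> {for r, continuous u1}.
Proof. by move=> H /H[_ /is_derive_continuous]. Qed.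

(** Divergence form of the equation: [r^p] is the integrating factor of the first-order term. *)
Lemma ode_flux u (u1 : R -> R) r : ode Rad p q F u u1 -> I r ->
  is_derive r 1 (fun x => x `^ p * u1 x) (r `^ p * (q / r ^+ 2 * u r + F (u r))).
Proof.
move=> H Ir; have [_ D] := H r Ir; have r0 := interval0_pos Ir.
apply: derE; first by der.
by field; rewrite gt_eqF.
Qed.

(** While [u] is bounded, the flux [r^p u'] has a bounded derivative, so it grows at most linearly.
    Here [b] may be the end of the interval, where continuity of [u1] gives nothing. *)
Lemma ode_der_bounded u (u1 : R -> R) (a b V : R) : ode Rad p q F u u1 -> I a ->
  (b%:E <= Rad)%E -> (forall r, a <= r -> r < b -> `|u r| <= V) ->
  exists2 C : R, 0 < C & forall r, a <= r -> r < b -> `|u1 r| <= C.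
Proof.
move=> Hu Ia bR uV; have a0 := interval0_pos Ia.
have Iab r : a <= r -> r < b -> I r.
  move=> ar rb; split; first exact: lt_le_trans ar.
  by apply: lt_le_trans bR; rewrite lte_fin.
have [m [M [m0 M0 mM]]] := powR_bounds p b a0.
have [K K0 HK] : exists2 K : R, 0 < K & forall x, - V <= x -> x <= V -> `|F x| <= K.
  by apply: cont_bounded => x _ _; exact: cF.
pose D := M * (`|q| / a ^+ 2 * V + K).
pose W x := x `^ p * u1 x.
have [ab|ba] := ltP a b; last first.
  by exists 1 => // r ar rb; move: (le_lt_trans ar rb); rewrite ltNge ba.
have ba0 : 0 <= b - a by rewrite subr_ge0 ltW.
have V0 : 0 <= V by apply: le_trans (uV a (lexx _) ab).
have D0 : 0 <= D.
  by rewrite mulr_ge0 ?ltW // ltr_wpDl // mulr_ge0 // divr_ge0 // exprn_ge0 // ltW.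
exists ((`|W a| + D * (b - a) + 1) / m) => [|r ar rb].
  by rewrite divr_gt0 // ltr_wpDl // addr_ge0 // mulr_ge0.
have Wr : `|W r| <= `|W a| + D * (b - a).
  move: ar; rewrite le_eqVlt => /predU1P[<-|ar].
    by rewrite lerDl mulr_ge0.
  have [c [ac cr E]] := @mvt R W _ a r ar (fun x ax xr =>
    ode_flux Hu (Iab x ax (le_lt_trans xr rb))).
  rewrite -[W r](subrK (W a)) E (le_trans (ler_normD _ _)) // addrC lerD2l.
  have cb := lt_trans cr rb.
  rewrite normrM [X in _ * X]gtr0_norm ?subr_gt0 //.
  apply: ler_pM => //; [by rewrite subr_ge0 ltW|idtac|by rewrite lerD2r ltW].
  have [_ cM] := mM c (ltW ac) (ltW cb).
  rewrite normrM ger0_norm ?powR_ge0 //; apply: ler_pM => //; first exact: powR_ge0.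
  rewrite (le_trans (ler_normD _ _)) //; apply: lerD.
    rewrite !normrM; apply: ler_pM => //; last by apply: uV => //; exact: ltW.
    rewrite ler_wpM2l // normfV lef_pV2 ?posrE ?exprn_gt0 ?normr_gt0 ?gt_eqF ?exprn_gt0 ?(lt_trans a0 ac) //.
    by rewrite ger0_norm ?exprn_ge0 ?(ltW (lt_trans a0 ac)) // lerXn2r ?nnegrE ?ltW // (lt_trans a0 ac).
  have := uV c (ltW ac) cb; rewrite ler_norml => /andP[? ?]; exact: HK.
have [mr _] := mM r ar (ltW rb).
have rp0 : 0 < r `^ p by exact: lt_le_trans mr.
rewrite ler_pdivlMr // mulrC.
apply: (@le_trans _ _ (r `^ p * `|u1 r|)); first by rewrite ler_wpM2r.
rewrite -[X in X * _]gtr0_norm // -normrM -/(W r); arith.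
Qed.

End Ode.

Lemma nonneg_solution_ode (R : realType) (Rad : \bar R) (sp p q : R) (F u : R -> R) :
  nonneg_solution Rad sp p q F u -> ode Rad p q F u u^`().
Proof.
move=> [H _ _ _] r Ir; have [d1 d2 E] := H r Ir; split; first exact: derive1P.
apply: derE; first exact: derive1P d2.
by move: E; rewrite derive1nS derive1n1 => <-; ring.
Qed.

(** * Bounds, positivity and monotonicity of the non-negative solution *)

Section NonnegSolution.
Variables (R : realType) (Rad : \bar R) (sp p q : R) (F u u1 : R -> R).
Implicit Types r t e s c : R.
Hypotheses (hRad : (0 < Rad)%E) (hsp : 0 < sp) (hq : 0 < q) (hF : class_C1 F).
Hypotheses (hF0 : F 0 = 0) (hFsp : F sp = 0).
Hypothesis hFneg : forall t, 0 < t -> t < sp -> F t < 0.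
Hypothesis hFpos : forall t, sp < t -> 0 <= F t.
Local Notation I := (interval0 Rad).
Hypotheses (hu : ode Rad p q F u u1) (hu0 : u x @[x --> 0^'+] --> 0).
Hypotheses (hus : end_value Rad u sp) (hupos : forall r, I r -> 0 <= u r).

Let cF : continuous F.
Proof. by move=> x; exact: (is_derive_continuous (derive1P (proj1 hF x))). Qed.

Let cu r : I r -> {for r, continuous u}. Proof. exact: (ode_cont hu). Qed.
Let du r : I r -> is_derive r 1 u (u1 r). Proof. by move=> /hu[]. Qed.

(** At a local maximum [u' = 0] and [u'' <= 0], whereas at a height of at least [sp] the equation
    gives [u'' >= q / c^2 u > 0]. *)
Lemma sol_local_max c e : I c -> 0 < e -> (forall y, `|y - c| < e -> u y <= u c) ->
  u c < sp.
Proof.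
move=> Ic e0 H; rewrite ltNge; apply/negP => spu.
have [d d0 Hd] := interval0_nbhs Ic.
have m0 : 0 < Num.min d e by rewrite lt_min d0.
have [||u10 u2] := max_der2 (f := u) (df := u1) m0 _ _ (hu Ic).2.
- by move=> y; rewrite lt_min => /andP[_]; exact: H.
- by move=> y; rewrite lt_min => /andP[+ _] => /Hd; exact: du.
have : 0 < q / c ^+ 2 * u c.
  by rewrite mulr_gt0 ?divr_gt0 ?exprn_gt0 ?(interval0_pos Ic) // (lt_le_trans hsp).
have : 0 <= F (u c).
  by move: spu; rewrite le_eqVlt => /predU1P[<-|/hFpos //]; rewrite hFsp.
by move: u2; rewrite u10 mulr0 => *; arith.
Qed.

Let near0 e : 0 < e -> exists2 x, I x & forall y, 0 < y -> y <= x -> `|u y| < e.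
Proof.
move=> e0; have [d d0 Hd] := at_rightP hu0 e0.
have [x Ix] := interval0_nonempty hRad; have x0 := interval0_pos Ix.
have m0 : 0 < Num.min d x by rewrite lt_min d0.
have md : Num.min d x <= d by rewrite ge_min lexx.
have mx : Num.min d x <= x by rewrite ge_min lexx orbT.
exists (Num.min d x / 2) => [|y y0 yd]; first by apply: (interval0_left Ix); arith.
by rewrite -[u y]subr0; apply: Hd => //; arith.
Qed.

(** A value above [sp] would exceed both boundary values 0 and [sp], so it would force an interior
    maximum above [sp]. *)
Lemma sol_le r : I r -> u r <= sp.
Proof.
move=> Ir; rewrite leNgt; apply/negP => ur; have r0 := interval0_pos Ir.
have [x Ix Hx] := near0 (lt_trans hsp ur).
have [z Iz Hz] := @end_valueP _ _ u sp (u r - sp) hRad hus (ltac:(lra)).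
pose a := Num.min x r; pose b := Num.max z r.
have a0 : 0 < a by rewrite lt_min (interval0_pos Ix).
have ar : a <= r by rewrite ge_min lexx orbT.
have rb : r <= b by rewrite le_max lexx orbT.
have Ib : I b by rewrite /b; case: leP.
have Iab t : a <= t -> t <= b -> I t.
  by move=> at_; apply: interval0_left Ib _; exact: lt_le_trans at_.
have [c] := EVT_max (le_trans ar rb) (within_itv (fun t ta tb => cu (Iab t ta tb))).
rewrite in_itv /= => /andP[ac cb] Hc.
have urc : u r <= u c by apply: Hc; rewrite in_itv /= ar rb.
have xc : x < c.
  rewrite ltNge; apply/negP => cx; have := Hx c (lt_le_trans a0 ac) cx.
  by rewrite ltr_norml => /andP[_]; rewrite ltNge urc.
have cz : c < z.
  rewrite ltNge; apply/negP => zc; have := Hz c (Iab c ac cb) zc.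
  by rewrite ltr_norml => /andP[_]; rewrite ltrD2r ltNge urc.
have ac' : a < c by rewrite (le_lt_trans _ xc) // ge_min lexx.
have cb' : c < b by rewrite (lt_le_trans cz) // le_max lexx.
have m0 : 0 < Num.min (c - a) (b - c) by rewrite lt_min !subr_gt0 ac'.
have : u c < sp.
  apply: (sol_local_max (Iab c ac cb) m0) => y; rewrite lt_min => /andP[].
  rewrite !ltr_norml => /andP[? ?] /andP[? ?]; apply: Hc; rewrite in_itv /=.
  by apply/andP; split; arith.
by rewrite ltNge (ltW (lt_le_trans ur urc)).
Qed.

(** By [sol_le], a point at height [sp] would be a local maximum. *)
Lemma sol_lt r : I r -> u r < sp.
Proof.
move=> Ir; rewrite lt_neqAle sol_le // andbT; apply/negP => /eqP E.
have [e e0 He] := interval0_nbhs Ir.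
have := sol_local_max Ir e0; rewrite E ltxx => H.
by suff : false by []; apply: H => y /He; exact: sol_le.
Qed.

(** Lipschitz bound around the zero of [F] at 0. A lower bound linear in [t] is what the singular
    term [q / r^2 u] can absorb near the origin. *)
Lemma F_lower : exists2 L : R, 0 < L & forall t, 0 <= t -> t <= sp ->
  - (L * t) <= F t /\ F t <= 0.
Proof.
have [L L0 HL] := @C1_lipschitz R F 0 sp hF; exists L => // t t0 ts.
have := HL t 0 t0 ts (lexx _) (ltW hsp); rewrite hF0 !subr0 ler_norml => /andP[+ _].
rewrite ger0_norm // => ->; split=> //.
move: t0; rewrite le_eqVlt => /predU1P[<-|t0]; first by rewrite hF0.
move: ts; rewrite le_eqVlt => /predU1P[->|ts]; first by rewrite hFsp.
exact/ltW/hFneg.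
Qed.

(* Unique continuation: [u^2 + u'^2] satisfies a Gronwall inequality. *)
Lemma sol_pos r : I r -> 0 < u r.
Proof.
move=> Ir; rewrite lt_neqAle hupos // andbT; apply/negP => /eqP/esym ur0.
have [e e0 He] := interval0_nbhs Ir.
have u1r : u1 r = 0.
  have := @max_der R (fun y => - u y) r (- u1 r) e e0.
  rewrite ur0 oppr0 => H; apply/eqP; rewrite -oppr_eq0; apply/eqP; apply: H.
  - by move=> y /He/hupos; rewrite oppr_le0.
  - exact: dN (du Ir).
  - by move=> y /He/du/dN[].
have [L L0 HL] := F_lower.
have vanish s : I s -> u s = 0.
  move=> Is; pose a := Num.min r s; pose b := Num.max r s.
  have Ia : I a by rewrite /a; case: leP.
  have Ib : I b by rewrite /b; case: leP.
  have a0 := interval0_pos Ia.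
  have Iab t : a <= t -> t <= b -> I t.
    by move=> at_; apply: interval0_left Ib _; exact: lt_le_trans at_.
  (* Every term of [dw] is a multiple of [2 |u u'|], which is at most [w], except the one with [p],
     a multiple of [u'^2]. *)
  pose K := 1 + q / a ^+ 2 + L + 2 * (`|p| / a).
  pose w t := u t ^+ 2 + u1 t ^+ 2.
  pose dw t := 2 * (u t * u1 t) + 2 * (u1 t * (q / t ^+ 2 * u t - p / t * u1 t + F (u t))).
  have Dw t : I t -> is_derive t 1 w (dw t).
    move=> /hu[D1 D2]; rewrite /w; deriv.
    by rewrite /dw; ring.
  have w0 t : 0 <= w t by rewrite addr_ge0 ?sqr_ge0.
  have wr : w r = 0 by rewrite /w ur0 u1r expr0n addr0.
  have dwb t : a <= t -> t <= b -> `|dw t| <= K * w t.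
    move=> at_ tb; have It := Iab t at_ tb.
    have t0 := interval0_pos It.
    pose A := `|u t|; pose B := `|u1 t|.
    have A0 : 0 <= A by exact: normr_ge0.
    have B0 : 0 <= B by exact: normr_ge0.
    have AB : 2 * (A * B) <= w t.
      rewrite /w -[u t ^+ 2]real_normK ?num_real // -[u1 t ^+ 2]real_normK ?num_real //.
      rewrite -subr_ge0 (_ : _ - _ = (A - B) ^+ 2) ?sqr_ge0 //.
      by rewrite /A /B; ring.
    have BB : B * B <= w t.
      by rewrite /B -expr2 real_normK ?num_real // /w lerDr sqr_ge0.
    have FA : `|F (u t)| <= L * A.
      have [F1 F2] := HL _ (hupos It) (sol_le It).
      by rewrite ler0_norm // /A ger0_norm ?hupos // lerNl.
    have qt : `|q / t ^+ 2 * u t| <= q / a ^+ 2 * A.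
      rewrite normrM ler_wpM2r // ger0_norm; first by apply: le_divXn => //; exact: ltW.
      by rewrite divr_ge0 ?sqr_ge0 // ltW.
    have pt : `|p / t * u1 t| <= `|p| / a * B.
      rewrite !normrM ler_wpM2r // ler_wpM2l // normfV gtr0_norm // lef_pV2 ?posrE //.
    have : `|dw t| <= 2 * (A * B) + 2 * (B * (q / a ^+ 2 * A + `|p| / a * B + L * A)).
      rewrite /dw (le_trans (ler_normD _ _)) // lerD //.
        by rewrite !normrM ger0_norm.
      rewrite normrM ger0_norm // ler_wpM2l // normrM ler_wpM2l //.
      rewrite (le_trans (ler_normD _ _)) // lerD // (le_trans (ler_normB _ _)) //.
      exact: lerD.
    move/le_trans; apply.
    have qa0 : 0 <= q / a ^+ 2 by rewrite divr_ge0 ?sqr_ge0 // ltW.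
    have pa0 : 0 <= `|p| / a by rewrite divr_ge0 // ltW.
    have ringE (X Y : R) : 2 * (A * B) + 2 * (B * (X * A + Y * B + L * A)) =
      (1 + X + L) * (2 * (A * B)) + 2 * Y * (B * B) by ring.
    rewrite ringE.
    rewrite /K [in leRHS]mulrDl lerD // ler_wpM2l //.
      by rewrite addr_ge0 // ?addr_ge0 // ltW.
    by rewrite mulr_ge0.
  have dexp (k t : R) : is_derive t 1 (fun t => expR (k * t)) (expR (k * t) * k).
    eapply derE; [eapply (@dcomp _ expR (fun t => k * t)); [exact: is_derive_expR|der]|].
    by ring.
  have De k t : I t -> is_derive t 1 (fun t => w t * expR (k * t))
      ((dw t + k * w t) * expR (k * t)).
    by move=> /Dw D; eapply derE; [eapply dM; [exact: D|exact: dexp]|cbv beta; ring].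
  have ws : w s = 0.
    apply/eqP; rewrite eq_le w0 andbT.
    (* To the right of [r] the function [w exp (- K t)] is nonincreasing, to its left [w exp (K t)]
       is nondecreasing; both vanish at [r]. *)
    have [rs|sr] := leP r s.
      have [ea eb] : a = r /\ b = s by rewrite /a /b; case: leP rs.
      have := @nonincr_der R _ _ r s rs (fun t rt ts => De (- K) t
         (Iab t (ltac:(rewrite ea; exact: rt)) (ltac:(rewrite eb; exact: ts)))).
      rewrite wr mul0r pmulr_lle0 ?expR_gt0 //; apply => t rt ts.
      rewrite pmulr_lle0 ?expR_gt0 // mulNr subr_le0.
      apply: le_trans (ler_norm _) _; apply: dwb; rewrite ?ea ?eb; exact: ltW.
    have [ea eb] : a = s /\ b = r by rewrite /a /b; case: leP sr.
    have := @nondecr_der R _ _ s r (ltW sr) (fun t st tr => De K t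
       (Iab t (ltac:(rewrite ea; exact: st)) (ltac:(rewrite eb; exact: tr)))).
    rewrite wr mul0r pmulr_lle0 ?expR_gt0 //; apply => t st tr.
    rewrite pmulr_lge0 ?expR_gt0 // -lerBlDr sub0r.
    have : `|dw t| <= K * w t by apply: dwb; rewrite ?ea ?eb; exact: ltW.
    by rewrite ler_norml => /andP[].
  by apply/eqP; move/eqP: ws; rewrite paddr_eq0 ?sqr_ge0 // sqrf_eq0 => /andP[].
have [x Ix Hx] := end_valueP hRad hus hsp.
by have := Hx x Ix (lexx _); rewrite vanish // sub0r normrN gtr0_norm // ltxx.
Qed.

Lemma prim_decr s t : 0 <= s -> s < t -> t <= sp -> prim F t < prim F s.
Proof.
move=> s0 st ts; rewrite -ltrN2.
apply: (@incr_der R (fun y => - prim F y) (fun y => - F y) s t) => // x sx xt.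
  exact: dN (dprim x cF).
by rewrite oppr_gt0; apply: hFneg; [exact: le_lt_trans sx|exact: lt_le_trans ts].
Qed.

Lemma prim_le s t : 0 <= s -> s <= t -> t <= sp -> prim F t <= prim F s.
Proof.
move=> s0; rewrite le_eqVlt => /predU1P[->//|st] ts; exact/ltW/prim_decr.
Qed.

(** Mechanical energy for the variable [s = log r], in which the equation reads
    [u_ss + (p - 1) u_s - q u = r^2 F u]. Taking for [m] the value of [prim F] at the height of an
    extremum gives the last term of [dQ] a sign and cancels that of [Q] when [u] is back at this
    height. *)
Let Q m r := (r * u1 r) ^+ 2 / 2 - q * u r ^+ 2 / 2 - r ^+ 2 * (prim F (u r) - m).
Let dQ m r := (1 - p) * (r * u1 r ^+ 2) - 2 * (r * (prim F (u r) - m)).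

Let DQ m r : I r -> is_derive r 1 (Q m) (dQ m r).
Proof.
move=> Ir; have [D1 D2] := hu Ir; have r0 := interval0_pos Ir.
have D3 := dprim (u r) cF.
rewrite /Q; deriv; rewrite /dQ.
by field; rewrite gt_eqF.
Qed.

Let conv a b t : I a -> I b -> a <= t -> t <= b -> I t.
Proof. exact: interval0_conv. Qed.

Let zero_der c e : 0 < e -> I c ->
  (forall y, `|y - c| < e -> I y) ->
  (forall y, `|y - c| < e -> u y <= u c) \/ (forall y, `|y - c| < e -> u c <= u y) ->
  u1 c = 0.
Proof.
move=> e0 Ic He [H|H].
  by apply: (max_der e0 H (du Ic)) => y /He/du[].
apply/eqP; rewrite -oppr_eq0; apply/eqP.
apply: (@max_der R (fun y => - u y) c (- u1 c) e) => //.
- by move=> y /H; rewrite lerN2.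
- exact: dN (du Ic).
- by move=> y /He/du/dN[].
Qed.

(* If [u] were not monotone, it would return to the value [M] of a local
   maximum (if [1 <= p]), or would have taken before the value [M] of a local
   minimum (if [p <= 1]); both contradict the monotonicity of [Q]. *)
Lemma sol_nondecr x y : I x -> I y -> x < y -> u x <= u y.
Proof.
move=> Ix Iy xy; rewrite leNgt; apply/negP => uyx.
have x0 := interval0_pos Ix; have y0 := interval0_pos Iy.
have upos r : I r -> 0 < u r by exact: sol_pos.
have [p1|/ltW p1] := leP 1 p.
- have [d Id Hd] := near0 (upos x Ix).
  have dx : d < x.
    rewrite ltNge; apply/negP => xd; have := Hd x x0 xd.
    by rewrite gtr0_norm ?upos // ltxx.
  have dy : d <= y by lra.
  (* The values at [d] and at [y] are below [u x], so the maximum is taken at an interior point. *)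
  have [a] := EVT_max dy (within_itv (fun t ta tb => cu (conv Id Iy ta tb))).
  rewrite in_itv /= => /andP[da ay] Ha.
  have uxa : u x <= u a by apply: Ha; rewrite in_itv /=; apply/andP; split; lra.
  have Ia := conv Id Iy da ay.
  have ady : a < y.
    by rewrite lt_neqAle ay andbT; apply: contraTneq uyx => <-; rewrite -leNgt.
  have dda : d < a.
    rewrite lt_neqAle da andbT; apply: contraTneq uxa => <-; rewrite -ltNge.
    by have := Hd d (interval0_pos Id) (lexx _); rewrite gtr0_norm ?upos.
  have m0 : 0 < Num.min (a - d) (y - a) by rewrite lt_min !subr_gt0 dda.
  have near_a t : `|t - a| < Num.min (a - d) (y - a) -> d <= t /\ t <= y.
    by rewrite lt_min !ltr_norml => /andP[/andP[? ?] /andP[? ?]]; split; lra.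
  have u1a : u1 a = 0.
    apply: (zero_der m0 Ia) => [t /near_a[]|]; first exact: conv.
    by left=> t /near_a[? ?]; apply: Ha; rewrite in_itv /=; apply/andP.
  have [z Iz Hz] := @end_valueP _ _ u sp (sp - u a) hRad hus
    (ltac:(have := sol_lt Ia; lra)).
  have uz t : I t -> z <= t -> u a < u t.
    by move=> It /(Hz t It); rewrite ltr_norml => /andP[? _]; lra.
  pose w := Num.max z y.
  have Iw : I w by rewrite /w; case: leP.
  have yw : y <= w by rewrite le_max lexx orbT.
  have zw : z <= w by rewrite le_max lexx.
  have uya : u y < u a by exact: lt_le_trans uxa.
  have [||b [yb bw ub Hb]] := first_hit (fun t ta tb => cu (conv Iy Iw ta tb)) yw (M := u a) => //.
    exact/ltW/uz.
  have Ib := conv Iy Iw (ltW yb) bw.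
  have Hab t : a <= t -> t <= b -> u t <= u a.
    move=> at_ tb; have [ty|yt] := leP t y; last by apply: Hb => //; exact: ltW.
    by apply: Ha; rewrite in_itv /=; apply/andP; split => //; lra.
  have dQle t : a <= t -> t <= b -> dQ (prim F (u a)) t <= 0.
    move=> at_ tb; have It := conv Ia Ib at_ tb.
    rewrite /dQ subr_le0; apply: (@le_trans _ _ 0).
      by rewrite mulr_le0_ge0 ?subr_le0 // mulr_ge0 ?sqr_ge0 // ltW // (interval0_pos It).
    rewrite !mulr_ge0 ?subr_ge0 ?(ltW (interval0_pos It)) //.
    by apply: prim_le; [exact/ltW/upos|exact: Hab|exact: sol_le].
  have dQlt : dQ (prim F (u a)) y < 0.
    have : 0 < y * (prim F (u y) - prim F (u a)).
      rewrite mulr_gt0 // subr_gt0; apply: prim_decr => //; first exact/ltW/upos.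
      exact: sol_le.
    have : (1 - p) * (y * u1 y ^+ 2) <= 0.
      by rewrite mulr_le0_ge0 ?subr_le0 // mulr_ge0 ?sqr_ge0 // ltW.
    rewrite /dQ; lra.
  have Qb t s : a <= s -> s <= t -> t <= b -> Q (prim F (u a)) t <= Q (prim F (u a)) s.
    move=> as_ st tb.
    apply: (@nonincr_der R _ (dQ (prim F (u a))) s t st) => v sv vt.
      by apply: DQ; apply: (conv Ia Ib); lra.
    by apply: dQle; lra.
  (* The heights at [a] and [b] agree and [u' a = 0], so the kinetic term makes [Q] at least as
     large at [b]. Being nonincreasing, [Q] is then constant on [[a, b]], against [dQlt] at [y]. *)
  have Qab : Q (prim F (u a)) a <= Q (prim F (u a)) b.
    rewrite /Q u1a ub mulr0 expr0n /= mul0r subrr !mulr0 !subr0 lerD2r.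
    by rewrite mulr_ge0 ?sqr_ge0.
  have Qcst t : a <= t -> t <= b -> Q (prim F (u a)) t = Q (prim F (u a)) a.
    move=> at_ tb; apply/eqP; rewrite eq_le; apply/andP; split; first exact: Qb.
    by apply: le_trans Qab _; apply: Qb => //; exact: lexx.
  have : 0 <= dQ (prim F (u a)) y.
    apply: (@nondecr_der_ge0 R (Q (prim F (u a))) y _ (b - y)); first by rewrite subr_gt0.
      exact: DQ.
    move=> t yt tb; have ay2 : a <= y by lra.
    have yb2 : y <= b by lra.
    by rewrite (Qcst y ay2 yb2) (Qcst t (le_trans ay2 (ltW yt))) //; lra.
  by rewrite leNgt dQlt.
- have [z Iz Hz] := @end_valueP _ _ u sp (sp - u y) hRad hus (ltac:(have := sol_lt Iy; lra)).
  have uz t : I t -> z <= t -> u y < u t.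
    by move=> It /(Hz t It); rewrite ltr_norml => /andP[? _]; lra.
  have yz : y < z by rewrite ltNge; apply/negP => /(uz y Iy); rewrite ltxx.
  have xz : x <= z by lra.
  have [b] := EVT_min xz (within_itv (fun t ta tb => cu (conv Ix Iz ta tb))).
  rewrite in_itv /= => /andP[xb bz] Hb.
  have Ib := conv Ix Iz xb bz.
  have uby : u b <= u y by apply: Hb; rewrite in_itv /=; apply/andP; split; lra.
  have xb' : x < b.
    rewrite lt_neqAle xb andbT; apply: contraTneq uby => <-; by rewrite -ltNge.
  have bz' : b < z.
    rewrite lt_neqAle bz andbT; apply: contraTneq uby => ->; by rewrite -ltNge uz.
  have m0 : 0 < Num.min (b - x) (z - b) by rewrite lt_min !subr_gt0 xb'.
  have near_b t : `|t - b| < Num.min (b - x) (z - b) -> x <= t /\ t <= z.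
    by rewrite lt_min !ltr_norml => /andP[/andP[? ?] /andP[? ?]]; split; lra.
  have u1b : u1 b = 0.
    apply: (zero_der m0 Ib) => [t /near_b[]|]; first exact: conv.
    by right=> t /near_b[? ?]; apply: Hb; rewrite in_itv /=; apply/andP.
  have ubx : u b < u x by exact: le_lt_trans uyx.
  have [d Id Hd] := near0 (upos b Ib).
  pose w := Num.min d x.
  have Iw : I w by rewrite /w; case: leP.
  have wx : w <= x by rewrite ge_min lexx orbT.
  have wd : w <= d by rewrite ge_min lexx.
  have uw : u w <= u b.
    have := Hd w (interval0_pos Iw) wd.
    by rewrite ger0_norm ?hupos // => /ltW.
  (* Since [u] tends to 0, it lies below [u b] at some point before [x]; [a] is the last point
     before [x] at that height. *)
  have [a [wa ax ua Ha]] := last_hit (fun t ta tb => cu (conv Iw Ix ta tb)) wx uw ubx.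
  have Ia := conv Iw Ix wa (ltW ax).
  have Hab t : a <= t -> t <= b -> u b <= u t.
    move=> at_ tb; have [tx|xt] := leP t x; first exact: Ha.
    by apply: Hb; rewrite in_itv /=; apply/andP; split => //; lra.
  have dQge t : a <= t -> t <= b -> 0 <= dQ (prim F (u b)) t.
    move=> at_ tb; have It := conv Ia Ib at_ tb.
    rewrite /dQ subr_ge0; apply: (@le_trans _ _ 0).
      rewrite pmulr_rle0 // pmulr_rle0 ?(interval0_pos It) // subr_le0.
      by apply: prim_le; [exact/ltW/upos|exact: Hab|exact: sol_le].
    by rewrite mulr_ge0 ?subr_ge0 // mulr_ge0 ?sqr_ge0 // ltW // (interval0_pos It).
  have dQgt : 0 < dQ (prim F (u b)) x.
    have : 0 < x * (prim F (u b) - prim F (u x)).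
      rewrite mulr_gt0 // subr_gt0; apply: prim_decr => //; first exact/ltW/upos.
      exact: sol_le.
    have : 0 <= (1 - p) * (x * u1 x ^+ 2).
      by rewrite mulr_ge0 ?subr_ge0 // mulr_ge0 ?sqr_ge0 // ltW.
    rewrite /dQ; lra.
  have Qb t s : a <= s -> s <= t -> t <= b -> Q (prim F (u b)) s <= Q (prim F (u b)) t.
    move=> as_ st tb.
    apply: (@nondecr_der R _ (dQ (prim F (u b))) s t st) => v sv vt.
      by apply: DQ; apply: (conv Ia Ib); lra.
    by apply: dQge; lra.
  have Qab : Q (prim F (u b)) b <= Q (prim F (u b)) a.
    rewrite /Q u1b ua mulr0 expr0n /= mul0r subrr !mulr0 !subr0 lerD2r.
    by rewrite mulr_ge0 ?sqr_ge0.
  have Qcst t : a <= t -> t <= b -> Q (prim F (u b)) t = Q (prim F (u b)) b.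
    move=> at_ tb; apply/eqP; rewrite eq_le; apply/andP; split; first exact: Qb.
    by apply: le_trans Qab _; apply: Qb => //; exact: lexx.
  have : 0 <= - dQ (prim F (u b)) x.
    apply: (@nondecr_der_ge0 R (fun t => - Q (prim F (u b)) t) x _ (b - x)).
    - by rewrite subr_gt0.
    - exact: dN (DQ _ Ix).
    - move=> t xt tb; have ax2 : a <= x by lra.
      have xb2 : x <= b by lra.
      by rewrite (Qcst x ax2 xb2) (Qcst t (le_trans ax2 (ltW xt))) //; lra.
  by rewrite oppr_ge0 leNgt dQgt.
Qed.

Lemma sol_der_ge0 r : I r -> 0 <= u1 r.
Proof.
move=> Ir; have [e e0 He] := interval0_nbhs Ir.
apply: (nondecr_der_ge0 e0 (du Ir)) => y ry ye; apply: sol_nondecr => //.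
by apply: He; rewrite ger0_norm; lra.
Qed.

(* On an interval where [u] is constant, [q / r^2 * u + F u] would vanish. *)
Lemma sol_incr x y : I x -> I y -> x < y -> u x < u y.
Proof.
move=> Ix Iy xy; rewrite lt_neqAle sol_nondecr // andbT; apply/negP => /eqP E.
have ucst t : x <= t -> t <= y -> u t = u x.
  move=> xt ty; apply/eqP; rewrite eq_le; apply/andP; split.
    rewrite E; have [->//|ty'] := eqVneq t y; have {}ty : t < y by rewrite lt_neqAle ty'.
    by apply: sol_nondecr => //; exact: conv Ix Iy xt (ltW ty).
  have [->//|xt'] := eqVneq t x; have {}xt : x < t by rewrite lt_neqAle eq_sym xt'.
  by apply: sol_nondecr => //; exact: conv Ix Iy (ltW xt) ty.
have flat m : x < m -> m < y -> q / m ^+ 2 * u x + F (u x) = 0.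
  move=> xm my; have Im := conv Ix Iy (ltW xm) (ltW my).
  have m0 : 0 < Num.min (m - x) (y - m) by rewrite lt_min !subr_gt0 xm.
  have near_m t : `|t - m| < Num.min (m - x) (y - m) -> x <= t /\ t <= y.
    by rewrite lt_min !ltr_norml => /andP[/andP[? ?] /andP[? ?]]; split; arith.
  have um t : `|t - m| < Num.min (m - x) (y - m) -> u t = u m.
    by move=> /near_m[? ?]; rewrite !ucst //; exact: ltW.
  have Dm t : `|t - m| < Num.min (m - x) (y - m) -> is_derive t 1 u (u1 t).
    by move=> /near_m[? ?]; apply: du; exact: conv Ix Iy _ _.
  have [|u1m h1] := max_der2 m0 _ Dm (hu Im).2; first by move=> t /um->.
  have [|_ h2] := @max_der2 R (fun t => - u t) (fun t => - u1 t) m _ _ m0 _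
    (fun t ht => dN (Dm t ht)) (dN (hu Im).2); first by move=> t /um->.
  have -> : u x = u m by rewrite ucst //; exact: ltW.
  by move: h1 h2; rewrite u1m mulr0 subr0 => ? ?; lra.
(* At two distinct points the term [F (u x)] is the same while [q / m^2] is not. *)
have := flat ((x + y) / 2) (ltac:(lra)) (ltac:(lra)).
have := flat ((x + 2 * y) / 3) (ltac:(lra)) (ltac:(lra)).
set m1 := (_ + 2 * y) / 3; set m2 := (x + y) / 2 => E1 E2.
have x0 := interval0_pos Ix.
have m20 : 0 < m2 by rewrite /m2; lra.
have m12 : m2 < m1 by rewrite /m1 /m2; lra.
have E12 : q / m1 ^+ 2 * u x = q / m2 ^+ 2 * u x := addIr _ (etrans E1 (esym E2)).
have m10 : 0 < m1 by exact: lt_trans m12.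
have : q / m1 ^+ 2 * u x < q / m2 ^+ 2 * u x.
  rewrite ltr_pM2r ?sol_pos // ltr_pM2l // ltf_pV2 ?posrE ?exprn_gt0 //.
  by rewrite ltrXn2r // ltW.
by rewrite E12 ltxx.
Qed.

End NonnegSolution.

(** * Energy of the non-negative solution *)

Section EnergyDensity.
Variables (R : realType) (p q : R) (F : R -> R).
Hypothesis cF : continuous F.

Lemma energy_densityE (u du : R -> R) (r : R) : 0 < r ->
  energy_density p q F u du r =
  r `^ p * (du r ^+ 2 + q / r ^+ 2 * u r ^+ 2 + potential F (u r)).
Proof.
move=> r0; rewrite /energy_density real_normK ?num_real // powRB; last first.
  by rewrite lt0r_neq0 // implybT.
rewrite -(powR_mulrn 2 (ltW r0)); field; rewrite gt_eqF //; exact: powR_gt0.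
Qed.

Lemma energy_density_continuous (u du : R -> R) (r : R) : 0 < r ->
  {for r, continuous u} -> {for r, continuous du} ->
  {for r, continuous (energy_density p q F u du)}.
Proof.
move=> r0 cu cdu.
have ch : {for u r, continuous (potential F)}.
  by apply: is_derive_continuous; exact: dpotential.
rewrite /energy_density; apply: continuousD; first apply: continuousD.
- apply: continuousM; first exact: cont_powR.
  apply: (@continuous_comp _ _ _ (fun y => `|du y|) (fun z : R => z ^+ 2)).
    by apply: (@continuous_comp _ _ _ du Num.norm) => //; exact: norm_continuous.
  exact: exprn_continuous.
- apply: continuousM; first by apply: continuousM; [exact: cvg_cst|exact: cont_powR].
  by apply: (@continuous_comp _ _ _ u (fun z : R => z ^+ 2)) => //; exact: exprn_continuous.
- apply: continuousM; first exact: cont_powR.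
  exact: (@continuous_comp _ _ _ u (potential F)).
Qed.

End EnergyDensity.

(** * Behaviour at the origin and finiteness of the energy *)

Section SolutionEnergy.
Variables (R : realType) (Rad : \bar R) (sp p q L : R) (F u u1 : R -> R).
Implicit Types r t e s c : R.
Hypotheses (hRad : (0 < Rad)%E) (hsp : 0 < sp) (hq : 0 < q) (cF : continuous F).
Hypotheses (L0 : 0 < L)
  (HL : forall t, 0 <= t -> t <= sp -> - (L * t) <= F t /\ F t <= 0).
Local Notation I := (interval0 Rad).
Hypotheses (hu : ode Rad p q F u u1) (hu0 : u x @[x --> 0^'+] --> 0).
Hypotheses (upos : forall r, I r -> 0 < u r) (ult : forall r, I r -> u r < sp).
Hypothesis u1ge : forall r, I r -> 0 <= u1 r.

Lemma potential_bounds t : 0 <= t -> t <= sp ->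
  - (L * t ^+ 2) <= potential F t /\ potential F t <= 0.
Proof.
move=> t0 ts; split.
  rewrite lerNl -subr_ge0 opprK addrC -[leLHS](_ : potential F 0 + L * 0 ^+ 2 = 0).
    apply: (@nondecr_der R (fun y => potential F y + L * y ^+ 2)
      (fun y => 2 * F y + L * (2 * y)) 0 t t0) => x x0 xt.
      have D := dpotential x cF; deriv; ring.
    have [+ _] := HL (ltW x0) (le_trans (ltW xt) ts); arith.
  by rewrite potential0; ring.
rewrite -(potential0 F).
apply: (@nonincr_der R _ (fun y => 2 * F y) 0 t t0) => x x0 xt.
  exact: dpotential.
have [_ +] := HL (ltW x0) (le_trans (ltW xt) ts); arith.
Qed.

(** Up to [r0] the coefficient [q / r^2] is at least [2 L], so it absorbs [F] in the equation and
    the potential in the energy. *)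
Lemma near_origin : exists2 r0, I r0 & L * r0 ^+ 2 <= q / 2.
Proof.
have [x Ix] := interval0_nonempty hRad; have x0 := interval0_pos Ix.
pose s := Num.sqrt (q / 2 / L).
have s0 : 0 < s by rewrite sqrtr_gt0 !divr_gt0.
exists (Num.min x s); first by apply: (interval0_left Ix); [rewrite lt_min x0|rewrite ge_min lexx].
have m0 : 0 < Num.min x s by rewrite lt_min x0.
have ms : Num.min x s <= s by rewrite ge_min lexx orbT.
apply: (@le_trans _ _ (L * s ^+ 2)).
  by rewrite ler_pM2l // sqr_le // ltW.
rewrite sqr_sqrtr; last by rewrite ltW // !divr_gt0.
by rewrite mulrC divfK // lt0r_neq0.
Qed.

(** The derivative [r^p (q / r^2 u + F u)] of the flux is nonnegative below [r0] because
    [F u >= - L u]. *)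
Lemma flux_nondecr r0 r s : I r0 -> L * r0 ^+ 2 <= q / 2 -> 0 < r -> r <= s -> s <= r0 ->
  r `^ p * u1 r <= s `^ p * u1 s.
Proof.
move=> I0 hr0 r_0 rs s0.
have Is t : r <= t -> t <= s -> I t.
  by move=> rt ts; apply: (interval0_left I0); [exact: lt_le_trans rt|exact: le_trans s0].
apply: (nondecr_der rs (fun t rt ts => ode_flux hu (Is t rt ts))) => t rt ts.
have It := Is t (ltW rt) (ltW ts); have t0 := interval0_pos It.
rewrite mulr_ge0 ?powR_ge0 //.
have [+ _] := HL (ltW (upos It)) (ltW (ult It)).
suff : L * u t <= q / t ^+ 2 * u t by arith.
rewrite ler_pM2r ?upos // ler_pdivlMr ?exprn_gt0 //.
apply: (@le_trans _ _ (L * r0 ^+ 2)); last first.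
  by have := hq; arith.
by rewrite ler_pM2l // sqr_le //; arith.
Qed.

Lemma powR_double r s : 0 < r -> r <= s -> s <= 2 * r -> s `^ p <= 2 `^ `|p| * r `^ p.
Proof.
move=> r0 rs sr; have s0 := lt_le_trans r0 rs.
have {1}-> : s = (s / r) * r by rewrite divfK // lt0r_neq0.
have d1 : 1 <= s / r by rewrite ler_pdivlMr // mul1r.
have d2 : s / r <= 2 by rewrite ler_pdivrMr.
rewrite powRM; [|by rewrite ltW // divr_gt0|exact: ltW].
apply: ler_wpM2r; first exact: powR_ge0.
apply: (@le_trans _ _ ((s / r) `^ `|p|)); first by apply: ler_powR => //; exact: ler_norm.
by apply: ge0_ler_powR; rewrite // nnegrE // ltW // divr_gt0.
Qed.

(** The mean value theorem on [[r, 2 r]] gives [r u' c = u (2 r) - u r], which is small, and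
    monotonicity of the flux bounds [u' r] by a constant times [u' c]. *)
Lemma sol_scale_der e : 0 < e -> exists2 d, I d &
  forall r, 0 < r -> r <= d -> r * u1 r <= e.
Proof.
move=> e0; have [r0 I0 h0] := near_origin.
pose K := 2 `^ `|p| : R.
have K0 : 0 < K by exact: powR_gt0.
have [d d0 Hd] := at_rightP hu0 (divr_gt0 e0 K0).
pose m := Num.min d r0.
have m0 : 0 < m by rewrite lt_min d0 (interval0_pos I0).
have md : m <= d by rewrite ge_min lexx.
have mr : m <= r0 by rewrite ge_min lexx orbT.
exists (m / 3) => [|r r_0 rm]; first by apply: (interval0_left I0); arith.
have Ir t : r <= t -> t <= 2 * r -> I t by move=> *; apply: (interval0_left I0); arith.
have r2 : r < 2 * r by arith.
have [c [rc c2 E]] := mvt r2 (fun t rt tr => (hu (Ir t rt tr)).1).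
have c0 : 0 < c by arith.
have h1 : r `^ p * u1 r <= c `^ p * u1 c by apply: (flux_nondecr I0 h0); arith.
have h2 : c `^ p <= K * r `^ p by apply: powR_double; arith.
have rp : 0 < r `^ p by exact: powR_gt0.
have Ic : I c by apply: Ir; arith.
have h3 : u1 r <= K * u1 c.
  rewrite -(ler_pM2l rp) (le_trans h1) // mulrA [r `^ p * K]mulrC.
  by apply: ler_wpM2r => //; exact: u1ge.
have h4 : r * u1 c <= e / K.
  have -> : r * u1 c = u (2 * r) - u r by rewrite E; ring.
  have := upos (Ir r (lexx _) (ltW r2)).
  have := Hd (2 * r) (ltac:(lra)) (ltac:(lra)).
  by rewrite subr0 ltr_norml => /andP[? ?] ?; arith.
apply: (@le_trans _ _ (r * (K * u1 c))); first by rewrite ler_pM2l.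
by rewrite mulrCA mulrC -ler_pdivlMr.
Qed.

(** Multiplying the equation by [r^p u] shows that the derivative of [r^p u' u] is
    [r^p (u'^2 + q / r^2 u^2 + F u u)], which dominates the density near 0. The function [r^p u' u]
    is bounded, by monotonicity of the flux near 0 and by [ode_der_bounded] beyond. *)
Lemma sol_energy_integrable a b : 0 <= a -> a <= b -> (b%:E <= Rad)%E ->
  (@lebesgue_measure R).-integrable `[a, b] (EFin \o energy_density p q F u u1).
Proof.
move=> a0 ab bR; apply: (@integrable_itvS _ _ 0 b) => //.
apply: integrable_oo_cc.
have Ib r : 0 < r -> r < b -> I r.
  by move=> r0 rb; split => //; apply: lt_le_trans bR; rewrite lte_fin.
have [r0 I0 h0] := near_origin.
have r00 := interval0_pos I0.
have [C C0 HC] : exists2 C : R, 0 < C & forall r, r0 <= r -> r < b -> `|u1 r| <= C.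
  apply: (ode_der_bounded cF hu I0 bR (V := sp)) => r rr rb.
  have Ir := Ib r (lt_le_trans r00 rr) rb.
  by rewrite gtr0_norm ?upos // ltW // ult.
have [m [B [m0 B0 HB]]] := powR_bounds p b r00.
(* Beyond [r0] the singular term no longer absorbs [L u^2]; the constant [K] is at least
   [2 r^p L u^2] there. *)
pose K := 2 * L * sp ^+ 2 * B.
pose Y r := r `^ p * u1 r * u r + K * r.
pose dY r := r `^ p * (u1 r ^+ 2 + q / r ^+ 2 * u r ^+ 2 + F (u r) * u r) + K.
have DY r : 0 < r -> r < b -> is_derive r 1 Y (dY r).
  move=> r_0 rb; have Ir := Ib r r_0 rb.
  have D1 := ode_flux hu Ir; have [D2 _] := hu Ir.
  eapply derE; first by eapply dD; [eapply dM; [exact: D1|exact: D2]|der].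
  by cbv beta; rewrite /dY; ring.
have K0 : 0 < K by rewrite !mulr_gt0 // exprn_gt0.
pose Cb := r0 `^ p * u1 r0 * u r0 + B * C * sp + K * b.
(* The factor 3 is due to the part [L u^2]: it is added in the bound of the density and subtracted
   in that of [dY], and near 0 it may be half of [q / r^2 u^2]. *)
apply: (@integrable_oo_dom _ _ (fun r => 3 * Y r) (fun r => 3 * dY r) (3 * Cb)) => r r_0 rb.
- have Ir := Ib r r_0 rb; apply: energy_density_continuous => //.
    exact: ode_cont hu Ir.
  exact: ode_cont1 hu Ir.
- have D := DY r r_0 rb; deriv; by rewrite mul0r add0r.
- have Ir := Ib r r_0 rb; have [/is_derive_continuous c1 /is_derive_continuous c2] := hu Ir.
  apply: (@continuous_comp _ _ _ dY (fun y : R => 3 * y)); last exact: mulrl_continuous.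
  have c3 : {for r, continuous (fun r => F (u r))}.
    by apply: (@continuous_comp _ _ _ u F) => //; exact: cF.
  apply: continuousD; last exact: cvg_cst.
  apply: continuousM; first exact: cont_powR.
  apply: continuousD; last exact: continuousM.
  apply: continuousD.
    exact: cont_sq.
  apply: continuousM; last first.
    exact: cont_sq.
  exact: cont_divsq.
- have Ir := Ib r r_0 rb; rewrite energy_densityE //.
  have ur := upos Ir; have us := ult Ir; have rp : 0 < r `^ p by exact: powR_gt0.
  have [h1 h2] := potential_bounds (ltW ur) (ltW us).
  have [F1 F2] := HL (ltW ur) (ltW us).
  have Fu : - (L * u r ^+ 2) <= F (u r) * u r.
    by rewrite expr2 mulrA -mulNr ler_pM2r.
  have q0 : 0 <= q / r ^+ 2 * u r ^+ 2 by rewrite mulr_ge0 ?sqr_ge0 // divr_ge0 ?sqr_ge0 // ltW.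
  have d0 : 0 <= u1 r ^+ 2 by exact: sqr_ge0.
  rewrite normrM gtr0_norm //.
  set A := u1 r ^+ 2 in d0 *; set D := q / r ^+ 2 * u r ^+ 2 in q0 *.
  have nle : `|A + D + potential F (u r)| <= A + D + L * u r ^+ 2.
    by rewrite ler_norml; apply/andP; split; arith.
  apply: le_trans (ler_wpM2l (ltW rp) nle) _.
  rewrite /dY -/A -/D.
  have [rr|rr] := leP r r0.
    have LD : 2 * (L * u r ^+ 2) <= D.
      rewrite /D mulrA ler_pM2r ?exprn_gt0 // ler_pdivlMr ?exprn_gt0 //.
      have : L * r ^+ 2 <= L * r0 ^+ 2 by rewrite ler_pM2l // sqr_le // ltW.
      arith.
    apply: (@le_trans _ _ (3 * (r `^ p * (A + D + F (u r) * u r)))); last by arith.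
    by rewrite [leRHS]mulrCA ler_pM2l //; arith.
  have [_ Br] := HB r (ltW rr) (ltW rb).
  have u2 : u r ^+ 2 <= sp ^+ 2 by apply: sqr_le; exact: ltW.
  have LB : r `^ p * (L * u r ^+ 2) <= B * (L * sp ^+ 2).
    apply: ler_pM => //; first exact: ltW.
      by rewrite mulr_ge0 ?sqr_ge0 // ltW.
    by rewrite ler_pM2l.
  have X1 : r `^ p * (- (L * u r ^+ 2)) <= r `^ p * (F (u r) * u r) by rewrite ler_pM2l.
  have X2 : 0 <= r `^ p * (A + D) by rewrite mulr_ge0 ?addr_ge0 // ltW.
  rewrite [X in _ <= 3 * (X + _)]mulrDr [leLHS]mulrDr /K.
  have KE : K = 2 * (B * (L * sp ^+ 2)) by rewrite /K; ring.
  by move: X1 X2 LB K0; rewrite mulrN -/K KE; set P1 := r `^ p * (A + D); arith.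
- have Ir := Ib r r_0 rb; have ur := upos Ir; have us := ult Ir.
  have u10 := u1ge Ir; have rp : 0 < r `^ p by exact: powR_gt0.
  have Y0 : 0 <= Y r.
    by rewrite addr_ge0 // ?mulr_ge0 // ltW.
  have B1 : 0 <= B * C * sp by rewrite !mulr_ge0 // ltW.
  have B2 : 0 <= r0 `^ p * u1 r0 * u r0.
    by rewrite !mulr_ge0 ?powR_ge0 ?u1ge // ltW // upos.
  rewrite normrM !ger0_norm // ler_pM2l // /Y /Cb.
  have KR : K * r <= K * b by rewrite ler_pM2l // ltW.
  apply: lerD => //.
  have [rr|rr] := leP r r0.
    apply: ler_wpDr => //; apply: ler_pM.
    + by rewrite mulr_ge0 // ltW.
    + exact: ltW.
    + by apply: (flux_nondecr I0 h0).
    + apply: (nondecr_der rr (fun t rt tr => (hu (interval0_left I0 (lt_le_trans r_0 rt) tr)).1)).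
      by move=> t rt tr; apply: u1ge; apply: (interval0_left I0); arith.
  apply: ler_wpDl => //; apply: ler_pM; [|exact: ltW| |exact: ltW].
    by rewrite mulr_ge0 // ltW.
  have [_ Br] := HB r (ltW rr) (ltW rb).
  apply: ler_pM => //; first exact: ltW.
  by apply: le_trans (HC r (ltW rr) rb); exact: ler_norm.
Qed.

End SolutionEnergy.

(** * Calibration by the field of dilates *)

Section Inverse.
Variable R : realType.

Lemma cont_epsP (f : R -> R) (x : R) :
  (forall e : R, 0 < e -> exists2 d : R, 0 < d & forall y, `|y - x| < d -> `|f y - f x| < e) ->
  {for x, continuous f}.
Proof.
move=> H; apply/cvgrPdist_lt => e /H[d d0 Hd]; apply/nbhs_ballP; exists d => //= y yx.
by rewrite distrC; apply: Hd; rewrite distrC.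
Qed.

(** The right branch is only asked to tend to [f1 c], not to be continuous at [c]: it will be
    [r * u1 r] glued at [c = 0], about whose value at 0 nothing is known. *)
Lemma cont_glue (f1 f2 : R -> R) (c x : R) :
  (x <= c -> {for x, continuous f1}) -> (c < x -> {for x, continuous f2}) ->
  (forall e : R, 0 < e -> exists2 d : R, 0 < d &
     forall y : R, c < y -> y < c + d -> `|f2 y - f1 c| < e) ->
  {for x, continuous (fun y : R => if y <= c then f1 y else f2 y)}.
Proof.
move=> c1 c2 H; apply: cont_epsP => e e0.
have [xc|cx] := leP x c; last first.
  have [d d0 Hd] := cont_near e0 (c2 cx).
  exists (Num.min d (x - c)) => [|y]; first by rewrite lt_min d0 subr_gt0.
  rewrite lt_min => /andP[yd]; rewrite ltr_norml => /andP[yc _].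
  have /lt_geF -> : c < y by arith.
  exact: Hd.
have [d d0 Hd] := cont_near e0 (c1 xc).
have [xc'|cx] := ltP x c.
  exists (Num.min d (c - x)) => [|y]; first by rewrite lt_min d0 subr_gt0.
  rewrite lt_min => /andP[yd]; rewrite ltr_norml => /andP[_ yc].
  have -> : y <= c by arith.
  exact: Hd.
have {}xc : x = c by apply/eqP; rewrite eq_le xc.
have [d' d0' Hd'] := H e e0.
exists (Num.min d d') => [|y]; first by rewrite lt_min d0.
rewrite lt_min => /andP[yd yd']; have [yc|cy] := leP y c; first exact: Hd.
rewrite xc; apply: Hd' => //; move: yd'; rewrite ltr_norml => /andP[_]; arith.
Qed.

(** Monotonicity and surjectivity alone make the inverse continuous: the points [U (w y - e)] and
    [U (w y + e)] enclose a neighbourhood of [y]. *)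
Lemma increasing_inverse (U : R -> R) :
  (forall x y : R, x < y -> U x < U y) -> (forall y : R, exists x : R, U x = y) ->
  exists w : R -> R, [/\ forall x, w (U x) = x, forall y, U (w y) = y & continuous w].
Proof.
move=> Ui Us; pose w (y : R) : R := sval (cid (Us y)).
have Uw y : U (w y) = y by rewrite /w; case: (cid _).
have Ulr x y : U x < U y -> x < y.
  move=> Uxy; rewrite ltNge le_eqVlt; apply/negP => /predU1P[yx|/Ui].
    by move: Uxy; rewrite yx ltxx.
  by move/(lt_trans Uxy); rewrite ltxx.
have wU x : w (U x) = x.
  by apply/eqP; rewrite eq_le !leNgt; apply/andP; split; apply/negP => /Ui;
    rewrite Uw ltxx.
exists w; split=> // y; apply: cont_epsP => e e0.
pose d := Num.min (U (w y + e) - y) (y - U (w y - e)).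
exists d.
  rewrite lt_min !subr_gt0 -{1}[y]Uw -{4}[y]Uw !Ui //; arith.
move=> z; rewrite lt_min !ltr_norml => /andP[/andP[_ z1] /andP[z2 _]].
have h1 : w z < w y + e by apply: Ulr; rewrite Uw; arith.
have h2 : w y - e < w z by apply: Ulr; rewrite Uw; arith.
by apply/andP; split; arith.
Qed.

End Inverse.

(* If [g (w r) = r * w' r] and [G' = g], the energy density of [v] is
   [(2 r^(p-1) G v)' + r^(p-2) ((r v' - g v)^2 + psi r v)]. *)
Definition psi (R : realType) (p q : R) (F g G : R -> R) (r y : R) : R :=
  q * y ^+ 2 - g y ^+ 2 - 2 * (p - 1) * G y + r ^+ 2 * potential F y.

(** * Construction of the slope of the field *)

Section Calibration.
Variables (R : realType) (Rad : \bar R) (sp p q : R) (F u u1 : R -> R).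
Implicit Types r t e s c x y : R.
Hypotheses (hRad : (0 < Rad)%E) (hsp : 0 < sp) (hq : 0 < q) (cF : continuous F).
Hypothesis hFsp : F sp = 0.
Hypothesis hFneg : forall t, 0 < t -> t < sp -> F t < 0.
Hypothesis hFpos : forall t, sp < t -> 0 <= F t.
Hypothesis hFsym : forall t, 0 <= t -> (F t + F (- t)) / 2 <= 0.
Local Notation I := (interval0 Rad).
Hypotheses (hu : ode Rad p q F u u1) (hu0 : u x @[x --> 0^'+] --> 0).
Hypothesis hus : end_value Rad u sp.
Hypotheses (upos : forall r, I r -> 0 < u r) (ult : forall r, I r -> u r < sp).
Hypothesis u1ge : forall r, I r -> 0 <= u1 r.
Hypothesis uincr : forall x y, I x -> I y -> x < y -> u x < u y.
Hypothesis scale0 : forall e, 0 < e -> exists2 d, I d &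
  forall r, 0 < r -> r <= d -> r * u1 r <= e.

(** Integrated form of the hypothesis on [F t + F (- t)]. *)
Lemma potential_sym y : potential F `|y| <= potential F y.
Proof.
have [y0|y0] := leP 0 y; first by rewrite ger0_norm.
rewrite ltr0_norm // -{2}[y]opprK; set t := - y.
have t0 : 0 <= t by rewrite /t oppr_ge0 ltW.
rewrite -subr_ge0 -(_ : potential F (- 0) - potential F 0 = 0); last by rewrite oppr0 subrr.
apply: (@nondecr_der R (fun x => potential F (- x) - potential F x)
  (fun x => - (2 * F (- x)) - 2 * F x) 0 t t0) => x x0 xt.
  have D1 := dpotential x cF; have D2 := dpotential (- x) cF; deriv; ring.
have := hFsym (ltW x0); lra.
Qed.

(** Slightly below [sp] the negative part of [F] is small while [q * y] stays away from 0; from [sp]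
    on both terms are nonnegative. How close to [sp] the height [u N] must be depends on [b]. *)
Lemma inner_bound b : I b -> exists N, [/\ I N, b < N &
  forall r y, 0 < r -> r <= b -> u N <= y -> 0 <= q * y + r ^+ 2 * F y].
Proof.
move=> Ib; have b0 := interval0_pos Ib.
(* Chosen so that [b^2 e = q * (sp / 2)], which is at most [q * y] once [y >= sp / 2]. *)
pose e := q * (sp / 2) / b ^+ 2.
have e0 : 0 < e by rewrite !divr_gt0 ?mulr_gt0 ?exprn_gt0 // divr_gt0.
have [d d0 Hd] := cont_near e0 (@cF sp).
have m0 : 0 < Num.min d (sp / 2) by rewrite lt_min d0 divr_gt0.
have [x Ix Hx] := end_valueP hRad hus m0.
have [b' Ib' bb'] := interval0_right Ib.
pose N := Num.max x b'.
have IN : I N by rewrite /N; case: leP.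
exists N; split=> //; first by rewrite lt_max bb' orbT.
move=> r y r0 rb Ny.
have := Hx N IN (ltac:(by rewrite le_max lexx)).
rewrite ltr_norml lt_min => /andP[+ _]; rewrite ltrNl lt_min => /andP[N1 N2].
have y2 : sp / 2 <= y by have := hsp; arith.
have y0 : 0 < y by have := hsp; arith.
have [ys|sy] := ltP y sp; last first.
  have F0 : 0 <= F y.
    by move: sy; rewrite le_eqVlt => /predU1P[<-|/hFpos //]; rewrite hFsp.
  by rewrite addr_ge0 // mulr_ge0 // ?sqr_ge0 // ltW.
have Fy : - e <= F y.
  have := Hd y; rewrite hFsp subr0 => Hdy.
  have /Hdy : `|y - sp| < d by rewrite ltr_norml; apply/andP; split; arith.
  by rewrite ltr_norml => /andP[/ltW].
have F0 := hFneg y0 ys.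
have : b ^+ 2 * F y <= r ^+ 2 * F y by rewrite ler_nM2r // sqr_le // ltW.
have : b ^+ 2 * - e <= b ^+ 2 * F y by rewrite ler_pM2l // exprn_gt0.
have -> : b ^+ 2 * - e = - (q * (sp / 2)).
  by rewrite /e; field; rewrite gt_eqF.
have : q * (sp / 2) <= q * y by rewrite ler_pM2l.
arith.
Qed.

(** [g] is [r * u1 r] read as a function of the height [u r], which takes an inverse of [u]. Its
    continuity at height 0 is the limit [scale0]. *)
Lemma field_exists N : I N -> exists g : R -> R, [/\ continuous g,
  forall y, y <= 0 -> g y = 0,
  forall r, 0 < r -> r <= N -> g (u r) = r * u1 r,
  forall y, u N <= y -> g y = Num.max 0 (N * u1 N - (`|p - 1| + 1) * (y - u N)) &
  forall y, 0 < y -> y <= u N -> exists r, [/\ 0 < r, r <= N & u r = y]].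
Proof.
move=> IN; have N0 := interval0_pos IN.
have Iin r : 0 < r -> r <= N -> I r by exact: interval0_left IN.
have range y : 0 < y -> y <= u N -> exists r, [/\ 0 < r, r <= N & u r = y].
  move=> y0 yN; have [d d0 Hd] := at_rightP hu0 y0.
  pose a := Num.min d N / 2.
  have m0 : 0 < Num.min d N by rewrite lt_min d0.
  have md : Num.min d N <= d by rewrite ge_min lexx.
  have mN : Num.min d N <= N by rewrite ge_min lexx orbT.
  have a0 : 0 < a by rewrite /a; arith.
  have aN : a <= N by rewrite /a; arith.
  have ua : u a < y.
    have := Hd a a0 (ltac:(rewrite /a; lra)).
    by rewrite subr0; apply: le_lt_trans; exact: ler_norm.
  have [r [ar rN E _]] := first_hit (fun t at_ tN => ode_cont hu
    (Iin t (lt_le_trans a0 at_) tN)) aN ua yN.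
  by exists r; split=> //; exact: lt_trans ar.
(* [u] is extended to an increasing bijection of the line, so that its inverse is defined and
   continuous everywhere. *)
pose U r := if r <= 0 then r else if r <= N then u r else u N + (r - N).
have Ui x y : x < y -> U x < U y.
  move=> xy; rewrite /U.
  have uN := upos IN.
  have [x0|x0] := leP x 0; have [y0|y0] := leP y 0 => //; try lra.
    have [yN|yN] := leP y N; last by lra.
    by apply: le_lt_trans x0 _; apply/upos/Iin.
  have [xN|xN] := leP x N; have [yN|yN] := leP y N => //; try lra.
    by apply: uincr => //; exact: Iin.
  have : u x <= u N.
    move: xN; rewrite le_eqVlt => /predU1P[->//|xN].
    by apply/ltW/uincr => //; apply: Iin => //; exact: ltW.
  lra.
have Us y : exists x, U x = y.
  have [y0|y0] := leP y 0; first by exists y; rewrite /U y0.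
  have [yN|Ny] := leP y (u N).
    have [r [r0 rN <-]] := range y y0 yN.
    by exists r; rewrite /U leNgt r0 rN.
  exists (N + (y - u N)); rewrite /U.
  have /lt_geF -> : 0 < N + (y - u N) by lra.
  have /lt_geF -> : N < N + (y - u N) by lra.
  lra.
have [w [wU Uw cw]] := increasing_inverse Ui Us.
(* [psi_tail] calls for a rate of decrease that is positive and at least [p - 1]. *)
pose Lc := `|p - 1| + 1.
pose tail r := Num.max 0 (N * u1 N - Lc * (r - N)).
pose Ga r := if r <= 0 then 0 else if r <= N then r * u1 r else tail r.
have cGa : continuous Ga.
  move=> r; apply: cont_glue => [_|r0|e e0]; first exact: cvg_cst.
  - apply: cont_glue => [rN|_|e e0].
    + have Ir := Iin r r0 rN.
      by apply: continuousM; [exact: cvg_id|exact: ode_cont1 hu Ir].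
    + apply: continuous_max; first exact: cvg_cst.
      apply: is_derive_continuous; der.
    + have cT : {for N, continuous tail}.
        apply: continuous_max; first exact: cvg_cst.
        apply: is_derive_continuous; der.
      have [d d0 Hd] := cont_near e0 cT; exists d => // y Ny yd.
      have -> : N * u1 N = tail N.
        by rewrite /tail subrr mulr0 subr0 max_r // mulr_ge0 ?u1ge // ltW.
      by apply: Hd; rewrite ger0_norm; lra.
  - have [d Id Hd] := scale0 (ltac:(lra) : 0 < e / 2).
    pose m := Num.min d N.
    have m0 : 0 < m by rewrite lt_min (interval0_pos Id).
    have md : m <= d by rewrite ge_min lexx.
    have mN : m <= N by rewrite ge_min lexx orbT.
    exists m => // y y0 ym; have -> : y <= N by lra.
    have Iy : I y by apply: Iin => //; lra.
    rewrite subr0 ger0_norm; last by rewrite mulr_ge0 ?u1ge // ltW.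
    have := Hd y y0 (ltac:(lra)); lra.
exists (fun y => Ga (w y)); split=> //.
- by move=> y; apply: continuous_comp; [exact: cw|exact: cGa].
- by move=> y y0; have -> : w y = y; [rewrite -{1}[y](_ : U y = y) ?wU // /U y0|rewrite /Ga y0].
- move=> r r0 rN; have -> : w (u r) = r.
    by rewrite -{2}[r]wU /U leNgt r0 rN.
  by rewrite /Ga leNgt r0 rN.
- move=> y Ny; have -> : w y = N + (y - u N).
    rewrite -[RHS]wU /U; have /lt_geF -> : 0 < N + (y - u N) by lra.
    have [h|h] := leP (N + (y - u N)) N; last by congr w; lra.
    have {}h : y = u N by apply/eqP; rewrite eq_le Ny andbT; lra.
    by rewrite h subrr addr0.
  rewrite /Ga; have /lt_geF -> : 0 < N + (y - u N) by lra.
  have [h|h] := leP (N + (y - u N)) N.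
    have {}h : y = u N by apply/eqP; rewrite eq_le Ny andbT; lra.
    by rewrite h subrr addr0 mulr0 subr0 max_r // mulr_ge0 ?u1ge // ltW.
  by rewrite /tail; congr (Num.max 0 (_ - _ * _)); ring.
Qed.

End Calibration.

Lemma le_add_shifted (R : realDomainType) (A B C D k x y : R) : D <= A -> B <= C ->
  C + k * x <= D + k * y -> k * (x - y) <= A - B.
Proof. by move=> *; lra. Qed.

Lemma le_sub_shifted (R : realDomainType) (A B C D k x y : R) : D <= A -> B <= C ->
  C - k * x <= D - k * y -> k * (y - x) <= A - B.
Proof. by move=> *; lra. Qed.

(** * Minimality of [psi] along the solution, with a margin *)

Section CalibrationField.
Variables (R : realType) (Rad : \bar R) (sp p q b N : R) (F u u1 g : R -> R).
Implicit Types r t e s c x y : R.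
Hypotheses (hq : 0 < q) (cF : continuous F).
Hypothesis hFle : forall t, 0 <= t -> t <= sp -> F t <= 0.
Hypothesis hpot : forall y, potential F `|y| <= potential F y.
Local Notation I := (interval0 Rad).
Hypotheses (hu : ode Rad p q F u u1) (hu0 : u x @[x --> 0^'+] --> 0).
Hypotheses (upos : forall r, I r -> 0 < u r) (ult : forall r, I r -> u r < sp).
Hypothesis u1ge : forall r, I r -> 0 <= u1 r.
Hypothesis uincr : forall x y, I x -> I y -> x < y -> u x < u y.
Hypotheses (IN : I N) (Ib : I b) (bN : b < N).
Hypothesis hN : forall r y, 0 < r -> r <= b -> u N <= y -> 0 <= q * y + r ^+ 2 * F y.
Hypotheses (cg : continuous g) (g0 : forall y, y <= 0 -> g y = 0).
Hypothesis gu : forall r, 0 < r -> r <= N -> g (u r) = r * u1 r.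
Hypothesis gtail : forall y, u N <= y ->
  g y = Num.max 0 (N * u1 N - (`|p - 1| + 1) * (y - u N)).
Hypothesis urange : forall y, 0 < y -> y <= u N -> exists r, [/\ 0 < r, r <= N & u r = y].

(** Odd reflection of [g], which vanishes on negative heights; [cal_pot] is its even primitive. *)
Definition cal_field y := g y - g (- y).
Definition cal_pot y := prim g y + prim g (- y).

Local Notation Psi := (psi p q F cal_field cal_pot).

Let Iin r : 0 < r -> r <= N -> I r. Proof. exact: interval0_left IN. Qed.

Let u1x r : 0 < r -> r <= N -> 0 <= u1 r.
Proof. by move=> r0 rN; exact/u1ge/Iin. Qed.

Lemma cal_fieldE y : 0 <= y -> cal_field y = g y.
Proof. by move=> y0; rewrite /cal_field (@g0 (- y)) ?subr0 // oppr_le0. Qed.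

Lemma cal_field_cont : continuous cal_field.
Proof.
move=> y; apply: continuousB; first exact: cg.
apply: (@continuous_comp _ _ _ -%R g); last exact: cg.
exact: continuousN.
Qed.

Lemma dcal_pot y : is_derive y 1 cal_pot (cal_field y).
Proof.
have D1 := dprim y cg; have D2 := dprim (- y) cg.
by rewrite /cal_pot; deriv; rewrite /cal_field; ring.
Qed.

Lemma cal_pot_even y : cal_pot (- y) = cal_pot y.
Proof. by rewrite /cal_pot opprK addrC. Qed.

Lemma cal_field_sol r : 0 < r -> r <= N -> cal_field (u r) = r * u1 r.
Proof. by move=> r0 rN; rewrite cal_fieldE ?gu //; exact/ltW/upos/Iin. Qed.

(** All terms of [psi] but the potential are even in [y]. *)
Lemma psi_abs r y : Psi r `|y| <= Psi r y.
Proof.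
have -> : Psi r y = Psi r `|y| + r ^+ 2 * (potential F y - potential F `|y|).
  have [y0|y0] := leP 0 y; first by rewrite ger0_norm // subrr mulr0 addr0.
  rewrite ltr0_norm // /psi cal_pot_even /cal_field opprK; ring.
by rewrite lerDl mulr_ge0 ?sqr_ge0 // subr_ge0.
Qed.

(** Once the equation replaces [u''] in the derivative of [(t u')^2], all terms without [F] cancel;
    this fixes the coefficient [2 (p - 1)] in [psi]. *)
Lemma dpsi_sol r t : 0 < t -> t <= N ->
  is_derive t 1 (fun x => q * u x ^+ 2 - (x * u1 x) ^+ 2 - 2 * (p - 1) * cal_pot (u x)
      + r ^+ 2 * potential F (u x))
    (2 * (u1 t * (r ^+ 2 - t ^+ 2) * F (u t))).
Proof.
move=> t0 tN; have [D1 D2] := hu (Iin t0 tN).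
have D3 := dcal_pot (u t); have D4 := dpotential (u t) cF.
by deriv; rewrite cal_field_sol //; field; rewrite gt_eqF.
Qed.

Lemma psi_sol r t : 0 < t -> t <= N ->
  Psi r (u t) = q * u t ^+ 2 - (t * u1 t) ^+ 2 - 2 * (p - 1) * cal_pot (u t)
      + r ^+ 2 * potential F (u t).
Proof. by move=> t0 tN; rewrite /psi cal_field_sol. Qed.

Let Fle r : 0 < r -> r <= N -> F (u r) <= 0.
Proof.
move=> r0 rN; have Ir := Iin r0 rN.
by apply: hFle; apply: ltW; [exact: upos|exact: ult].
Qed.

Let uN0 : 0 < u N. Proof. exact: upos. Qed.
Let N0 : 0 < N. Proof. exact: interval0_pos IN. Qed.

Let ule x y : 0 < x -> y <= N -> x <= y -> u x <= u y.
Proof.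
move=> x0 yN xy; move: (xy); rewrite le_eqVlt => /predU1P[->//|xy'].
by apply/ltW/uincr => //; apply: Iin => //; lra.
Qed.

Let ulr x y : 0 < y -> x <= N -> u x <= u y -> x <= y.
Proof.
move=> y0 xN uxy; rewrite leNgt; apply/negP => yx.
suff : u y < u x by rewrite ltNge uxy.
by apply: uincr => //; apply: Iin => //; lra.
Qed.

(* Past [u N] the slope decreases fast enough for [Psi r] to stay above its
   value at [u N]. *)
Lemma psi_tail r y : 0 < r -> r <= b -> u N <= y -> Psi r (u N) <= Psi r y.
Proof.
move=> r0 rb Ny; pose c := u N; pose gc := N * u1 N; pose L := `|p - 1| + 1.
have gc0 : 0 <= gc by rewrite mulr_ge0 ?u1ge // ltW.
have c0 : 0 < c by exact: uN0.
have L1 : p - 1 <= L by rewrite /L; have := ler_norm (p - 1); lra.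
have L0 : 0 < L by rewrite /L ltr_wpDl.
have gE z : c <= z -> cal_field z = Num.max 0 (gc - L * (z - c)).
  by move=> cz; rewrite cal_fieldE ?gtail //; lra.
have S : q * c ^+ 2 + r ^+ 2 * potential F c <= q * y ^+ 2 + r ^+ 2 * potential F y.
  apply: (@nondecr_der R (fun z => q * z ^+ 2 + r ^+ 2 * potential F z)
    (fun z => 2 * (q * z + r ^+ 2 * F z)) c y Ny) => z cz zy.
    by have D := dpotential z cF; deriv; ring.
  by rewrite mulr_ge0 // hN // ltW.
suff T : - (cal_field c) ^+ 2 - 2 * (p - 1) * cal_pot c <=
         - (cal_field y) ^+ 2 - 2 * (p - 1) * cal_pot y.
  by move: S T; rewrite /psi -/c; lra.
(* While the field is nonnegative, the derivative of the right side is [2 (L - (p - 1))] times the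
   field. *)
have T1 z : c <= z -> L * (z - c) <= gc ->
    - (cal_field c) ^+ 2 - 2 * (p - 1) * cal_pot c <=
    - (cal_field z) ^+ 2 - 2 * (p - 1) * cal_pot z.
  move=> cz zg; have gz x : c <= x -> x <= z -> cal_field x = gc - L * (x - c).
    move=> cx xz; rewrite gE // max_r // subr_ge0 (le_trans _ zg) //.
    by rewrite ler_pM2l //; lra.
  rewrite (gz c) // (gz z) //.
  apply: (@nondecr_der R (fun x => - (gc - L * (x - c)) ^+ 2 - 2 * (p - 1) * cal_pot x)
    (fun x => 2 * (L - (p - 1)) * (gc - L * (x - c))) c z cz) => x cx xz.
    by have D := dcal_pot x; deriv; rewrite gz //; ring.
  have : L * (x - c) <= L * (z - c) by rewrite ler_pM2l //; lra.
  by move=> ?; rewrite mulr_ge0 // ?mulr_ge0 //; lra.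
have [yg|gy] := leP (L * (y - c)) gc; first exact: T1.
(* The field reaches 0 at [z]; beyond it the field vanishes and [cal_pot] is constant. *)
pose z := c + gc / L.
have cz : c <= z by rewrite lerDl divr_ge0 // ltW.
have zL : L * (z - c) = gc by rewrite /z addrAC subrr add0r mulrC divfK // gt_eqF.
have zy : z <= y by rewrite -(ler_pM2l L0) -(lerD2r (- (L * c))) -!mulrBr zL ltW.
apply: (le_trans (T1 z cz (ltac:(by rewrite zL)))).
have gz x : z <= x -> cal_field x = 0.
  move=> zx; rewrite gE ?(le_trans cz) // max_l // -zL -mulrBr.
  by rewrite mulr_ge0_le0 //; [exact: ltW|lra].
rewrite (gz z) // (gz y) //.
have D0 x : z <= x -> x <= y -> is_derive x 1 (fun x => - 0 ^+ 2 - 2 * (p - 1) * cal_pot x) 0.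
  by move=> zx xy; have D := dcal_pot x; deriv; rewrite gz //; ring.
exact: (nondecr_der zy D0).
Qed.

(** A height above [u s] is either [u t] for a later radius [t], where [(r^2 - t^2) F (u t) >= 0],
    or lies beyond [u N] and falls under [psi_tail]. *)
Lemma psi_above r s y : 0 < r -> r <= b -> r <= s -> s <= N -> u s <= y ->
  Psi r (u s) <= Psi r y.
Proof.
move=> r0 rb rs sN sy; have s0 := lt_le_trans r0 rs.
have up t : s <= t -> t <= N -> Psi r (u s) <= Psi r (u t).
  move=> st tN; have t0 := lt_le_trans s0 st.
  rewrite !psi_sol //.
  apply: (nondecr_der st (fun x sx xt => dpsi_sol r (lt_le_trans s0 sx) (le_trans xt tN))).
  move=> x sx xt; have x0 : 0 < x by lra.
  have xN : x <= N by lra.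
  rewrite mulr_ge0 // mulr_le0 ?Fle // mulr_ge0_le0 ?u1x // subr_le0.
  by apply: sqr_le; lra.
have [yN|Ny] := leP y (u N).
  have [t [t0 tN ut]] := urange (lt_le_trans (upos (Iin s0 sN)) sy) yN.
  by rewrite -ut; apply: up => //; apply: ulr => //; rewrite ut.
exact: le_trans (up N sN (lexx _)) (psi_tail r0 rb (ltW Ny)).
Qed.

Lemma psi_below r s y : 0 < s -> s <= r -> r <= N -> 0 <= y -> y <= u s ->
  Psi r (u s) <= Psi r y.
Proof.
move=> s0 sr rN.
have pos z : 0 < z -> z <= u s -> Psi r (u s) <= Psi r z.
  move=> z0 zs; have sN := le_trans sr rN.
  have [t [t0 tN ut]] := urange z0 (le_trans zs (ule s0 (lexx _) sN)).
  have ts : t <= s by apply: ulr => //; rewrite ut.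
  rewrite -ut !psi_sol //.
  apply: (nonincr_der ts (fun x tx xs => dpsi_sol r (lt_le_trans t0 tx) (le_trans xs sN))).
  move=> x tx xs; have x0 : 0 < x by lra.
  have xN : x <= N by lra.
  rewrite mulr_ge0_le0 // mulr_ge0_le0 ?Fle // mulr_ge0 ?u1x // subr_ge0.
  by apply: sqr_le; lra.
(* The height 0 is not a value of [u]; it is reached by continuity of [psi] at 0. *)
rewrite le_eqVlt => /predU1P[<- _|]; last exact: pos.
have us0 : 0 < u s by apply: upos; apply: Iin => //; lra.
rewrite leNgt; apply/negP => h.
have cP : {for 0, continuous (Psi r)}.
  have cG : {for 0, continuous cal_pot} by exact: is_derive_continuous (dcal_pot 0).
  have cH : {for 0, continuous (potential F)}.
    exact: is_derive_continuous (dpotential 0 cF).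
  rewrite /psi; apply: continuousD; last first.
    by apply: continuousM => //; exact: cvg_cst.
  apply: continuousB; last by apply: continuousM => //; exact: cvg_cst.
  apply: continuousB; last by apply: cont_sq; exact: cal_field_cont.
  by apply: continuousM; [exact: cvg_cst|apply: cont_sq; exact: cvg_id].
have e0 : 0 < Psi r (u s) - Psi r 0 by rewrite subr_gt0.
have [d d0 Hd] := cont_near e0 cP.
have m0 : 0 < Num.min d (u s) by rewrite lt_min d0.
have md : Num.min d (u s) <= d by rewrite ge_min lexx.
have ms : Num.min d (u s) <= u s by rewrite ge_min lexx orbT.
have := pos (Num.min d (u s) / 2) (ltac:(lra)) (ltac:(lra)).
have := Hd (Num.min d (u s) / 2).
rewrite subr0 gtr0_norm ?divr_gt0 // => /(_ (ltac:(lra))).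
by rewrite ltr_norml => /andP[_]; lra.
Qed.

Lemma psi_min r y : 0 < r -> r <= b -> Psi r (u r) <= Psi r y.
Proof.
move=> r0 rb; apply: le_trans (psi_abs r y).
have rN : r <= N by have := bN; lra.
have [yr|ry] := leP `|y| (u r); first exact: psi_below.
by apply: psi_above => //; exact: ltW.
Qed.

(** On [[m, s]] the derivative of [psi r (u x)] is at least [2 (m^2 - c^2) |F (u x)| u' x], because
    [x^2 - r^2 >= m^2 - c^2]. The margin involves neither [b] nor the field, so it survives when [b]
    grows. *)
Lemma psi_gap_above r c m s y : 0 < r -> r <= c -> c < m -> m <= s -> s <= b ->
  u s <= `|y| ->
  2 * (m ^+ 2 - c ^+ 2) * (prim F (u m) - prim F (u s)) <= Psi r y - Psi r (u r).
Proof.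
move=> r0 rc cm ms sb sy; have rb : r <= b by lra.
have sN : s <= N by have := bN; lra.
have h1 : Psi r (u s) <= Psi r y.
  by apply: le_trans (psi_abs r y); apply: psi_above => //; lra.
have h2 : Psi r (u r) <= Psi r (u m).
  have mN : m <= N by have := bN; lra.
  by apply: psi_above => //; [lra|apply: ule => //; lra].
apply: (le_add_shifted h1 h2).
clear h1 h2 sy.
rewrite !psi_sol //; [|lra|lra|lra].
have D x : m <= x -> x <= s -> is_derive x 1
   (fun x => q * u x ^+ 2 - (x * u1 x) ^+ 2 - 2 * (p - 1) * cal_pot (u x)
      + r ^+ 2 * potential F (u x) + 2 * (m ^+ 2 - c ^+ 2) * prim F (u x))
   (2 * (u1 x * (r ^+ 2 - x ^+ 2) * F (u x)) + 2 * (m ^+ 2 - c ^+ 2) * (F (u x) * u1 x)).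
  move=> mx xs; have x0 : 0 < x by lra.
  have D1 := dpsi_sol r x0 (le_trans xs sN); have D2 := dprim (u x) cF.
  have [D3 _] := hu (Iin x0 (le_trans xs sN)).
  eapply derE; [eapply dD; [exact: D1|]|].
    by eapply dM; [exact: dcst|eapply dcomp; [exact: D2|exact: D3]].
  by cbv beta; ring.
apply: (nondecr_der ms D) => x mx xs; have x0 : 0 < x by lra.
have xN : x <= N by lra.
have -> : 2 * (u1 x * (r ^+ 2 - x ^+ 2) * F (u x)) + 2 * (m ^+ 2 - c ^+ 2) * (F (u x) * u1 x)
  = 2 * (u1 x * ((r ^+ 2 - c ^+ 2) + (m ^+ 2 - x ^+ 2)) * F (u x)) by ring.
rewrite mulr_ge0 // mulr_le0 ?Fle // mulr_ge0_le0 ?u1x //.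
have : r ^+ 2 <= c ^+ 2 by apply: sqr_le; lra.
have : m ^+ 2 <= x ^+ 2 by apply: sqr_le; lra.
lra.
Qed.

(** Mirror image of [psi_gap_above]: here [r^2 - x^2 >= c^2 - m^2] on [[s, m]], and [psi r (u x)]
    decreases. *)
Lemma psi_gap_below r c m s y : 0 < s -> s <= m -> m < c -> c <= r -> r <= b ->
  `|y| <= u s ->
  2 * (c ^+ 2 - m ^+ 2) * (prim F (u s) - prim F (u m)) <= Psi r y - Psi r (u r).
Proof.
move=> s0 sm mc cr rb sy; have r0 : 0 < r by lra.
have sN : s <= N by have := bN; lra.
have rN : r <= N by have := bN; lra.
have h1 : Psi r (u s) <= Psi r y.
  by apply: le_trans (psi_abs r y); apply: psi_below => //; lra.
have mN : m <= N by have := bN; lra.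
have h2 : Psi r (u r) <= Psi r (u m).
  apply: psi_below => //; [by apply/ltW/upos/Iin => //; lra|].
  by apply: ule => //; lra.
apply: (le_sub_shifted h1 h2).
clear h1 h2 sy.
rewrite !psi_sol //; last lra.
have D x : s <= x -> x <= m -> is_derive x 1
   (fun x => q * u x ^+ 2 - (x * u1 x) ^+ 2 - 2 * (p - 1) * cal_pot (u x)
      + r ^+ 2 * potential F (u x) - 2 * (c ^+ 2 - m ^+ 2) * prim F (u x))
   (2 * (u1 x * (r ^+ 2 - x ^+ 2) * F (u x)) - 2 * (c ^+ 2 - m ^+ 2) * (F (u x) * u1 x)).
  move=> sx xm; have x0 : 0 < x by lra.
  have D1 := dpsi_sol r x0 (le_trans xm mN); have D2 := dprim (u x) cF.
  have [D3 _] := hu (Iin x0 (le_trans xm mN)).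
  eapply derE; [eapply dD; [exact: D1|]|].
    by eapply dN; eapply dM; [exact: dcst|eapply dcomp; [exact: D2|exact: D3]].
  by cbv beta; ring.
apply: (nonincr_der sm D) => x sx xm; have x0 : 0 < x by lra.
have xN : x <= N by lra.
have -> : 2 * (u1 x * (r ^+ 2 - x ^+ 2) * F (u x)) - 2 * (c ^+ 2 - m ^+ 2) * (F (u x) * u1 x)
  = 2 * (u1 x * ((r ^+ 2 - c ^+ 2) + (m ^+ 2 - x ^+ 2)) * F (u x)) by ring.
rewrite mulr_ge0_le0 // mulr_ge0_le0 ?Fle // mulr_ge0 ?u1x //.
have : c ^+ 2 <= r ^+ 2 by apply: sqr_le; lra.
have : x ^+ 2 <= m ^+ 2 by apply: sqr_le; lra.
lra.
Qed.

End CalibrationField.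

Section RintBounds.
Variable R : realType.
Notation mu := (@lebesgue_measure R).

Lemma Rint_cst (a b k : R) : a <= b -> \int[mu]_(x in `[a, b]) k = k * (b - a).
Proof.
move=> ab; have cc : continuous (fun _ : R => k) by move=> x; exact: cvg_cst.
have D x : a <= x -> x <= b -> is_derive x 1 (fun x => k * x) k.
  by move=> _ _; deriv; ring.
rewrite (ftc2 ab D (fun x _ _ => cc x)); ring.
Qed.

Lemma Rint_ge0 (f : R -> R) a b : (forall x, a <= x -> x <= b -> 0 <= f x) ->
  0 <= \int[mu]_(x in `[a, b]) f x.
Proof.
by move=> f0; apply: Rintegral_ge0 => x /=; rewrite in_itv /= => /andP[]; exact: f0.
Qed.

Lemma Rint_ge_sub (f : R -> R) (a b c e k : R) : a <= c -> c <= e -> e <= b ->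
  mu.-integrable `[a, b] (EFin \o f) ->
  (forall x, a <= x -> x <= b -> 0 <= f x) ->
  (forall x, c <= x -> x <= e -> k <= f x) ->
  k * (e - c) <= \int[mu]_(x in `[a, b]) f x.
Proof.
move=> ac ce eb fi f0 fk.
have cb : c <= b by exact: le_trans eb.
have ae : a <= e by exact: le_trans ce.
have fcb : mu.-integrable `[c, b] (EFin \o f) by exact: integrable_itvS fi.
have fce : mu.-integrable `[c, e] (EFin \o f) by exact: integrable_itvS fi.
rewrite (Rint_split ac cb fi) (Rint_split ce eb fcb).
have h1 : 0 <= \int[mu]_(x in `[a, c]) f x.
  by apply: Rint_ge0 => x ax xc; apply: f0 => //; exact: le_trans cb.
have h2 : 0 <= \int[mu]_(x in `[e, b]) f x.
  by apply: Rint_ge0 => x ex xb; apply: f0 => //; exact: le_trans ex.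
have h3 : k * (e - c) <= \int[mu]_(x in `[c, e]) f x.
  rewrite -Rint_cst //; apply: Rint_le => //.
  by apply: cont_integrable => x _ _; exact: cvg_cst.
arith.
Qed.

End RintBounds.

(** * Lower bound of the energy by calibration *)

Section CalibratedEnergy.
Variables (R : realType) (p q : R) (F g G u u1 : R -> R) (a b : R).
Notation mu := (@lebesgue_measure R).
Hypotheses (cF : continuous F) (cg : continuous g).
Hypothesis dG : forall y : R, is_derive y 1 G (g y).
Hypotheses (a0 : 0 < a) (ab : a <= b).
Hypothesis du : forall r : R, a <= r -> r <= b -> is_derive r 1 u (u1 r).
Hypothesis cu1 : forall r : R, a <= r -> r <= b -> {for r, continuous u1}.
Hypothesis gu : forall r : R, a <= r -> r <= b -> g (u r) = r * u1 r.
Local Notation Psi := (psi p q F g G).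
Hypothesis psi_min_sol : forall r y : R, a <= r -> r <= b -> Psi r (u r) <= Psi r y.

(** The difference of the two sides is [r^p / r^2 (r dy - g y)^2]; the corresponding square for [u]
    vanishes by [gu]. The first line is the derivative of [2 r^(p-1) (G v - G u)] when [y] and [dy]
    come from a function [v]. *)
Lemma calibrated_density (r y dy : R) : a <= r -> r <= b ->
  2 * ((p - 1) * (r `^ p / r ^+ 2) * (G y - G (u r)) +
       r `^ p / r * (g y * dy - g (u r) * u1 r)) +
  r `^ p / r ^+ 2 * (Psi r y - Psi r (u r)) <=
  r `^ p * (dy ^+ 2 + q / r ^+ 2 * y ^+ 2 + potential F y) -
  r `^ p * (u1 r ^+ 2 + q / r ^+ 2 * u r ^+ 2 + potential F (u r)).
Proof.
move=> ar rb; have r0 : 0 < r by exact: lt_le_trans ar.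
rewrite -subr_ge0; apply: (@le_trans _ _ (r `^ p / r ^+ 2 * (r * dy - g y) ^+ 2)).
  by rewrite mulr_ge0 ?sqr_ge0 // divr_ge0 ?powR_ge0 ?sqr_ge0.
rewrite /psi gu // le_eqVlt; apply/orP; left; apply/eqP; field.
by rewrite gt_eqF.
Qed.

(** The exact term [B] vanishes at both ends with [eta], so the increase of energy is at least the
    integral of the excess of [psi]. That excess is nonnegative everywhere and only its part on
    [[c, e]] is kept. *)
Lemma calibrated_energy (eta eta1 : R -> R) (c e k : R) :
  (forall r : R, a <= r -> r <= b -> is_derive r 1 eta (eta1 r)) ->
  (forall r : R, a <= r -> r <= b -> {for r, continuous eta1}) ->
  eta a = 0 -> eta b = 0 -> a <= c -> c <= e -> e <= b ->
  (forall r : R, c <= r -> r <= e ->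
     k <= r `^ p / r ^+ 2 * (Psi r (u r + eta r) - Psi r (u r))) ->
  k * (e - c) <=
  \int[mu]_(r in `[a, b]) energy_density p q F (u \+ eta) (u1 \+ eta1) r -
  \int[mu]_(r in `[a, b]) energy_density p q F u u1 r.
Proof.
move=> deta ceta1 eta_a eta_b ac ce eb hk.
have cu r : a <= r -> r <= b -> {for r, continuous u}.
  by move=> ar rb; exact: is_derive_continuous (du ar rb).
have ceta r : a <= r -> r <= b -> {for r, continuous eta}.
  by move=> ar rb; exact: is_derive_continuous (deta r ar rb).
have rpos r : a <= r -> 0 < r by exact: lt_le_trans a0.
pose v := u \+ eta; pose v1 := u1 \+ eta1.
have cv r : a <= r -> r <= b -> {for r, continuous v}.
  by move=> ar rb; apply: continuousD; [exact: cu|exact: ceta].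
have cv1 r : a <= r -> r <= b -> {for r, continuous v1}.
  by move=> ar rb; apply: continuousD; [exact: cu1|exact: ceta1].
pose B r := 2 * (r `^ p / r * (G (v r) - G (u r))).
pose dB r := 2 * ((p - 1) * (r `^ p / r ^+ 2) * (G (v r) - G (u r)) +
       r `^ p / r * (g (v r) * v1 r - g (u r) * u1 r)).
have DB r : a <= r -> r <= b -> is_derive r 1 B (dB r).
  move=> ar rb; have D1 := du ar rb; have D2 := deta r ar rb; have r0 := rpos r ar.
  have D3 : is_derive r 1 v (v1 r) by exact: dD.
  have D4 := dG (v r); have D5 := dG (u r); have D6 := dpow p r0.
  have rn : r != 0 by rewrite gt_eqF.
  have D7 := dV rn (did r).
  eapply derE; [eapply dM; [exact: dcst|eapply dM]|].
  - by eapply dM; [exact: D6|exact: D7].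
  - by eapply dD; [eapply dcomp; [exact: D4|exact: D3]|eapply dN; eapply dcomp; [exact: D5|exact: D1]].
  - by cbv beta; rewrite /dB; field.
have cB r : a <= r -> r <= b -> {for r, continuous dB}.
  move=> ar rb; have r0 := rpos r ar.
  have cG y : {for y, continuous G} by exact: is_derive_continuous (dG y).
  have cGc (w : R -> R) : {for r, continuous w} -> {for r, continuous (fun r => G (w r))}.
    by move=> cw; apply: (@continuous_comp _ _ _ w G).
  have cgc (w : R -> R) : {for r, continuous w} -> {for r, continuous (fun r => g (w r))}.
    by move=> cw; apply: (@continuous_comp _ _ _ w g) => //; exact: cg.
  have ci : {for r, continuous (fun r : R => r^-1)}.
    exact: (is_derive_continuous (dV (f := fun y : R => y) (lt0r_neq0 r0) (did r))).
  have ci2 : {for r, continuous (fun r : R => (r ^+ 2)^-1)}.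
    have r2 : r ^+ 2 != 0 by rewrite sqrf_eq0 gt_eqF.
    exact: (is_derive_continuous (dV (f := fun y : R => y ^+ 2) r2 (dX 1 (did r)))).
  have cp := @cont_powR R p r r0.
  apply: continuousM; first exact: cvg_cst.
  apply: continuousD; apply: continuousM.
  - by apply: continuousM; [exact: cvg_cst|exact: continuousM].
  - by apply: continuousB; apply: cGc; [exact: cv|exact: cu].
  - exact: continuousM.
  - apply: continuousB; apply: continuousM.
    + by apply: cgc; exact: cv.
    + exact: cv1.
    + by apply: cgc; exact: cu.
    + exact: cu1.
have iB : mu.-integrable `[a, b] (EFin \o dB) by exact: cont_integrable.
have ie : mu.-integrable `[a, b] (EFin \o energy_density p q F u u1).
  apply: cont_integrable => r ar rb.
  by apply: energy_density_continuous; [exact: cF|exact: rpos|exact: cu|exact: cu1].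
have iev : mu.-integrable `[a, b] (EFin \o energy_density p q F v v1).
  apply: cont_integrable => r ar rb.
  by apply: energy_density_continuous; [exact: cF|exact: rpos|exact: cv|exact: cv1].
pose f r := energy_density p q F v v1 r - energy_density p q F u u1 r - dB r.
have fge r : a <= r -> r <= b -> r `^ p / r ^+ 2 * (Psi r (v r) - Psi r (u r)) <= f r.
  move=> ar rb; rewrite /f !energy_densityE ?rpos //.
  by have := calibrated_density (v r) (v1 r) ar rb; rewrite /dB; arith.
have i1 : mu.-integrable `[a, b]
    (EFin \o (fun r => energy_density p q F v v1 r - energy_density p q F u u1 r)).
  exact: (integrableB _ iev ie).
have fi : mu.-integrable `[a, b] (EFin \o f) by exact: (integrableB _ i1 iB).
have : k * (e - c) <= \int[mu]_(x in `[a, b]) f x.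
  apply: Rint_ge_sub => // r.
    move=> ar rb; apply: le_trans (fge r ar rb).
    by rewrite mulr_ge0 ?divr_ge0 ?powR_ge0 ?sqr_ge0 // subr_ge0 psi_min_sol.
  move=> cr re; apply: le_trans (fge r _ _); [exact: hk|exact: le_trans cr|exact: le_trans eb].
rewrite /f RintegralB // RintegralB // (ftc2 ab DB cB) /B /v /= eta_a eta_b !addr0.
have RE (I1 I2 x y x' y' : R) :
  I1 - I2 - (2 * (x * (y - y)) - 2 * (x' * (y' - y'))) = I1 - I2 by ring.
by rewrite RE.
Qed.

End CalibratedEnergy.

(** * Energy of competitors of the non-negative solution *)

Section MinimalSolution.
Variables (R : realType) (Rad : \bar R) (sp p q : R) (F u : R -> R).
Notation mu := (@lebesgue_measure R).
Implicit Types r t e s c x y a b : R.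
Hypotheses (hRad : (0 < Rad)%E) (hsp : 0 < sp) (hq : 0 < q) (hF : class_C1 F).
Hypotheses (hF0 : F 0 = 0) (hFsp : F sp = 0).
Hypothesis hFneg : forall t, 0 < t -> t < sp -> F t < 0.
Hypothesis hFpos : forall t, sp < t -> 0 <= F t.
Hypothesis hFsym : forall t, 0 <= t -> (F t + F (- t)) / 2 <= 0.
Hypothesis hu : nonneg_solution Rad sp p q F u.
Local Notation I := (interval0 Rad).
Local Notation u1 := (u^`()%classic).

Lemma class_C1_continuous : continuous F.
Proof. by move=> x; exact: (is_derive_continuous (derive1P (proj1 hF x))). Qed.

Let cF := class_C1_continuous.
Let hode : ode Rad p q F u u1. Proof. exact: nonneg_solution_ode hu. Qed.
Let hu0 : u x @[x --> 0^'+] --> 0. Proof. by case: hu. Qed.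
Let hus : end_value Rad u sp. Proof. by case: hu. Qed.
Let hupos r : I r -> 0 <= u r. Proof. by case: hu => _ _ _; exact. Qed.

Lemma nonneg_solution_gt0 r : I r -> 0 < u r.
Proof. exact: (sol_pos hRad hsp hq hF hF0 hFsp hFneg hFpos hode hu0 hus hupos). Qed.

Lemma nonneg_solution_lt r : I r -> u r < sp.
Proof. exact: (sol_lt hRad hsp hq hFsp hFpos hode hu0 hus). Qed.

Let uincr x y : I x -> I y -> x < y -> u x < u y.
Proof. exact: (sol_incr hRad hsp hq hF hF0 hFsp hFneg hFpos hode hu0 hus hupos). Qed.

Lemma nonneg_solution_der_ge0 r : I r -> 0 <= u1 r.
Proof. exact: (sol_der_ge0 hRad hsp hq hF hF0 hFsp hFneg hFpos hode hu0 hus hupos). Qed.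

Let Fle t : 0 <= t -> t <= sp -> F t <= 0.
Proof. by have [L L0 HL] := F_lower hsp hF hF0 hFsp hFneg => t0 ts; have [] := HL t t0 ts. Qed.

Let scale0 e : 0 < e -> exists2 d, I d & forall r, 0 < r -> r <= d -> r * u1 r <= e.
Proof.
have [L L0 HL] := F_lower hsp hF hF0 hFsp hFneg.
exact: (sol_scale_der hRad hq L0 HL hode hu0 nonneg_solution_gt0 nonneg_solution_lt
  nonneg_solution_der_ge0).
Qed.

Lemma nonneg_solution_energy_integrable a b : 0 <= a -> a <= b -> (b%:E <= Rad)%E ->
  mu.-integrable `[a, b] (EFin \o energy_density p q F u u1).
Proof.
have [L L0 HL] := F_lower hsp hF hF0 hFsp hFneg.
exact: (sol_energy_integrable hRad hsp hq cF L0 HL hode nonneg_solution_gt0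
  nonneg_solution_lt nonneg_solution_der_ge0).
Qed.

Let excess (a b : R) (eta eta1 : R -> R) : R :=
  \int[mu]_(r in `[a, b]) energy_density p q F (u \+ eta) (u1 \+ eta1) r -
  \int[mu]_(r in `[a, b]) energy_density p q F u u1 r.

(** Perturbations of class C^1 rather than test functions, because the product of a cutoff with a
    difference of two solutions will be one of them. *)
Definition admissible (a b : R) (eta eta1 : R -> R) : Prop :=
  [/\ forall r, a <= r -> r <= b -> is_derive r 1 eta (eta1 r),
      forall r, a <= r -> r <= b -> {for r, continuous eta1},
      eta a = 0 & eta b = 0].

(** All that is used later of the calibration up to [b]. The fields depend on [b]; the margins on
    the left of the last two items do not. *)
Let field b : I b -> exists g G : R -> R,
  [/\ forall a c e k eta eta1, 0 < a -> a <= c -> c <= e -> e <= b -> admissible a b eta eta1 ->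
        (forall r, c <= r -> r <= e ->
          k <= r `^ p / r ^+ 2 * (psi p q F g G r (u r + eta r) - psi p q F g G r (u r))) ->
        k * (e - c) <= excess a b eta eta1,
      forall r y, 0 < r -> r <= b -> psi p q F g G r (u r) <= psi p q F g G r y,
      forall r c m s y, 0 < r -> r <= c -> c < m -> m <= s -> s <= b -> u s <= `|y| ->
        2 * (m ^+ 2 - c ^+ 2) * (prim F (u m) - prim F (u s)) <=
        psi p q F g G r y - psi p q F g G r (u r) &
      forall r c m s y, 0 < s -> s <= m -> m < c -> c <= r -> r <= b -> `|y| <= u s ->
        2 * (c ^+ 2 - m ^+ 2) * (prim F (u s) - prim F (u m)) <=
        psi p q F g G r y - psi p q F g G r (u r)].
Proof.
move=> Ib; have [N [IN bN hN]] := inner_bound hRad hsp hq cF hFsp hFneg hFpos hus Ib.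
have [g [cg g0 gu gtail urange]] := field_exists hode hu0 nonneg_solution_gt0
  nonneg_solution_der_ge0 uincr scale0 IN.
have hpot := potential_sym cF hFsym.
have psi_min_b := psi_min cF Fle hpot hode nonneg_solution_gt0 nonneg_solution_lt
  nonneg_solution_der_ge0 uincr IN bN hN cg g0 gu gtail urange.
exists (cal_field g), (cal_pot g); split.
- move=> a c e k eta eta1 a0 ac ce eb [h1 h2 h3 h4] hk.
  have Iin r : a <= r -> r <= b -> I r.
    by move=> ar rb; apply: (interval0_left Ib) => //; exact: lt_le_trans ar.
  apply: (calibrated_energy cF (cal_field_cont cg) (dcal_pot cg) a0) => //.
  + exact: le_trans ac (le_trans ce eb).
  + by move=> r ar rb; have [] := hode (Iin r ar rb).
  + by move=> r ar rb; exact: (ode_cont1 hode (Iin r ar rb)).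
  + move=> r ar rb; apply: (cal_field_sol nonneg_solution_gt0 IN g0 gu).
      exact: lt_le_trans ar.
    exact: le_trans rb (ltW bN).
  + by move=> r y ar rb; apply: psi_min_b => //; exact: lt_le_trans ar.
- exact: psi_min_b.
- exact: (psi_gap_above cF Fle hpot hode nonneg_solution_gt0 nonneg_solution_lt
    nonneg_solution_der_ge0 uincr IN bN hN cg g0 gu gtail urange).
- exact: (psi_gap_below cF Fle hpot hode nonneg_solution_gt0 nonneg_solution_lt
    nonneg_solution_der_ge0 uincr IN bN cg g0 gu urange).
Qed.

Lemma nonneg_solution_minimal a b eta eta1 : 0 < a -> a <= b -> I b ->
  admissible a b eta eta1 ->
  \int[mu]_(r in `[a, b]) energy_density p q F u u1 r <=
  \int[mu]_(r in `[a, b]) energy_density p q F (u \+ eta) (u1 \+ eta1) r.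
Proof.
move=> a0 ab Ib h; have [g [G [H1 H2 _ _]]] := field Ib.
rewrite -subr_ge0; have := H1 a a b 0 eta eta1 a0 (lexx _) ab (lexx _) h.
rewrite mul0r; apply => r ar rb; have r0 : 0 < r by exact: lt_le_trans ar.
by rewrite mulr_ge0 ?divr_ge0 ?powR_ge0 ?sqr_ge0 // subr_ge0 H2.
Qed.

(** By continuity [|v|] stays on one side of a fixed height [u s] on an interval [[c, e]] next to
    [r0], where the margins of [psi] apply. The loss [d] has to be uniform in [a], [b] and [eta],
    since the transition zones of the cutoff will move towards the ends. *)
Lemma nonneg_solution_gap (v : R -> R) r0 : I r0 -> {for r0, continuous v} ->
  `|v r0| != u r0 ->
  exists c e s d : R, [/\ I c /\ I e, I s, c < e, 0 < d &
    forall a b eta eta1, 0 < a -> a <= c -> e <= b -> s <= b -> I b ->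
      admissible a b eta eta1 ->
      (forall r, c <= r -> r <= e -> eta r = v r - u r) ->
      d <= excess a b eta eta1].
Proof.
move=> I0 cv vu; have r00 := interval0_pos I0.
have [e0 e00 He0] := interval0_nbhs I0.
have cu := ode_cont hode I0.
have cav : {for r0, continuous (fun r => `|v r|)}.
  by apply: (@continuous_comp _ _ _ v Num.norm) => //; exact: norm_continuous.
(* It suffices to bound the excess of [psi] below by some [k] on [[c, e]], since the weight
   [r^p / r^2] is at least [m / e^2] there. *)
have build c e s k : I c -> I e -> I s -> c < e -> 0 < k ->
    (forall b g G, e <= b -> s <= b -> I b ->
      (forall r y, 0 < r -> r <= b -> psi p q F g G r (u r) <= psi p q F g G r y) ->
      (forall r c m s y, 0 < r -> r <= c -> c < m -> m <= s -> s <= b -> u s <= `|y| ->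
        2 * (m ^+ 2 - c ^+ 2) * (prim F (u m) - prim F (u s)) <=
        psi p q F g G r y - psi p q F g G r (u r)) ->
      (forall r c m s y, 0 < s -> s <= m -> m < c -> c <= r -> r <= b -> `|y| <= u s ->
        2 * (c ^+ 2 - m ^+ 2) * (prim F (u s) - prim F (u m)) <=
        psi p q F g G r y - psi p q F g G r (u r)) ->
      forall r, c <= r -> r <= e ->
        k <= psi p q F g G r (v r) - psi p q F g G r (u r)) ->
    exists c e s d : R, [/\ I c /\ I e, I s, c < e, 0 < d &
    forall a b eta eta1, 0 < a -> a <= c -> e <= b -> s <= b -> I b ->
      admissible a b eta eta1 ->
      (forall r, c <= r -> r <= e -> eta r = v r - u r) ->
      d <= excess a b eta eta1].
  move=> Ic Ie Is ce k0 H; have c0 := interval0_pos Ic.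
  have [m [M [m0 M0 mM]]] := powR_bounds p e c0.
  have e2 : 0 < e ^+ 2 by rewrite exprn_gt0 // (lt_trans c0).
  exists c, e, s, (m / e ^+ 2 * k * (e - c)); split=> //.
    by rewrite !mulr_gt0 ?invr_gt0 ?subr_gt0.
  move=> a b eta eta1 a0 ac eb sb Ib h etav.
  have [g [G [H1 H2 H3 H4]]] := field Ib.
  apply: (H1 a c e _ eta eta1 a0 ac (ltW ce) eb h) => r cr re.
  rewrite etav // [u r + _]addrC subrK.
  have r_0 : 0 < r by exact: lt_le_trans cr.
  have [mr _] := mM r cr re.
  apply: ler_pM.
  - by rewrite divr_ge0 ?sqr_ge0 // ltW.
  - exact: ltW.
  - apply: (@le_trans _ _ (r `^ p / e ^+ 2)).
      by rewrite ler_pM2r ?invr_gt0.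
    by apply: le_divXn => //; exact: powR_ge0.
  - exact: (H b g G).
have prim_lt x y : I x -> I y -> x < y -> prim F (u y) < prim F (u x).
  move=> Ix Iy xy; apply: (prim_decr hF hFneg).
  - exact/ltW/nonneg_solution_gt0.
  - exact: uincr.
  - exact/ltW/nonneg_solution_lt.
have [lt|gt|//] := ltgtP (`|v r0|) (u r0); last by move=> E; rewrite E eqxx in vu.
(* The points [s < m < c < r0] are equally spaced, and on [[c, r0]] one has
   [|v| <= |v r0| + dl = u r0 - dl <= u s]. *)
- pose dl := (u r0 - `|v r0|) / 2.
  have dl0 : 0 < dl by rewrite divr_gt0 // subr_gt0.
  have [d1 d10 Hd1] := cont_near dl0 cu.
  have [d2 d20 Hd2] := cont_near dl0 cav.
  pose t := Num.min e0 (Num.min d1 d2) / 2.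
  have m0 : 0 < Num.min e0 (Num.min d1 d2) by rewrite !lt_min e00 d10.
  have me : Num.min e0 (Num.min d1 d2) <= e0 by rewrite ge_min lexx.
  have md1 : Num.min e0 (Num.min d1 d2) <= d1 by rewrite !ge_min lexx !orbT.
  have md2 : Num.min e0 (Num.min d1 d2) <= d2 by rewrite !ge_min lexx !orbT.
  have t0 : 0 < t by rewrite /t; arith.
  have Ir r : `|r - r0| <= t -> I r by move=> h; apply: He0; apply: le_lt_trans h _; rewrite /t; arith.
  have ball x : - t <= x - r0 -> x - r0 <= t -> `|x - r0| <= t.
    by move=> *; rewrite ler_norml; apply/andP.
  pose s := r0 - t; pose m := r0 - 2 * t / 3; pose c := r0 - t / 3.
  have Is : I s by apply/Ir/ball; rewrite /s; arith.
  have Im : I m by apply/Ir/ball; rewrite /m; arith.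
  have Ic : I c by apply/Ir/ball; rewrite /c; arith.
  have s0 := interval0_pos Is.
  have us : u r0 - dl <= u s.
    have /Hd1 : `|s - r0| < d1.
      by apply: (@le_lt_trans _ _ t); [apply: ball; rewrite /s; arith|rewrite /t; arith].
    by rewrite ltr_norml => /andP[? _]; arith.
  apply: (build c r0 r0 (2 * (c ^+ 2 - m ^+ 2) * (prim F (u s) - prim F (u m)))) => //.
  + by rewrite /c; arith.
  + rewrite !mulr_gt0 ?subr_gt0 //; last by apply: prim_lt => //; rewrite /s /m; arith.
    by rewrite ltrXn2r // ?ltW ?(interval0_pos Im) // /c /m; arith.
  + move=> b g G r0b _ Ib _ _ H4 r cr rr.
    apply: H4 => //; rewrite /s /m /c; [arith|arith|arith|].
    have /Hd2 : `|r - r0| < d2.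
      by apply: (@le_lt_trans _ _ t); [apply: ball; move: cr; rewrite /c; arith|rewrite /t; arith].
    rewrite ltr_norml => /andP[_ h]; rewrite -/s; move: us h; rewrite /dl; arith.
(* Mirror case, with [r0 < c < m < s] and the interval [[r0, c]]. *)
- pose dl := (`|v r0| - u r0) / 2.
  have dl0 : 0 < dl by rewrite divr_gt0 // subr_gt0.
  have [d1 d10 Hd1] := cont_near dl0 cu.
  have [d2 d20 Hd2] := cont_near dl0 cav.
  pose t := Num.min e0 (Num.min d1 d2) / 2.
  have m0 : 0 < Num.min e0 (Num.min d1 d2) by rewrite !lt_min e00 d10.
  have me : Num.min e0 (Num.min d1 d2) <= e0 by rewrite ge_min lexx.
  have md1 : Num.min e0 (Num.min d1 d2) <= d1 by rewrite !ge_min lexx !orbT.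
  have md2 : Num.min e0 (Num.min d1 d2) <= d2 by rewrite !ge_min lexx !orbT.
  have t0 : 0 < t by rewrite /t; arith.
  have Ir r : `|r - r0| <= t -> I r by move=> h; apply: He0; apply: le_lt_trans h _; rewrite /t; arith.
  have ball x : - t <= x - r0 -> x - r0 <= t -> `|x - r0| <= t.
    by move=> *; rewrite ler_norml; apply/andP.
  pose s := r0 + t; pose m := r0 + 2 * t / 3; pose c := r0 + t / 3.
  have Is : I s by apply/Ir/ball; rewrite /s; arith.
  have Im : I m by apply/Ir/ball; rewrite /m; arith.
  have Ic : I c by apply/Ir/ball; rewrite /c; arith.
  have us : u s <= u r0 + dl.
    have /Hd1 : `|s - r0| < d1.
      by apply: (@le_lt_trans _ _ t); [apply: ball; rewrite /s; arith|rewrite /t; arith].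
    by rewrite ltr_norml => /andP[_ ?]; arith.
  apply: (build r0 c s (2 * (m ^+ 2 - c ^+ 2) * (prim F (u m) - prim F (u s)))) => //.
  + by rewrite /c; arith.
  + rewrite !mulr_gt0 ?subr_gt0 //; last by apply: prim_lt => //; rewrite /s /m; arith.
    by rewrite ltrXn2r // ?ltW ?(interval0_pos Ic) // /c /m; arith.
  + move=> b g G cb sb Ib _ H3 _ r rr rc.
    apply: H3 => //; [arith|rewrite /c /m; arith|rewrite /s /m; arith|].
    have /Hd2 : `|r - r0| < d2.
      by apply: (@le_lt_trans _ _ t); [apply: ball; move: rc; rewrite /c; arith|rewrite /t; arith].
    rewrite ltr_norml => /andP[h _]; move: us h; rewrite /dl; arith.
Qed.

End MinimalSolution.

(** * Local minimality *)

Section TestFunctions.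
Variable R : realType.
Notation mu := (@lebesgue_measure R).
Implicit Types (phi : R -> R) (x a b : R).

Lemma test_function_der (U : set R) phi x : test_function U phi ->
  is_derive x 1 phi (phi^`()%classic x).
Proof. by case=> H _ _; exact: derive1P (H 0%N x). Qed.

Lemma test_function_cont1 (U : set R) phi x : test_function U phi ->
  {for x, continuous phi^`()%classic}.
Proof. by case=> H _ _; exact: is_derive_continuous (derive1P (H 1%N x)). Qed.

(** The extreme points of the compact support are pushed outwards inside [U]. Outside []a, b[] the
    function then vanishes on a neighbourhood of each point, hence so does its derivative. *)
Lemma test_function_support (U : set R) phi : open U -> test_function U phi ->
  (forall x, phi x = 0) \/
  exists a b, [/\ a < b, U a, U b &
    forall x, (x <= a) || (b <= x) -> phi x = 0 /\ phi^`()%classic x = 0].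
Proof.
move=> oU [dphi cK KU]; set S := [set x | phi x != 0] in cK KU *.
have [S0|/set0P[z Sz]] := eqVneq S set0.
  left=> x; apply/eqP; rewrite -[_ == _]negbK; apply/negP => xS.
  by have : S x by []; rewrite S0.
right; have SK : S `<=` closure S by exact: subset_closure.
have K0 : closure S !=set0 by exists z; exact: SK.
have cid : {within closure S, continuous (fun x : R => x)}.
  by apply: continuous_subspaceT => x; exact: cvg_id.
have [M KM HM] := compact_EVT_max K0 cK cid.
have [m Km Hm] := compact_EVT_min K0 cK cid.
rewrite inE in KM; rewrite inE in Km.
have Sm x : S x -> m <= x by move=> Sx; apply: Hm; rewrite inE; exact: SK.
have SM x : S x -> x <= M by move=> Sx; apply: HM; rewrite inE; exact: SK.
have : nbhs m U by apply: open_nbhs_nbhs; split => //; exact: KU.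
move=> /nbhs_ballP[e1 /= e10 Um].
have : nbhs M U by apply: open_nbhs_nbhs; split => //; exact: KU.
move=> /nbhs_ballP[e2 /= e20 UM].
have mM : m <= M by exact: le_trans (Sm z Sz) (SM z Sz).
exists (m - e1 / 2), (M + e2 / 2); split.
- arith.
- by apply: Um; rewrite /ball /= opprB addrC subrK gtr0_norm ?divr_gt0 //; arith.
- by apply: UM; rewrite /ball /= opprD addrA subrr sub0r normrN gtr0_norm ?divr_gt0 //; arith.
move=> x xm.
have out y : (y < m) || (M < y) -> phi y = 0.
  move=> ym; apply/eqP; rewrite -[_ == _]negbK; apply/negP => Sy.
  by move: ym; rewrite !ltNge Sm // SM.
have near0 : \forall y \near x, phi y = 0.
  case/orP: xm => xm.
    have : \forall y \near x, y < m by apply: lt_nbhsl; arith.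
    by apply: filterS => y ym; apply: out; rewrite ym.
  have : \forall y \near x, M < y by apply: lt_nbhsr; arith.
  by apply: filterS => y ym; apply: out; rewrite ym orbT.
split; first exact: nbhs_singleton near0.
have E : \forall y \near x, 0 = phi y by apply: filterS near0 => y ->.
exact: (is_derive_derive1 (near_eq_is_derive E (dcst 0 x))).
Qed.

Lemma test_function0 (U : set R) phi : (forall x, phi x = 0) ->
  phi = (fun=> 0) /\ phi^`()%classic = (fun=> 0).
Proof.
move=> H; have -> : phi = (fun=> 0) by apply/funext.
by split=> //; apply/funext => x; exact: is_derive_derive1 (dcst 0 x).
Qed.

Lemma Rint_support (D : set R) (f : R -> R) a b : measurable D -> `[a, b] `<=` D ->
  (forall x, D x -> ~~ (a <= x <= b) -> f x = 0) ->
  \int[mu]_(x in D) f x = \int[mu]_(x in `[a, b]) f x.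
Proof.
move=> mD abD f0; rewrite -[in RHS](setIidr abD) Rintegral_mkcondr.
apply: eq_Rintegral => x; rewrite inE => Dx; rewrite patchE.
case: ifPn => //; rewrite notin_setE /= in_itv /= => /negP h.
exact: f0.
Qed.

(** Meant for intervals touching 0, where the densities are not known to be continuous: only
    [g - f], which lives on [[a', b']], has to be examined. *)
Lemma integrable_patch (f g : R -> R) a b a' b' : a <= a' -> b' <= b ->
  mu.-integrable `[a, b] (EFin \o f) -> mu.-integrable `[a', b'] (EFin \o g) ->
  (forall x, a <= x -> x <= b -> ~~ (a' <= x <= b') -> g x = f x) ->
  mu.-integrable `[a, b] (EFin \o g) /\
  \int[mu]_(x in `[a, b]) g x - \int[mu]_(x in `[a, b]) f x =
  \int[mu]_(x in `[a', b']) g x - \int[mu]_(x in `[a', b']) f x.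
Proof.
move=> aa bb fi gi gf.
have fi' : mu.-integrable `[a', b'] (EFin \o f) by exact: integrable_itvS fi.
pose d x := g x - f x.
have di' : mu.-integrable `[a', b'] (EFin \o d) by exact: (integrableB _ gi fi').
have sub : `[a', b'] `<=` (`[a, b] : set R).
  move=> x /=; rewrite !in_itv /= => /andP[ax xb].
  by rewrite (le_trans aa ax) (le_trans xb bb).
have di : mu.-integrable `[a, b] (EFin \o d).
  have : mu.-integrable `[a, b] ((EFin \o d) \_ `[a', b']).
    have : mu.-integrable setT ((EFin \o d) \_ `[a', b']).
      by apply/(integrable_mkcond _ _).1.
    by apply: integrableS => //; exact: subsetT.
  apply: eq_integrable => // x; rewrite inE /= in_itv /= => /andP[ax xb].
  rewrite patchE; case: ifPn => //; rewrite notin_setE /= in_itv /= => /negP h.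
  by rewrite /d gf // subrr.
have gE : g = (fun x => d x + f x) by apply/funext => x; rewrite /d subrK.
have gi2 : mu.-integrable `[a, b] (EFin \o g).
  by rewrite gE; exact: (integrableD _ di fi).
split=> //; rewrite -!RintegralB //.
apply: Rint_support => // x /=; rewrite in_itv /= => /andP[ax xb] h.
by rewrite gf // subrr.
Qed.

End TestFunctions.

Section LocalMinimality.
Variables (R : realType) (Rad : \bar R) (sp p q : R) (F u : R -> R).
Notation mu := (@lebesgue_measure R).
Hypotheses (hRad : (0 < Rad)%E) (hsp : 0 < sp) (hq : 0 < q) (hF : class_C1 F).
Hypotheses (hF0 : F 0 = 0) (hFsp : F sp = 0).
Hypothesis hFneg : forall t, 0 < t -> t < sp -> F t < 0.
Hypothesis hFpos : forall t, sp < t -> 0 <= F t.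
Hypothesis hFsym : forall t, 0 <= t -> (F t + F (- t)) / 2 <= 0.
Hypothesis hu : nonneg_solution Rad sp p q F u.
Local Notation I := (interval0 Rad).
Local Notation u1 := (u^`()%classic).

Lemma measurable_interval0 : measurable (I : set R).
Proof. by apply: open_measurable; exact: open_interval0. Qed.

Lemma itv_sub_interval0 (a b : R) : I a -> I b -> `[a, b] `<=` I.
Proof.
move=> Ia Ib x /=; rewrite in_itv /= => /andP[ax xb]; exact: interval0_conv Ia Ib ax xb.
Qed.

Lemma L2loc_cont (f : R -> R) : (forall r, I r -> {for r, continuous f}) -> L2loc I f.
Proof.
move=> cf; have m (g : R -> R) : (forall r, I r -> {for r, continuous g}) -> measurable_fun I g.
  move=> cg; apply: open_continuous_measurable_fun; first exact: open_interval0.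
  by move=> x /set_mem; exact: cg.
have cf2 r : I r -> {for r, continuous (fun x => f x ^+ 2)}.
  by move=> Ir; apply: cont_sq; exact: cf.
split; first exact: m.
split; [exact: m|exact: open_interval0|move=> K KI cK].
have : mu.-integrable K (EFin \o (fun x => f x ^+ 2)).
  apply: continuous_compact_integrable => //.
  by apply: continuous_in_subspaceT => x /set_mem/KI; exact: cf2.
by case/integrableP.
Qed.

Lemma weak_derivative_C1 (f f1 : R -> R) :
  (forall r, I r -> is_derive r 1 f (f1 r)) ->
  (forall r, I r -> {for r, continuous f1}) ->
  weak_derivative I f f1.
Proof.
move=> df cf1 phi tphi; have mI := measurable_interval0.
have [z|[a [b [ab Ia Ib out]]]] := test_function_support (@open_interval0 R Rad) tphi.
  have [phi0 phi10] := test_function0 setT z.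
  have E0 : \int[mu]_(x in I) (0 : R) = 0 by rewrite Rintegral_cst // mul0r.
  transitivity (0 : R).
    by rewrite -[RHS]E0; apply: eq_Rintegral => x _; rewrite phi10 mulr0.
  apply/eqP; rewrite eq_sym oppr_eq0; apply/eqP.
  by rewrite -[RHS]E0; apply: eq_Rintegral => x _; rewrite phi0 mulr0.
have Iab x : a <= x -> x <= b -> I x by exact: interval0_conv.
have outb x : ~~ (a <= x <= b) -> phi x = 0 /\ phi^`()%classic x = 0.
  rewrite negb_and -!ltNge => /orP[/ltW xa|/ltW bx]; apply: out; first by rewrite xa.
  by rewrite bx orbT.
have cphi x : {for x, continuous phi}.
  exact: is_derive_continuous (test_function_der x tphi).
have c1 x : a <= x -> x <= b -> {for x, continuous (fun x => f x * phi^`()%classic x)}.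
  move=> ax xb; apply: continuousM; last exact: test_function_cont1 tphi.
  exact: is_derive_continuous (df x (Iab x ax xb)).
have c2 x : a <= x -> x <= b -> {for x, continuous (fun x => f1 x * phi x)}.
  by move=> ax xb; apply: continuousM => //; exact/cf1/Iab.
rewrite (Rint_support mI (itv_sub_interval0 Ia Ib)); last first.
  by move=> x _ /outb[_ ->]; rewrite mulr0.
rewrite (Rint_support (f := fun x => f1 x * phi x) mI (itv_sub_interval0 Ia Ib)); last first.
  by move=> x _ /outb[-> _]; rewrite mulr0.
apply/eqP; rewrite -addr_eq0; apply/eqP.
rewrite -RintegralD //; [|exact: cont_integrable|exact: cont_integrable].
have D x : a <= x -> x <= b ->
    is_derive x 1 (fun x => f x * phi x) (f x * phi^`()%classic x + f1 x * phi x).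
  move=> ax xb; have D1 := df x (Iab x ax xb); have D2 := test_function_der x tphi.
  eapply derE; [eapply dM; [exact: D1|exact: D2]|by rewrite addrC].
have cD x : a <= x -> x <= b ->
    {for x, continuous (fun x => f x * phi^`()%classic x + f1 x * phi x)}.
  by move=> ax xb; apply: continuousD; [exact: c1|exact: c2].
have [phia _] := out a (ltac:(by rewrite lexx)).
have [phib _] := out b (ltac:(by rewrite lexx orbT)).
by rewrite (ftc2 (ltW ab) D cD) phia phib !mulr0 subrr.
Qed.

Lemma nonneg_solution_locally_minimizing : locally_energy_minimizing Rad p q F u.
Proof.
have cF := class_C1_continuous hF.
have hode := nonneg_solution_ode hu.
have cu r : I r -> {for r, continuous u} by exact: ode_cont hode.
have cu1 r : I r -> {for r, continuous u1} by exact: ode_cont1 hode.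
exists u1; split.
- exact: L2loc_cont.
- exact: L2loc_cont.
- by apply: weak_derivative_C1 => // r Ir; have [] := hode r Ir.
move=> a b a0 ab bR.
have ie := nonneg_solution_energy_integrable hRad hsp hq hF hF0 hFsp hFneg hFpos hu a0 ab bR.
split; [exact: ie|move=> phi tphi].
have oab : open (`]a, b[ : set R) by exact: interval_open.
(* [phi] lives on some [[a', b']] inside []a, b[], so [a' > 0] and [b' < Rad] even when [a = 0] or
   [b = Rad]. *)
have [z|[a' [b' [ab' /= Ia' Ib' out]]]] := test_function_support oab tphi.
  have [-> ->] := test_function0 setT z.
  by have addf0 (f : R -> R) : f \+ (fun=> 0) = f;
    [apply/funext => x; rewrite /= addr0|rewrite !addf0].
move: Ia' Ib'; rewrite !in_itv /= => /andP[aa _] /andP[_ bb].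
have a'0 : 0 < a' by exact: le_lt_trans aa.
have Ib' : I b'.
  by split; [exact: lt_trans ab'|apply: lt_le_trans bR; rewrite lte_fin].
have Iab x : a' <= x -> x <= b' -> I x.
  by move=> ax; apply: interval0_left Ib' _; exact: lt_le_trans ax.
have cphi x : {for x, continuous phi}.
  exact: is_derive_continuous (test_function_der x tphi).
have ie2 : mu.-integrable `[a', b']
    (EFin \o energy_density p q F (u \+ phi) (u1 \+ phi^`()%classic)).
  apply: cont_integrable => x ax xb; apply: energy_density_continuous => //.
  - exact: lt_le_trans ax.
  - by apply: continuousD => //; exact/cu/Iab.
  - by apply: continuousD; [exact/cu1/Iab|exact: test_function_cont1 tphi].
have eqout x : a <= x -> x <= b -> ~~ (a' <= x <= b') ->
    energy_density p q F (u \+ phi) (u1 \+ phi^`()%classic) x = energy_density p q F u u1 x.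
  move=> _ _; rewrite negb_and -!ltNge => h.
  have [] := out x; first by case/orP: h => /ltW ->; rewrite ?orbT.
  by move=> h1 h2; rewrite /energy_density /= h1 h2 !addr0.
have [ie3 diff] := integrable_patch (ltW aa) (ltW bb) ie ie2 eqout.
rewrite /energy (integral_EFin ie) (integral_EFin ie3).
apply: lee_wpmul2l; first by rewrite lee_fin invr_ge0.
rewrite lee_fin -subr_ge0 diff subr_ge0.
apply: (nonneg_solution_minimal hRad hsp hq hF hF0 hFsp hFneg hFpos hFsym hu a'0 (ltW ab') Ib').
split.
- by move=> r _ _; exact: test_function_der tphi.
- by move=> r _ _; exact: test_function_cont1 tphi.
- by have [] := out a' (ltac:(by rewrite lexx)).
- by have [] := out b' (ltac:(by rewrite lexx orbT)).
Qed.

End LocalMinimality.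

(** * Smooth functions of compact support *)

Section Smooth.
Variable R : realType.
Implicit Types (f g : R -> R) (x y : R).

Definition smooth f : Prop := forall (n : nat) x, derivable f^`(n) x 1.

(** Coinduction principle: smoothness is proved without formulas for iterated derivatives. *)
Lemma smooth_ind_class (S : set (R -> R)) :
  (forall f, S f -> exists2 g, S g & forall x, is_derive x 1 f (g x)) ->
  forall f, S f -> smooth f.
Proof.
move=> HS f Sf n; elim: n f Sf => [|n IH] f Sf x; have [g Sg D] := HS f Sf.
  by have [] := D x.
rewrite derive1Sn (_ : f^`()%classic = g); first exact: IH.
by apply/funext => y; exact: is_derive_derive1 (D y).
Qed.

Lemma smooth_der f x : smooth f -> is_derive x 1 f (f^`()%classic x).
Proof. by move=> sf; exact: derive1P (sf 0%N x). Qed.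

Lemma smooth_derive1 f : smooth f -> smooth f^`()%classic.
Proof. by move=> sf n x; have := sf n.+1 x; rewrite derive1Sn. Qed.

Lemma smooth_cont f : smooth f -> continuous f.
Proof. by move=> sf x; exact: is_derive_continuous (smooth_der x sf). Qed.

Lemma smooth_prim f : smooth f -> smooth (prim f).
Proof.
move=> sf; apply: (@smooth_ind_class [set h | h = prim f \/ smooth h]); last by left.
move=> h [->|sh]; first by exists f; [right|move=> x; exact: dprim (smooth_cont sf)].
exists h^`()%classic; first by right; exact: smooth_derive1.
by move=> x; exact: smooth_der.
Qed.

Lemma smooth_lin (a b : R) f g : smooth f -> smooth g ->
  smooth (fun x => a * f x + b * g x).
Proof.
move=> sf sg; apply: (@smooth_ind_class
  [set h | exists f g, [/\ smooth f, smooth g & h = (fun x => a * f x + b * g x)]]); last by exists f, g.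
move=> _ [{sf sg}f [{}g [sf sg ->]]].
exists (fun x => a * f^`()%classic x + b * g^`()%classic x).
  exists f^`()%classic, g^`()%classic.
  by split; [exact: smooth_derive1|exact: smooth_derive1|exact: erefl].
move=> x; have D1 := smooth_der x sf; have D2 := smooth_der x sg.
by eapply derE; [eapply dD; eapply dM; [exact: dcst|exact: D1|exact: dcst|exact: D2]|
  cbv beta; ring].
Qed.

Lemma smooth_cst (c : R) : smooth (fun=> c).
Proof.
apply: (@smooth_ind_class [set h | exists c, h = (fun=> c)]); last by exists c.
by move=> _ [d ->]; exists (fun=> 0); [exists 0|move=> x; exact: dcst].
Qed.

Lemma smooth_affine (a b : R) f : smooth f -> smooth (fun x => f ((x - a) / b)).
Proof.
move=> sf; apply: (@smooth_ind_class
  [set h | exists c f, smooth f /\ h = (fun x => c * f ((x - a) / b))]); last first.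
  by exists 1, f; split=> //; apply/funext => x; rewrite mul1r.
move=> _ [c [{sf}f [sf ->]]].
exists (fun x => (c / b) * f^`()%classic ((x - a) / b)).
  exists (c / b), f^`()%classic; split; [exact: smooth_derive1|exact: erefl].
move=> x; have D1 := smooth_der ((x - a) / b) sf.
have D2 : is_derive x 1 (fun x => (x - a) / b) b^-1.
  by eapply derE; [eapply dM; [eapply dD; [exact: did|exact: dcst]|exact: dcst]|cbv beta; ring].
eapply derE; [eapply dM; [exact: dcst|eapply dcomp; [exact: D1|exact: D2]]|cbv beta; ring].
Qed.

Lemma flat_der f x (C e : R) : 0 < e -> f x = 0 ->
  (forall y, `|y - x| < e -> `|f y| <= C * (y - x) ^+ 2) -> is_derive x 1 f 0.
Proof.
move=> e0 fx H.
have L : h^-1 *: ((f \o shift x) (h *: (1 : R)) - f x) @[h --> (0 : R)^'] --> (0 : R).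
  apply/cvgrPdist_lt => d d0; rewrite near_withinE; apply/nbhs_ballP.
  have C0 : 0 < `|C| + 1 by rewrite ltr_wpDl.
  exists (Num.min e (d / (`|C| + 1))) => /=; first by rewrite lt_min e0 divr_gt0.
  move=> h; rewrite /ball /= sub0r normrN lt_min => /andP[he hd] h0.
  rewrite sub0r normrN fx subr0 [h *: 1]mulr1 /GRing.scale /= normrM normfV.
  have := H (h + x); rewrite addrK => /(_ he) fh.
  rewrite mulrC ltr_pdivrMr ?normr_gt0 //; apply: (le_lt_trans fh).
  rewrite ltr_pdivlMr // in hd.
  apply: (@le_lt_trans _ _ (`|h| * `|C| * `|h|)).
    rewrite -real_normK ?num_real // [`|h| * _]mulrC -mulrA -expr2.
    by rewrite ler_wpM2r ?sqr_ge0 // ler_norm.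
  rewrite ltr_pM2r ?normr_gt0 //; apply: le_lt_trans hd.
  by rewrite ler_wpM2l // lerDl.
by apply: DeriveDef; [apply/cvg_ex; exists 0|exact: cvg_lim L].
Qed.

(* With [w = x (1 - x)], the functions [P * w^-m * exp (- 1 / w)] form a class that is
   stable under derivation. *)
Definition bumpf (P : {poly R}) (m : nat) x : R :=
  if (0 < x) && (x < 1) then P.[x] / (x * (1 - x)) ^+ m * expR (- (x * (1 - x))^-1) else 0.

(** With [w = x (1 - x)], the exponential series gives [exp (1 / w) >= w^-(m+2) / (m+2)!], so the
    function is at most a multiple of [w^2], and [w] is at most [x] and [1 - x]. By [flat_der] this
    gives derivative 0 at 0 and at 1. *)
Lemma bumpf_flat (P : {poly R}) m : exists2 C : R, 0 < C &
  forall x, `|bumpf P m x| <= C * x ^+ 2 /\ `|bumpf P m x| <= C * (1 - x) ^+ 2.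
Proof.
have [C C0 HC] := @cont_bounded R (horner P) 0 1 (fun x _ _ => @continuous_horner R P x).
pose K : R := C * (m.+2)`!%:R.
have K0 : 0 < K by rewrite mulr_gt0 // ltr0n fact_gt0.
exists K => // x; rewrite /bumpf; case: ifPn => [/andP[x0 x1]|_]; last first.
  by rewrite normr0; split; rewrite mulr_ge0 ?sqr_ge0 // ltW.
set w := x * (1 - x).
have w0 : 0 < w by rewrite mulr_gt0 // subr_gt0.
have wx : w <= x by rewrite ler_piMr ?ltW //; arith.
have w1x : w <= 1 - x by rewrite ler_piMl; arith.
have main : `|P.[x] / w ^+ m * expR (- w^-1)| <= K * w ^+ 2.
  rewrite normrM normrM [`|expR _|]gtr0_norm ?expR_gt0 // normfV.
  rewrite (gtr0_norm (exprn_gt0 m w0)) /K -mulrA -[leRHS]mulrA.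
  apply: ler_pM => //; first by rewrite mulr_ge0 ?expR_ge0 // invr_ge0 exprn_ge0 // ltW.
    by apply: HC; exact: ltW.
  rewrite expRN ler_pdivrMr ?expR_gt0 // -[leLHS]mul1r ler_pdivrMr ?exprn_gt0 //.
  have iw0 : 0 <= w^-1 by rewrite invr_ge0 ltW.
  have := expR_ge1Dxn m.+1 iw0 => hexp.
  have f0 : 0 < (m.+2)`!%:R :> R by rewrite ltr0n fact_gt0.
  have : w^-1 ^+ m.+2 / (m.+2)`!%:R <= expR w^-1 by arith.
  rewrite ler_pdivrMr // => hle.
  have : w ^+ m.+2 * (w^-1 ^+ m.+2) <= w ^+ m.+2 * (expR w^-1 * (m.+2)`!%:R).
    by rewrite ler_pM2l // exprn_gt0.
  rewrite -exprMn divff ?gt_eqF // expr1n => /le_trans; apply.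
  by rewrite le_eqVlt -addn2 exprD; apply/orP; left; apply/eqP; ring.
by split; apply: (le_trans main); rewrite ler_pM2l //; apply: sqr_le => //; exact: ltW.
Qed.

(** Numerator of the derivative: the derivative of [P w^-m exp (- 1 / w)] is [(P' w^2 - m P w' w + P
    w') w^-(m+2) exp (- 1 / w)], where [w' = 1 - 2 x]. *)
Definition bumpD (P : {poly R}) (m : nat) : {poly R} :=
  P^`() * ('X * (1%:P - 'X) * ('X * (1%:P - 'X)))
  - m%:R%:P * (P * (1%:P - 2%:R%:P * 'X) * ('X * (1%:P - 'X)))
  + P * (1%:P - 2%:R%:P * 'X).

Lemma bumpDE (P : {poly R}) (m : nat) x : (bumpD P m).[x] =
  P^`().[x] * (x * (1 - x) * (x * (1 - x))) - m%:R * (P.[x] * (1 - 2 * x) * (x * (1 - x)))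
  + P.[x] * (1 - 2 * x).
Proof. by rewrite /bumpD !(hornerD, hornerN, hornerM, hornerX, hornerC). Qed.

Lemma dbumpf (P : {poly R}) m x : is_derive x 1 (bumpf P m) (bumpf (bumpD P m) m.+2 x).
Proof.
have [C C0 HC] := bumpf_flat P m.
have [x0|x0|x0] := ltgtP x 0.
- have -> : bumpf (bumpD P m) m.+2 x = 0 by rewrite /bumpf ltNge (ltW x0).
  have E : \forall y \near x, 0 = bumpf P m y.
    have : \forall y \near x, y < 0 by exact: lt_nbhsl.
    by apply: filterS => y y0; rewrite /bumpf ltNge (ltW y0).
  exact: near_eq_is_derive E (dcst 0 x).
- have [x1|x1|x1] := ltgtP x 1.
  + rewrite /bumpf x0 x1 /=.
    have E : \forall y \near x, P.[y] / (y * (1 - y)) ^+ m * expR (- (y * (1 - y))^-1) = bumpf P m y.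
      have h0 : \forall y \near x, 0 < y by exact: lt_nbhsr.
      have h1 : \forall y \near x, y < 1 by exact: lt_nbhsl.
      by apply: filterS2 h0 h1 => y y0 y1; rewrite /bumpf y0 y1.
    apply: (near_eq_is_derive E).
    have w0 : x * (1 - x) != 0 by rewrite mulf_neq0 // gt_eqF // subr_gt0.
    have D1 : is_derive x 1 (horner P) (P^`()).[x].
      by rewrite derivE; apply: derive1P; exact: derivable_horner.
    have D2 : is_derive x 1 (fun y => y * (1 - y)) (1 - 2 * x) by deriv; ring.
    have D3 := dV (f := fun y : R => y * (1 - y)) w0 D2.
    have D4 : is_derive x 1 (fun y => ((y * (1 - y)) ^+ m)^-1)
        (- (m%:R * (1 - 2 * x)) / (x * (1 - x) * (x * (1 - x)) ^+ m)).
      case: (m) => [|k].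
        have -> : (fun y : R => ((y * (1 - y)) ^+ 0)^-1) = (fun=> 1).
          by apply/funext => y; rewrite expr0 invr1.
        by rewrite mul0r oppr0 mul0r; exact: dcst.
      have wk : (x * (1 - x)) ^+ k.+1 != 0 by rewrite expf_neq0.
      eapply derE; first by eapply (dV (f := fun y => (y * (1 - y)) ^+ k.+1) wk); eapply dX; exact: D2.
      cbv beta; rewrite !exprS; clear -w0.
      move: w0; generalize (x * (1 - x)) => w w0.
      have W0 : w ^+ k != 0 by rewrite expf_neq0.
      by move: W0; generalize (w ^+ k) => W W0; field; rewrite w0 W0.
    have D5 := @is_derive_expR R (- (x * (1 - x))^-1).
    eapply derE; first by eapply dM; [eapply dM; [exact: D1|exact: D4]|eapply dcomp; [exact: D5|eapply dN; exact: D3]].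
    have W0 : (x * (1 - x)) ^+ m != 0 by rewrite expf_neq0.
    have EQ (w E5 Px P'x W : R) : w != 0 -> W != 0 ->
      (P'x * W^-1 + Px * (- (m%:R * (1 - 2 * x)) / (w * W))) * E5 +
        Px / W * (E5 * - (- (1 - 2 * x) / w ^+ 2)) =
      (P'x * (w * w) - m%:R * (Px * (1 - 2 * x) * w) + Px * (1 - 2 * x)) / (w * (w * W)) * E5.
      by move=> h1 h2; field; rewrite h1 h2.
    cbv beta; rewrite bumpDE (exprS _ m.+1) (exprS _ m).
    exact: (EQ _ _ _ _ _ w0 W0).
  + have -> : bumpf (bumpD P m) m.+2 x = 0 by rewrite /bumpf [x < 1]ltNge (ltW x1) andbF.
    have E : \forall y \near x, 0 = bumpf P m y.
      have : \forall y \near x, 1 < y by exact: lt_nbhsr.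
      by apply: filterS => y y0; rewrite /bumpf [y < 1]ltNge (ltW y0) andbF.
    exact: near_eq_is_derive E (dcst 0 x).
  + have z k (Q : {poly R}) : bumpf Q k x = 0 by rewrite /bumpf x1 ltxx andbF.
    rewrite z; apply: (@flat_der _ x C 1) => // y _.
    have [_ h] := HC y; apply: le_trans h _.
    by rewrite x1 -sqrrN opprB.
- have z k (Q : {poly R}) : bumpf Q k x = 0 by rewrite /bumpf x0 ltxx.
  rewrite z; apply: (@flat_der _ x C 1) => // y _.
  by have [h _] := HC y; rewrite x0 subr0.
Qed.

Lemma smooth_bumpf (P : {poly R}) m : smooth (bumpf P m).
Proof.
apply: (@smooth_ind_class [set h | exists P m, h = bumpf P m]); last by exists P, m.
move=> _ [Q [k ->]]; exists (bumpf (bumpD Q k) k.+2); first by exists (bumpD Q k), k.+2.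
by move=> x; exact: dbumpf.
Qed.

End Smooth.

(** * Smooth steps and smooth approximation *)

Section SmoothStep.
Variable R : realType.
Notation mu := (@lebesgue_measure R).
Implicit Types (f g : R -> R) (x y : R).

Definition bump x : R := bumpf 1 0 x.

Lemma bump_smooth : smooth bump. Proof. exact: smooth_bumpf. Qed.

Lemma bump_ge0 x : 0 <= bump x.
Proof.
rewrite /bump /bumpf; case: ifP => // _.
by rewrite hornerC expr0 divr1 mul1r expR_ge0.
Qed.

Lemma bump_out x : (x <= 0) || (1 <= x) -> bump x = 0.
Proof.
by rewrite /bump /bumpf => /orP[h|h]; [rewrite ltNge h|rewrite [x < 1]ltNge h andbF].
Qed.

Lemma bump_gt0 x : 0 < x -> x < 1 -> 0 < bump x.
Proof.
by move=> x0 x1; rewrite /bump /bumpf x0 x1 hornerC expr0 divr1 mul1r expR_gt0.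
Qed.

Definition bumpZ : R := prim bump 1.

Let dprimb x : is_derive x 1 (prim bump) (bump x).
Proof. exact: dprim (smooth_cont bump_smooth). Qed.

Lemma bumpZ_gt0 : 0 < bumpZ.
Proof.
rewrite /bumpZ -(prim0 bump); apply: (incr_der (df := bump)) => //.
exact: bump_gt0.
Qed.

(** Smooth nondecreasing step, equal to 0 up to 0 and to 1 from 1 on. *)
Definition sigma x : R := bumpZ^-1 * prim bump x.

Lemma dsigma x : is_derive x 1 sigma (bumpZ^-1 * bump x).
Proof.
have D := dprimb x.
by eapply derE; [eapply dM; [exact: dcst|exact: D]|cbv beta; rewrite mul0r add0r].
Qed.

Lemma sigma_smooth : smooth sigma.
Proof.
have := @smooth_lin R bumpZ^-1 0 _ _ (smooth_prim bump_smooth) (@smooth_cst R 0).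
by congr smooth; apply/funext => x; rewrite mul0r addr0.
Qed.

Lemma sigma_le0 x : x <= 0 -> sigma x = 0.
Proof.
move=> x0; rewrite /sigma.
have D y : x <= y -> y <= 0 -> is_derive y 1 (prim bump) 0.
  by move=> _ y0; rewrite -(@bump_out y) ?y0 //; exact: dprimb.
have h1 := nondecr_der x0 D (fun _ _ _ => lexx _).
have h2 := nonincr_der x0 D (fun _ _ _ => lexx _).
by rewrite (_ : prim bump x = 0) ?mulr0 //; apply/eqP; rewrite eq_le -(prim0 bump) h1.
Qed.

Lemma sigma_ge1 x : 1 <= x -> sigma x = 1.
Proof.
move=> x1; rewrite /sigma.
have D y : 1 <= y -> y <= x -> is_derive y 1 (prim bump) 0.
  by move=> y1 _; rewrite -(@bump_out y) ?y1 ?orbT //; exact: dprimb.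
have h1 := nondecr_der x1 D (fun _ _ _ => lexx _).
have h2 := nonincr_der x1 D (fun _ _ _ => lexx _).
have -> : prim bump x = bumpZ by apply/eqP; rewrite eq_le h2.
by rewrite mulVf // gt_eqF // bumpZ_gt0.
Qed.

Lemma sigma_nondecr x y : x <= y -> sigma x <= sigma y.
Proof.
move=> xy; apply: (nondecr_der xy (fun z _ _ => dsigma z)) => z _ _.
by rewrite mulr_ge0 ?bump_ge0 // invr_ge0 ltW // bumpZ_gt0.
Qed.

Lemma sigma_ge0 x : 0 <= sigma x.
Proof.
have [x0|/ltW x0] := leP x 0; first by rewrite sigma_le0.
by rewrite -(@sigma_le0 0) // sigma_nondecr.
Qed.

Lemma sigma_le1 x : sigma x <= 1.
Proof.
have [x0|/ltW x0] := leP 1 x; first by rewrite sigma_ge1.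
by rewrite -(@sigma_ge1 1) // sigma_nondecr.
Qed.

Lemma bump_bounded : exists2 K : R, 0 < K & forall x, bumpZ^-1 * bump x <= K.
Proof.
have [C C0 HC] := @cont_bounded R bump 0 1 (fun x _ _ => @smooth_cont R bump bump_smooth x).
exists (bumpZ^-1 * C); first by rewrite mulr_gt0 // invr_gt0 bumpZ_gt0.
move=> x; rewrite ler_pM2l ?invr_gt0 ?bumpZ_gt0 //.
have [x0|x0] := leP x 0; first by rewrite bump_out ?x0 // ltW.
have [x1|x1] := leP 1 x; first by rewrite bump_out ?x1 ?orbT // ltW.
by apply: le_trans (ler_norm _) _; apply: HC; exact: ltW.
Qed.

Lemma smooth_test_function (U : set R) f (a b : R) : smooth f -> `[a, b] `<=` U ->
  (forall x, ~~ (a <= x <= b) -> f x = 0) -> test_function U f.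
Proof.
move=> sf abU f0.
have sub : closure [set x | f x != 0] `<=` `[a, b].
  have E : (`[a, b] : set R) = closure `[a, b].
    by apply/closure_id; exact: interval_closed.
  rewrite [X in _ `<=` X]E.
  apply: closure_subset => x /= fx; rewrite in_itv /= -[_ && _]negbK.
  by apply/negP => /f0 fx0; rewrite fx0 eqxx in fx.
split => //; last exact: subset_trans abU.
by apply: subclosed_compact sub; [exact: closed_closure|exact: segment_compact].
Qed.

(* Piecewise smooth interpolation of [k] at the points [a + i delta]. *)
Lemma smooth_approx (k : R -> R) (a b L e : R) : a < b -> 0 < e ->
  (forall x, ~~ (a < x < b) -> k x = 0) ->
  (forall x y, a <= x -> x <= b -> a <= y -> y <= b -> `|k x - k y| <= L * `|x - y|) ->
  exists f, [/\ smooth f, forall x, ~~ (a < x < b) -> f x = 0 &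
    forall x, `|f x - k x| <= e].
Proof.
move=> ab e0 k0 kL.
have L0 : 0 < `|L| + 1 by rewrite ltr_wpDl.
(* The mesh [d] satisfies [(|L| + 1) d <= e], so [k] varies by at most [e] over one step. *)
pose n := (Num.truncn ((`|L| + 1) * (b - a) / e)).+1.
pose d := (b - a) / n%:R.
have n0 : 0 < n%:R :> R by rewrite ltr0n.
have d0 : 0 < d by rewrite divr_gt0 // subr_gt0.
have dL : (`|L| + 1) * d <= e.
  rewrite /d mulrA ler_pdivrMr // [leRHS]mulrC -ler_pdivrMr //.
  by apply: ltW; exact: truncnS_gt.
pose t i := a + i%:R * d.
have tn : t n = b by rewrite /t /d mulrC divfK ?gt_eqF //; ring.
have tS i : t i.+1 = t i + d by rewrite /t -natr1; ring.
have t0 : t 0%N = a by rewrite /t mul0r addr0.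
have ta i : a <= t i by rewrite /t lerDl mulr_ge0 // ltW.
have tb i : (i <= n)%N -> t i <= b.
  by move=> in_; rewrite -tn /t lerD2l ler_pM2r // ler_nat.
have kd x y : a <= x -> x <= b -> a <= y -> y <= b -> `|x - y| <= d -> `|k x - k y| <= e.
  move=> ax xb ay yb xyd; apply: le_trans (kL x y ax xb ay yb) _.
  apply: le_trans dL; apply: (@le_trans _ _ ((`|L| + 1) * `|x - y|)).
    by apply: ler_wpM2r => //; have := ler_norm L; arith.
  by rewrite ler_pM2l.
pose c i := k (t i.+1) - k (t i).
(* Sum of smooth steps, the [i]-th of which climbs by [k (t i.+1) - k (t i)] on [[t i, t i.+1]]. The
   coefficient 1 matches the form of [smooth_lin]. *)
pose f := fix f (j : nat) : R -> R := match j with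
  | 0%N => fun=> 0
  | i.+1 => fun x => 1 * f i x + c i * sigma ((x - t i) / d)
  end.
have sf j : smooth (f j).
  elim: j => [|j IH]; first exact: smooth_cst.
  exact: (smooth_lin IH (smooth_affine sigma_smooth)).
have sg0 i x : x <= t i -> sigma ((x - t i) / d) = 0.
  by move=> h; apply: sigma_le0; rewrite mulr_le0_ge0 ?subr_le0 // invr_ge0 ltW.
have f0 j x : x <= a -> f j x = 0.
  move=> xa; elim: j => //= j ->; rewrite mulr0 add0r sg0 ?mulr0 //.
  exact: le_trans xa (ta j).
have ka : k a = 0 by apply: k0; rewrite ltxx.
have kb : k b = 0 by apply: k0; rewrite ltxx andbF.
have sg1 i x : t i.+1 <= x -> sigma ((x - t i) / d) = 1.
  by rewrite tS => h; apply: sigma_ge1; rewrite ler_pdivlMr // mul1r; arith.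
have f1 j x : t j <= x -> f j x = k (t j).
  elim: j => [_|j IH h] /=; first by rewrite t0 ka.
  rewrite IH; last by move: h; rewrite tS; arith.
  by rewrite sg1 // /c; ring.
have f2 j x : (j <= n)%N -> a <= x -> x <= t j -> `|f j x - k x| <= e.
  elim: j => [_ ax|j IH jn ax h].
    rewrite t0 => xa; rewrite (_ : x = a) /=; last by apply/eqP; rewrite eq_le xa ax.
    by rewrite ka subrr normr0 ltW.
  have [xt|tx] := leP x (t j).
    by rewrite /= sg0 // mulr0 addr0 mul1r; apply: IH => //; exact: ltnW.
  have jn' : (j <= n)%N by exact: ltnW.
  rewrite /= f1 ?(ltW tx) //; set s := sigma _.
  have s0 : 0 <= s by exact: sigma_ge0.
  have s1 : s <= 1 by exact: sigma_le1.
  have h1 : `|k (t j) - k x| <= e.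
    apply: kd; [exact: ta|exact: tb|exact: ax|exact: le_trans h (tb _ jn)|].
    by rewrite distrC gtr0_norm ?subr_gt0 //; move: h; rewrite tS; arith.
  have h2 : `|k (t j.+1) - k x| <= e.
    apply: kd; [exact: ta|exact: tb|exact: ax|exact: le_trans h (tb _ jn)|].
    by rewrite ger0_norm ?subr_ge0 //; move: h tx; rewrite tS; arith.
  (* Convex combination of two nodal errors, each at most [e]. *)
  have -> : 1 * k (t j) + c j * s - k x = (1 - s) * (k (t j) - k x) + s * (k (t j.+1) - k x).
    by rewrite /c; ring.
  have g1 : `|(1 - s) * (k (t j) - k x)| <= (1 - s) * e.
    by rewrite normrM ger0_norm ?subr_ge0 // ler_wpM2l // subr_ge0.
  have g2 : `|s * (k (t j.+1) - k x)| <= s * e by rewrite normrM ger0_norm // ler_wpM2l.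
  apply: le_trans (ler_normD _ _) _; arith.
have fout x : ~~ (a < x < b) -> f n x = 0.
  rewrite negb_and -!leNgt => /orP[|bx]; first exact: f0.
  by rewrite f1 tn.
exists (f n); split=> // x.
have [h|h] := boolP (a < x < b); last by rewrite fout // k0 // subrr normr0 ltW.
by case/andP: h => ax xb; apply: f2 => //; [exact: ltW|rewrite tn ltW].
Qed.

(** A smooth approximation [f] of [eta1] is integrated. Its integral [m] over [[a, b]] is small but
    perhaps not 0, so [m] times a smooth step is subtracted to make the primitive vanish beyond
    [b]. *)
Lemma test_function_approx (eta eta1 : R -> R) (a b L e : R) : a < b -> 0 < e ->
  (forall x, is_derive x 1 eta (eta1 x)) ->
  (forall x, ~~ (a < x < b) -> eta x = 0 /\ eta1 x = 0) ->
  (forall x y, a <= x -> x <= b -> a <= y -> y <= b -> `|eta1 x - eta1 y| <= L * `|x - y|) ->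
  exists phi, [/\ smooth phi, forall x, ~~ (a < x < b) -> phi x = 0,
    forall x, `|phi x - eta x| <= e & forall x, `|phi^`()%classic x - eta1 x| <= e].
Proof.
move=> ab e0 deta eta0 etaL.
have ba0 : 0 < b - a by rewrite subr_gt0.
have [K K0 HK] := bump_bounded.
(* The error on the derivative will be [e' (1 + K)] and that on the function
   [e' (1 + K) (b - a)]. *)
pose e' := e / ((1 + K) * (1 + (b - a))).
have c0 : 0 < (1 + K) * (1 + (b - a)) by rewrite mulr_gt0 //; arith.
have e'0 : 0 < e' by rewrite divr_gt0.
have eE : e' * (1 + K) * (1 + (b - a)) = e by rewrite /e' -mulrA divfK // gt_eqF.
have [f [sf f0 fe]] := smooth_approx ab e'0 (fun x h => (eta0 x h).2) etaL.
pose m := prim f b - prim f a.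
have cf := smooth_cont sf.
have df x : is_derive x 1 (prim f) (f x) by exact: dprim cf.
have [ea _] := eta0 a (ltac:(by rewrite ltxx)).
have [eb _] := eta0 b (ltac:(by rewrite ltxx andbF)).
have mE : `|m| <= e' * (b - a).
  have D x : a <= x -> x <= b -> is_derive x 1 (fun y => prim f y - eta y) (f x - eta1 x).
    by move=> _ _; eapply dD; [exact: df|eapply dN; exact: deta].
  have [x [_ _]] := mvt ab D; rewrite ea eb !subr0 -/m => ->.
  by rewrite normrM (gtr0_norm ba0) ler_pM2r.
pose rho x := sigma ((x - a) / (b - a)).
pose g x := 1 * f x + (- m / (b - a)) * (bumpZ^-1 * bump ((x - a) / (b - a))).
pose phi x := 1 * (prim f x - prim f a) + (- m) * rho x.
have srho : smooth rho by exact: smooth_affine sigma_smooth.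
have sphi : smooth phi.
  have s1 : smooth (fun x => 1 * prim f x + (- prim f a) * (fun=> 1 : R) x).
    exact: smooth_lin (smooth_prim sf) (@smooth_cst R 1).
  have := @smooth_lin R 1 (- m) _ _ s1 srho.
  by congr smooth; apply/funext => x; rewrite /phi; congr (1 * _ + _); rewrite mul1r mulr1.
have dphi x : is_derive x 1 phi (g x).
  have D1 := df x; have D2 := dsigma ((x - a) / (b - a)).
  have D3 : is_derive x 1 (fun x => (x - a) / (b - a)) (b - a)^-1.
    by eapply derE; [eapply dM; [eapply dD; [exact: did|exact: dcst]|exact: dcst]|cbv beta; ring].
  have D4 : is_derive x 1 rho (bumpZ^-1 * bump ((x - a) / (b - a)) * (b - a)^-1).
    exact: (dcomp (f := sigma) (g := fun x => (x - a) / (b - a)) D2 D3).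
  eapply derE; first by eapply dD; [eapply dM; [exact: dcst|eapply dD; [exact: D1|exact: dcst]]|
    eapply dM; [exact: dcst|exact: D4]].
  by cbv beta; rewrite /g; ring.
have ge x : `|g x - eta1 x| <= e' * (1 + K).
  have -> : g x - eta1 x = (f x - eta1 x) +
      - (m / (b - a) * (bumpZ^-1 * bump ((x - a) / (b - a)))) by rewrite /g; ring.
  have g1 : `|m / (b - a)| <= e' by rewrite normrM normfV (gtr0_norm ba0) ler_pdivrMr.
  have s0 : 0 <= bumpZ^-1 * bump ((x - a) / (b - a)).
    by rewrite mulr_ge0 ?bump_ge0 // invr_ge0 ltW // bumpZ_gt0.
  have g2 : `|m / (b - a) * (bumpZ^-1 * bump ((x - a) / (b - a)))| <= e' * K.
    by rewrite normrM [X in _ * X]ger0_norm //; apply: ler_pM.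
  apply: le_trans (ler_normD _ _) _; rewrite normrN; have := fe x; arith.
have phi0 x : ~~ (a < x < b) -> phi x = 0.
  rewrite negb_and -!leNgt => /orP[xa|bx].
    have D y : x <= y -> y <= a -> is_derive y 1 (prim f) 0.
      by move=> _ ya; rewrite -(@f0 y) //; rewrite negb_and -!leNgt ya.
    have h1 := nondecr_der xa D (fun _ _ _ => lexx _).
    have h2 := nonincr_der xa D (fun _ _ _ => lexx _).
    rewrite /phi /rho sigma_le0; last by rewrite mulr_le0_ge0 ?subr_le0 // invr_ge0 ltW.
    by rewrite mulr0 addr0 mul1r; apply/eqP; rewrite subr_eq0 eq_le h1.
  have D y : b <= y -> y <= x -> is_derive y 1 (prim f) 0.
    by move=> by_ _; rewrite -(@f0 y) //; rewrite negb_and -!leNgt by_ orbT.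
  have h1 := nondecr_der bx D (fun _ _ _ => lexx _).
  have h2 := nonincr_der bx D (fun _ _ _ => lexx _).
  rewrite /phi /rho sigma_ge1; last by rewrite ler_pdivlMr // mul1r lerD2r.
  have -> : prim f x = prim f b by apply/eqP; rewrite eq_le h2.
  by rewrite /m; ring.
have K1 : e' * (1 + K) <= e.
  have X0 : 0 <= e' * (1 + K) by apply: mulr_ge0; arith.
  by rewrite -[leRHS]eE ler_peMr //; arith.
exists phi; split=> // x; last first.
  by rewrite (is_derive_derive1 (dphi x)); apply: le_trans (ge x) _.
have [h|h] := boolP (a < x < b); last first.
  by rewrite phi0 // (eta0 x h).1 subrr normr0 ltW.
case/andP: h => ax xb.
have D y : a <= y -> y <= x -> is_derive y 1 (fun y => phi y - eta y) (g y - eta1 y).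
  by move=> _ _; eapply dD; [exact: dphi|eapply dN; exact: deta].
have [y [_ _]] := mvt ax D; rewrite ea (phi0 a) ?ltxx // !subr0 => ->.
rewrite normrM (gtr0_norm (_ : 0 < x - a)) ?subr_gt0 // -[leRHS]eE.
apply: ler_pM => //; arith.
Qed.

End SmoothStep.

(** * Smoothed indicator functions and vanishing almost everywhere *)

Section IntegralTools.
Variable R : realType.
Notation mu := (@lebesgue_measure R).
Implicit Types (f g : R -> R) (x y a b : R).

Lemma integrable_contM (c f : R -> R) a b :
  (forall x, a <= x -> x <= b -> {for x, continuous c}) ->
  mu.-integrable `[a, b] (EFin \o f) ->
  mu.-integrable `[a, b] (EFin \o (fun x => c x * f x)).
Proof.
move=> cc fi; have ci := cont_integrable cc.
have mc : measurable_fun `[a, b] c.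
  by apply/measurable_EFinP; exact: measurable_int ci.
have [C C0 HC] := cont_bounded cc.
have bc : [bounded c x | x in (`[a, b] : set R)].
  exists C; split; [exact: num_real|move=> M CM x /=].
  rewrite in_itv /= => /andP[ax xb]; exact: le_trans (HC x ax xb) (ltW CM).
have : mu.-integrable `[a, b] ((EFin \o c) \* (EFin \o f))%E by exact: integrableMr.
by apply: eq_integrable => // x _; rewrite /= EFinM.
Qed.

Lemma integrable_abs f a b : mu.-integrable `[a, b] (EFin \o f) ->
  mu.-integrable `[a, b] (EFin \o (fun x => `|f x|)).
Proof. by move=> fi; exact: (integrable_norm fi). Qed.

Lemma Rint_near f a b (e : R) : a < b -> 0 < e -> mu.-integrable `[a, b] (EFin \o f) ->
  exists2 d : R, 0 < d & forall c, a <= c -> c < a + d ->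
    \int[mu]_(x in `[a, c]) `|f x| < e.
Proof.
move=> ab e0 fi; have := parameterized_integral_near_left ab e0 (integrable_abs fi).
move=> /nbhs_ballP[d /= d0 H]; exists d => // c ac cd.
have := H c; rewrite /ball /= ltr_distlC => /(_ (ltac:(apply/andP; split; lra)) ac).
by rewrite /parameterized_integral; apply: le_lt_trans; exact: ler_norm.
Qed.

Lemma Rint_small f g a b c : a <= c -> c <= b ->
  mu.-integrable `[a, b] (EFin \o f) -> mu.-integrable `[a, b] (EFin \o g) ->
  (forall x, a <= x -> x <= b -> `|g x| <= `|f x|) ->
  (forall x, c <= x -> x <= b -> g x = 0) ->
  `|\int[mu]_(x in `[a, b]) g x| <= \int[mu]_(x in `[a, c]) `|f x|.
Proof.
move=> ac cb fi gi gf g0; rewrite (Rint_split ac cb gi).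
have gi' : mu.-integrable `[a, c] (EFin \o g) by exact: integrable_itvS gi.
have fi' : mu.-integrable `[a, c] (EFin \o f) by exact: integrable_itvS fi.
have -> : \int[mu]_(x in `[c, b]) g x = 0.
  by rewrite (eq_Rint g0) Rint_cst // mul0r.
rewrite addr0; apply: (@le_trans _ _ (\int[mu]_(x in `[a, c]) `|g x|)); first exact: le_normr_Rintegral.
apply: Rint_le; [exact: integrable_abs|exact: integrable_abs|].
by move=> x ax xc; apply: gf => //; exact: le_trans cb.
Qed.

(** Smoothed indicator of [[x, y]], with transitions on [[x, x + e]] and [[y, y + e]]. *)
Definition step x y (e t : R) : R := sigma ((t - x) / e) - sigma ((t - y) / e).

Lemma step_cont x y e : continuous (step x y e).
Proof.
move=> t; have s z : {for t, continuous (fun t : R => sigma ((t - z) / e))}.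
  exact: smooth_cont (smooth_affine (@sigma_smooth R)) _.
apply: (@continuousB _ _ _ (fun t : R => sigma ((t - x) / e)) (fun t : R => sigma ((t - y) / e))).
  exact: s.
exact: s.
Qed.

Lemma step_bounds x y e t : 0 < e -> x <= y -> 0 <= step x y e t <= 1.
Proof.
move=> e0 xy; rewrite /step.
have : sigma ((t - y) / e) <= sigma ((t - x) / e).
  by apply: sigma_nondecr; rewrite ler_pM2r ?invr_gt0 // lerD2l lerN2.
have := sigma_ge0 ((t - y) / e); have := sigma_le1 ((t - x) / e).
by move=> *; apply/andP; split; arith.
Qed.

Lemma sigma_left x (e t : R) : 0 < e -> t <= x -> sigma ((t - x) / e) = 0.
Proof.
by move=> e0 tx; apply: sigma_le0; rewrite mulr_le0_ge0 ?subr_le0 // invr_ge0 ltW.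
Qed.

Lemma sigma_right x (e t : R) : 0 < e -> x + e <= t -> sigma ((t - x) / e) = 1.
Proof. by move=> e0 tx; apply: sigma_ge1; rewrite ler_pdivlMr // mul1r; arith. Qed.

(** The step differs from the indicator only on two intervals of length [h], where the integral of
    [|f|] is small by absolute continuity. *)
Lemma step_limit f a b x y (e : R) : a <= x -> x < y -> y < b -> 0 < e ->
  mu.-integrable `[a, b] (EFin \o f) ->
  exists2 d : R, 0 < d & forall h, 0 < h -> h < d ->
   `|\int[mu]_(t in `[a, b]) (step x y h t * f t) - \int[mu]_(t in `[x, y]) f t| <= e.
Proof.
move=> ax xy yb e0 fi.
have e20 : 0 < e / 2 by rewrite divr_gt0.
have fxy : mu.-integrable `[x, y] (EFin \o f) by apply: integrable_itvS fi => //; exact: ltW.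
have fyb : mu.-integrable `[y, b] (EFin \o f).
  by apply: integrable_itvS fi => //; arith.
have [d1 d10 H1] := Rint_near xy e20 fxy.
have [d2 d20 H2] := Rint_near yb e20 fyb.
exists (Num.min (Num.min d1 d2) (Num.min (y - x) (b - y))).
  by rewrite !lt_min d10 d20 !subr_gt0 xy yb.
move=> h h0; rewrite !lt_min => /andP[/andP[hd1 hd2] /andP[hxy hyb]].
have ci (c : R -> R) s t : a <= s -> t <= b -> continuous c ->
    mu.-integrable `[s, t] (EFin \o (fun t => c t * f t)).
  move=> as_ tb cc; apply: integrable_contM; first by move=> z _ _; exact: cc.
  exact: integrable_itvS fi.
have cs := @step_cont x y h.
have cs1 : continuous (fun t => step x y h t - 1).
  by move=> t; apply: continuousB; [exact: cs|exact: cvg_cst].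
have xxh : x <= x + h by rewrite lerDl ltW.
have xhd : x + h < x + d1 by rewrite ltrD2l.
have yyh : y <= y + h by rewrite lerDl ltW.
have yhd : y + h < y + d2 by rewrite ltrD2l.
have ay : a <= y by arith. have xb : x <= b by arith.
have ib : mu.-integrable `[a, b] (EFin \o (fun t => step x y h t * f t)) by exact: ci.
have ixb : mu.-integrable `[x, b] (EFin \o (fun t => step x y h t * f t)) by exact: ci.
have iyb : mu.-integrable `[y, b] (EFin \o (fun t => step x y h t * f t)) by exact: ci.
have ixy : mu.-integrable `[x, y] (EFin \o (fun t => step x y h t * f t)).
  by apply: ci => //; exact: ltW.
have ixy1 : mu.-integrable `[x, y] (EFin \o (fun t => (step x y h t - 1) * f t)).
  by apply: ci => //; exact: ltW.
rewrite (Rint_split ax xb ib) (Rint_split (ltW xy) (ltW yb) ixb).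
have -> : \int[mu]_(t in `[a, x]) (step x y h t * f t) = 0.
  have E t : a <= t -> t <= x -> step x y h t * f t = 0.
    move=> _ tx; rewrite /step !sigma_left ?subrr ?mul0r //; arith.
  by rewrite (eq_Rint E) Rint_cst // mul0r.
have -> : \int[mu]_(t in `[x, y]) (step x y h t * f t) =
    \int[mu]_(t in `[x, y]) ((step x y h t - 1) * f t) + \int[mu]_(t in `[x, y]) f t.
  by rewrite -RintegralD //; apply: eq_Rint => t _ _; ring.
have b1 : `|\int[mu]_(t in `[x, y]) ((step x y h t - 1) * f t)| <= e / 2.
  apply: le_trans (ltW (H1 (x + h) xxh xhd)).
  apply: Rint_small => //; [arith| |].
    move=> t _ _; rewrite normrM ler_piMl //.
    by have /andP[? ?] := @step_bounds x y h t h0 (ltW xy); rewrite ler_norml; apply/andP; split; arith.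
  move=> t xt ty; rewrite /step sigma_right // [sigma ((t - y) / h)]sigma_left //.
  by rewrite subr0 subrr mul0r.
have b2 : `|\int[mu]_(t in `[y, b]) (step x y h t * f t)| <= e / 2.
  apply: le_trans (ltW (H2 (y + h) yyh yhd)).
  apply: Rint_small => //; [arith| |].
    move=> t _ _; rewrite normrM ler_piMl //.
    by have /andP[? ?] := @step_bounds x y h t h0 (ltW xy); rewrite ler_norml; apply/andP; split; arith.
  by move=> t yt tb; rewrite /step !sigma_right // ?subrr ?mul0r //; arith.
move: b1 b2; move: (\int[mu]_(t in `[x, y]) ((step x y h t - 1) * f t))
  (\int[mu]_(t in `[y, b]) (step x y h t * f t)) (\int[mu]_(t in `[x, y]) f t) => I1 I2 I3.
by rewrite !ler_norml => /andP[? ?] /andP[? ?]; apply/andP; split; arith.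
Qed.

(** Lebesgue differentiation, applied to the extension of [f] by 0. *)
Lemma ae_zero f a b : mu.-integrable `[a, b] (EFin \o f) ->
  (forall x, a <= x -> x < b -> \int[mu]_(t in `[a, x]) f t = 0) ->
  {ae mu, forall x, `]a, b[%classic x -> f x = 0}.
Proof.
move=> fi f0; pose h := f \_ `[a, b].
have hiT : mu.-integrable setT (EFin \o h).
  by rewrite -restrict_EFin; apply/(integrable_mkcond _ _).1.
have hi y : mu.-integrable `]-oo, y] (EFin \o h).
  by apply: integrableS hiT => //; exact: subsetT.
have hl : locally_integrable setT h by exact: integrable_locally.
have := FTC1Ny hi hl; apply: filterS; first exact: (ae_filter_ringOfSetsType mu).
move=> x [_ Fx] /=; rewrite in_itv /= => /andP[ax xb].
have -> : f x = h x by rewrite /h patchE mem_set //= in_itv /= !ltW.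
rewrite -Fx; apply: is_derive_derive1.
apply: (near_eq_is_derive _ (dcst 0 x)).
have n1 : \forall y \near x, a < y by exact: lt_nbhsr.
have n2 : \forall y \near x, y < b by exact: lt_nbhsl.
apply: filterS2 n1 n2 => y ay yb; rewrite -(f0 y (ltW ay) yb) -Rintegral_mkcondr.
congr (Rintegral _ _ _); apply/seteqP; split => z /=; rewrite !in_itv /=.
  by move=> /andP[az zy]; rewrite zy az (le_trans zy (ltW yb)).
by move=> [zy /andP[az _]]; rewrite az zy.
Qed.

End IntegralTools.

(** * One-sided approximate identities *)

Section Averages.
Variable R : realType.
Notation mu := (@lebesgue_measure R).

(** Derivative in [t] of the smoothed Heaviside function [sigma ((t - x) / h)]: an approximate
    identity supported in [[x, x + h]]. *)
Definition kernel (x h t : R) : R := (bumpZ R)^-1 * bump ((t - x) / h) * h^-1.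

Lemma dsigma_affine (x h t : R) :
  is_derive t 1 (fun t => sigma ((t - x) / h)) (kernel x h t).
Proof.
have D2 := dsigma ((t - x) / h).
have D3 : is_derive t 1 (fun t => (t - x) / h) h^-1.
  by eapply derE; [eapply dM; [eapply dD; [exact: did|exact: dcst]|exact: dcst]|cbv beta; ring].
exact: (dcomp (f := @sigma R) (g := fun t => (t - x) / h) D2 D3).
Qed.

Lemma kernel_cont (x h : R) : continuous (kernel x h).
Proof.
have D t := is_derive_derive1 (dsigma_affine x h t).
have -> : kernel x h = (fun t => sigma ((t - x) / h))^`()%classic.
  by apply/funext => t; rewrite D.
exact: smooth_cont (smooth_derive1 (smooth_affine (@sigma_smooth R))).
Qed.

Lemma kernel_ge0 (x h t : R) : 0 < h -> 0 <= kernel x h t.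
Proof.
move=> h0; rewrite /kernel mulr_ge0 ?invr_ge0 ?(ltW h0) //.
by rewrite mulr_ge0 ?bump_ge0 // invr_ge0 ltW // bumpZ_gt0.
Qed.

Lemma kernel_right (x h t : R) : 0 < h -> x + h <= t -> kernel x h t = 0.
Proof.
move=> h0 ht; rewrite /kernel bump_out ?mulr0 ?mul0r //.
by apply/orP; right; rewrite ler_pdivlMr // mul1r; arith.
Qed.

Lemma kernel_left (x h t : R) : 0 < h -> t <= x -> kernel x h t = 0.
Proof.
move=> h0 ht; rewrite /kernel bump_out ?mulr0 ?mul0r //.
by apply/orP; left; rewrite mulr_le0_ge0 ?subr_le0 // invr_ge0 ltW.
Qed.

Lemma kernel_limit (v : R -> R) (a b x e : R) : a <= x -> x < b -> 0 < e ->
  (forall t, a <= t -> t <= b -> {for t, continuous v}) ->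
  exists2 d : R, 0 < d & forall h, 0 < h -> h < d ->
    `|\int[mu]_(t in `[a, b]) (v t * kernel x h t) - v x| <= e.
Proof.
move=> ax xb e0 cv; have [d d0 Hd] := cont_near e0 (cv x ax (ltW xb)).
exists (Num.min d (b - x)); first by rewrite lt_min d0 subr_gt0.
move=> h h0; rewrite lt_min => /andP[hd hb].
have ab : a <= b by arith.
have ck t : {for t, continuous (kernel x h)} by exact: kernel_cont.
have ik : mu.-integrable `[a, b] (EFin \o kernel x h) by apply: cont_integrable => t _ _.
have i1 : mu.-integrable `[a, b] (EFin \o (fun t => v t * kernel x h t)).
  by apply: cont_integrable => t at_ tb; apply: continuousM; [exact: cv|exact: ck].
have i2 : mu.-integrable `[a, b] (EFin \o (fun t => v x * kernel x h t)).
  by apply: cont_integrable => t _ _; apply: continuousM; [exact: cvg_cst|exact: ck].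
have i3 : mu.-integrable `[a, b] (EFin \o (fun t => (v t - v x) * kernel x h t)).
  apply: cont_integrable => t at_ tb; apply: continuousM; last exact: ck.
  by apply: continuousB; [exact: cv|exact: cvg_cst].
have i4 : mu.-integrable `[a, b] (EFin \o (fun t => e * kernel x h t)).
  by apply: cont_integrable => t _ _; apply: continuousM; [exact: cvg_cst|exact: ck].
have k1 : \int[mu]_(t in `[a, b]) kernel x h t = 1.
  rewrite (ftc2 ab (fun t _ _ => dsigma_affine x h t) (fun t _ _ => @kernel_cont x h t)).
  by rewrite sigma_right ?sigma_left ?subr0 //; arith.
have -> : \int[mu]_(t in `[a, b]) (v t * kernel x h t) - v x =
    \int[mu]_(t in `[a, b]) ((v t - v x) * kernel x h t).
  have -> : \int[mu]_(t in `[a, b]) ((v t - v x) * kernel x h t) =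
      \int[mu]_(t in `[a, b]) (v t * kernel x h t - v x * kernel x h t).
    by apply: eq_Rint => t _ _; rewrite mulrBl.
  by rewrite RintegralB // RintegralZl // k1 mulr1.
apply: (@le_trans _ _ (\int[mu]_(t in `[a, b]) `|(v t - v x) * kernel x h t|)).
  exact: le_normr_Rintegral.
apply: (@le_trans _ _ (\int[mu]_(t in `[a, b]) (e * kernel x h t))).
  apply: Rint_le => //; first exact: integrable_abs.
  move=> t at_ tb; rewrite normrM [X in _ * X]ger0_norm ?kernel_ge0 //.
  have [tx|xt] := leP t x; first by rewrite kernel_left // !mulr0.
  have [ht|ht] := leP (x + h) t; first by rewrite kernel_right // !mulr0.
  apply: ler_wpM2r; first exact: kernel_ge0.
  by apply/ltW/Hd; rewrite gtr0_norm; arith.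
by rewrite RintegralZl // k1 mulr1.
Qed.

Lemma step_smooth (x y h : R) : smooth (step x y h).
Proof.
have s := smooth_affine (@sigma_smooth R).
have := @smooth_lin R 1 (-1) _ _ (s x h) (s y h).
by congr smooth; apply/funext => t; rewrite /step; ring.
Qed.

Lemma dstep (x y h t : R) : is_derive t 1 (step x y h) (kernel x h t - kernel y h t).
Proof. by eapply dD; [exact: dsigma_affine|eapply dN; exact: dsigma_affine]. Qed.

Lemma Rint_ae (f g : R -> R) (a b : R) :
  measurable_fun `[a, b] f -> measurable_fun `[a, b] g -> ae_eq mu `[a, b] f g ->
  \int[mu]_(x in `[a, b]) f x = \int[mu]_(x in `[a, b]) g x.
Proof.
move=> mf mg fg; congr fine; apply: ae_eq_integral => //.
- exact/measurable_EFinP.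
- exact/measurable_EFinP.
- exact: (ae_eq_comp EFin fg).
Qed.

End Averages.

(** * Regularity of minimizers *)

Section WeakDerivative.
Variables (R : realType) (Rad : \bar R) (u du v : R -> R).
Notation mu := (@lebesgue_measure R).
Local Notation I := (interval0 Rad).
Hypotheses (hu : L2loc I u) (hdu : L2loc I du) (wd : weak_derivative I u du).
Hypothesis cv : forall r, I r -> {for r, continuous v}.
Hypothesis uv : ae_eq mu I u v.

Lemma L2loc_measurable (f : R -> R) (a b : R) : L2loc I f -> I a -> I b -> measurable_fun `[a, b] f.
Proof.
move=> [mf _] Ia Ib; apply: measurable_funS mf; first exact: measurable_interval0.
exact: itv_sub_interval0.
Qed.

Lemma L2loc_sq_integrable (f : R -> R) (a b : R) : L2loc I f -> I a -> I b ->
  mu.-integrable `[a, b] (EFin \o (fun x => f x ^+ 2)).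
Proof.
move=> [_ [mf _ H]] Ia Ib; apply/integrableP; split.
  apply/measurable_EFinP; apply: measurable_funS mf; first exact: measurable_interval0.
  exact: itv_sub_interval0.
by apply: H; [exact: itv_sub_interval0|exact: segment_compact].
Qed.

Lemma L2loc_integrable (f : R -> R) (a b : R) : L2loc I f -> I a -> I b ->
  mu.-integrable `[a, b] (EFin \o f).
Proof.
move=> hf Ia Ib; have i1 := L2loc_sq_integrable hf Ia Ib.
have i0 : mu.-integrable `[a, b] (EFin \o (fun=> 1 : R)).
  by apply: cont_integrable => x _ _; exact: cvg_cst.
have i2 : mu.-integrable `[a, b] (EFin \o (fun x => 1 + f x ^+ 2)).
  by exact: (integrableD _ i0 i1).
apply: (le_integrable _ _ _ i2) => //.
  by apply/measurable_EFinP; exact: L2loc_measurable.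
move=> x _ /=; rewrite lee_fin.
rewrite [leRHS]ger0_norm ?addr_ge0 ?sqr_ge0 //.
rewrite -[f x ^+ 2]real_normK ?num_real //.
have := sqr_ge0 (`|f x| - 1 / 2); have := normr_ge0 (f x).
set y := `|f x| => ? ?; nra.
Qed.

Lemma ae_eq_itv (a b : R) : I a -> I b -> ae_eq mu `[a, b] u v.
Proof. by move=> Ia Ib; apply: ae_eq_subset uv; exact: itv_sub_interval0. Qed.

Lemma cont_measurable (f : R -> R) (a b : R) :
  (forall x, a <= x -> x <= b -> {for x, continuous f}) -> measurable_fun `[a, b] f.
Proof.
move=> cf; apply/measurable_EFinP; exact: measurable_int (cont_integrable cf).
Qed.

Lemma weak_derivative_itv (phi : R -> R) (a b : R) : I a -> I b -> test_function I phi ->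
  (forall x, ~~ (a <= x <= b) -> phi x = 0 /\ phi^`()%classic x = 0) ->
  \int[mu]_(x in `[a, b]) (v x * phi^`()%classic x) =
  - \int[mu]_(x in `[a, b]) (du x * phi x).
Proof.
move=> Ia Ib tphi out; have mI := @measurable_interval0 R Rad.
have := wd tphi.
rewrite (Rint_support mI (itv_sub_interval0 Ia Ib)); last first.
  by move=> x _ /out[_ ->]; rewrite mulr0.
rewrite (Rint_support (f := fun x => du x * phi x) mI (itv_sub_interval0 Ia Ib)); last first.
  by move=> x _ /out[-> _]; rewrite mulr0.
move=> <-; apply: Rint_ae.
- apply: cont_measurable => x ax xb; apply: continuousM.
    by apply: cv; exact: interval0_conv Ia Ib ax xb.
  exact: test_function_cont1 tphi.
- apply: measurable_funM; first exact: L2loc_measurable.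
  by apply: cont_measurable => x _ _; exact: test_function_cont1 tphi.
- apply: ae_eq_mul2r; apply: ae_eq_sym; exact: ae_eq_itv.
Qed.

(** The weak derivative is tested with the smoothed indicator of [[x, y]]. Its derivative is a
    difference of two kernels, so for small [h] one side is close to [v x - v y] and the other to
    minus the integral of [du]. *)
Lemma weak_derivative_ftc x y : I x -> I y -> x < y ->
  v y - v x = \int[mu]_(t in `[x, y]) du t.
Proof.
move=> Ix Iy xy; have [b Ib yb] := interval0_right Iy.
have cvb t : x <= t -> t <= b -> {for t, continuous v}.
  by move=> xt tb; apply: cv; exact: interval0_conv Ix Ib xt tb.
have idu : mu.-integrable `[x, b] (EFin \o du) by exact: L2loc_integrable.
apply/eqP; rewrite -subr_eq0 -normr_le0; apply/ler_addgt0Pr => e e0; rewrite add0r.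
have e3 : 0 < e / 3 by rewrite divr_gt0.
have xb : x < b by exact: lt_trans yb.
have [d1 d10 H1] := kernel_limit (lexx x) xb e3 cvb.
have [d2 d20 H2] := kernel_limit (ltW xy) yb e3 cvb.
have [d3 d30 H3] := step_limit (lexx x) xy yb e3 idu.
pose m := Num.min (Num.min d1 d2) (Num.min d3 (b - y)).
have m0 : 0 < m by rewrite !lt_min d10 d20 d30 subr_gt0.
pose h := m / 2; have h0 : 0 < h by rewrite divr_gt0.
have hm : h < m by rewrite /h; arith.
move: (hm); rewrite /m !lt_min => /andP[/andP[h1 h2] /andP[h3 hb]].
have out t : ~~ (x <= t <= b) -> step x y h t = 0 /\ (step x y h)^`()%classic t = 0.
  rewrite negb_and -!ltNge (is_derive_derive1 (dstep x y h t)) /step => /orP[tx|bt].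
    by rewrite !sigma_left ?kernel_left ?subrr //; arith.
  by rewrite !sigma_right ?kernel_right ?subrr //; arith.
have ts : test_function I (step x y h).
  apply: (smooth_test_function (@step_smooth R x y h) (itv_sub_interval0 Ix Ib)).
  by move=> t /out[].
have := weak_derivative_itv Ix Ib ts out.
have ik z : mu.-integrable `[x, b] (EFin \o (fun t => v t * kernel z h t)).
  by apply: cont_integrable => t xt tb; apply: continuousM; [exact: cvb|exact: kernel_cont].
have -> : \int[mu]_(t in `[x, b]) (v t * (step x y h)^`()%classic t) =
    \int[mu]_(t in `[x, b]) (v t * kernel x h t) - \int[mu]_(t in `[x, b]) (v t * kernel y h t).
  rewrite -RintegralB //; apply: eq_Rint => t _ _.
  by rewrite (is_derive_derive1 (dstep x y h t)) mulrBr.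
have -> : \int[mu]_(t in `[x, b]) (du t * step x y h t) =
    \int[mu]_(t in `[x, b]) (step x y h t * du t).
  by apply: eq_Rint => t _ _; rewrite mulrC.
move: (H1 h h0 h1) (H2 h h0 h2) (H3 h h0 h3).
move: (\int[mu]_(t in `[x, b]) (v t * kernel x h t)) (\int[mu]_(t in `[x, b]) (v t * kernel y h t))
  (\int[mu]_(t in `[x, b]) (step x y h t * du t)) (\int[mu]_(t in `[x, y]) du t) => A B C E.
move: (v x) (v y) => vx vy.
rewrite !ler_norml => /andP[? ?] /andP[? ?] /andP[? ?] ?.
by apply/andP; split; arith.
Qed.

End WeakDerivative.

(** * Local primitives and second-order expansions *)

Section Primitive.
Variable R : realType.
Implicit Types a b x : R.

Definition clamp a b x : R := Num.max a (Num.min b x).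

Lemma clamp_in a b x : a <= b -> a <= clamp a b x <= b.
Proof. by move=> ab; rewrite /clamp le_max lexx ge_max ab ge_min lexx. Qed.

Lemma clamp_id a b x : a <= x -> x <= b -> clamp a b x = x.
Proof. by move=> ax xb; rewrite /clamp min_r // max_r. Qed.

Lemma clamp_cont a b : continuous (clamp a b).
Proof.
move=> x; apply/cvgrPdist_lt => e e0.
have : \forall y \near x, `|y - x| < e.
  by apply/nbhs_ballP; exists e => //= y; rewrite /ball /= distrC.
apply: filterS => y; rewrite distrC; apply: le_lt_trans; rewrite /clamp.
have h1 := ler_norm (x - y); have h2 := ler_norm (y - x); rewrite distrC in h2.
have hmin : `|Num.min b x - Num.min b y| <= `|x - y|.
  by case: (leP b x); case: (leP b y) => *; rewrite ler_norml; apply/andP; split; arith.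
apply: le_trans hmin; clear h1 h2; move: (Num.min b x) (Num.min b y) => s t.
have h1 := ler_norm (s - t); have h2 := ler_norm (t - s); rewrite distrC in h2.
by case: (leP a s); case: (leP a t) => *; rewrite ler_norml; apply/andP; split; arith.
Qed.

Lemma cont_clamp (f : R -> R) a b : a <= b ->
  (forall x, a <= x -> x <= b -> {for x, continuous f}) -> continuous (f \o clamp a b).
Proof.
move=> ab cf x; apply: continuous_comp; first exact: clamp_cont.
by have /andP[? ?] := clamp_in x ab; exact: cf.
Qed.

(** [dprim] asks for continuity on the whole line, hence the composition with [clamp]; the
    derivative is thereby two-sided also at [a] and [b]. *)
Lemma local_primitive (f : R -> R) a b : a <= b ->
  (forall x, a <= x -> x <= b -> {for x, continuous f}) ->
  exists P : R -> R, forall x, a <= x -> x <= b -> is_derive x 1 P (f x).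
Proof.
move=> ab cf; exists (prim (f \o clamp a b)) => x ax xb.
have := @dprim R (f \o clamp a b) x (cont_clamp ab cf).
by rewrite /= clamp_id.
Qed.

(** The value [t = - A / K'] makes the expression negative unless [A = 0]; [K'] is at least [K], and
    large enough that [|t| <= 1]. *)
Lemma quadratic_stationary (A K : R) :
  (forall t, `|t| <= 1 -> 0 <= 2 * t * A + t ^+ 2 * K) -> A = 0.
Proof.
move=> H; apply/eqP; rewrite -sqrf_eq0 eq_le sqr_ge0 andbT leNgt; apply/negP => A0.
pose K' := `|K| + `|A| + 1.
have K0 : 0 < K' by rewrite /K' ltr_wpDl // addr_ge0.
have KK : K <= K' by rewrite /K'; have := ler_norm K; have := normr_ge0 A; arith.
have tl : `|- A / K'| <= 1.
  rewrite normrM normrN normfV (gtr0_norm K0) ler_pdivrMr // mul1r /K'.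
  by have := normr_ge0 K; arith.
have := H _ tl.
have -> : 2 * (- A / K') * A + (- A / K') ^+ 2 * K = (A ^+ 2 / K' ^+ 2) * (K - 2 * K').
  by field; rewrite gt_eqF.
have : 0 < A ^+ 2 / K' ^+ 2 by rewrite divr_gt0 // exprn_gt0.
move: (A ^+ 2 / K' ^+ 2) => z z0; have : K - 2 * K' < 0 by arith.
by move=> h1; rewrite leNgt => /negP; apply; rewrite pmulr_rlt0.
Qed.

(** One-sided Taylor bound: the mean value theorem gives the slope [2 F c] with [|c - y| <= |s|],
    and [F] is Lipschitz on [[- M, M]]. *)
Lemma potential_quad (F : R -> R) (M L y s : R) : continuous F -> 0 <= L ->
  (forall s t, - M <= s -> s <= M -> - M <= t -> t <= M -> `|F s - F t| <= L * `|s - t|) ->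
  `|y| <= M -> `|y + s| <= M ->
  potential F (y + s) - potential F y <= 2 * F y * s + 2 * L * s ^+ 2.
Proof.
move=> cF L0 HL; rewrite !ler_norml => /andP[y1 y2] /andP[s1 s2].
have D x : is_derive x 1 (potential F) (2 * F x) by exact: dpotential.
have [c [cM1 cM2 cs E]] : exists c, [/\ - M <= c, c <= M, `|c - y| <= `|s| &
    potential F (y + s) - potential F y = 2 * F c * s].
  have [s0|s0|->] := ltgtP s 0.
  - have ys : y + s < y by arith.
    have [c [c1 c2 E]] := mvt ys (fun x _ _ => D x).
    exists c; split; [arith|arith| |by move: E; arith].
    by rewrite !ltr0_norm; arith.
  - have ys : y < y + s by arith.
    have [c [c1 c2 E]] := mvt ys (fun x _ _ => D x).
    exists c; split; [arith|arith| |by move: E; arith].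
    by rewrite !gtr0_norm; arith.
  - by exists y; split; [arith|arith|rewrite subrr normr0|rewrite addr0 subrr mulr0].
have h1 : (F c - F y) * s <= L * s ^+ 2.
  apply: le_trans (ler_norm _) _; rewrite normrM -[s ^+ 2]real_normK ?num_real // expr2 mulrA.
  apply: ler_wpM2r => //; apply: le_trans (HL c y cM1 cM2 y1 y2) _.
  by apply: ler_wpM2l.
by rewrite E; arith.
Qed.

End Primitive.

Lemma ae_imp (R : realType) (P Q : R -> Prop) : (forall x, P x -> Q x) ->
  {ae @lebesgue_measure R, forall x, P x} -> {ae @lebesgue_measure R, forall x, Q x}.
Proof.
by move=> PQ; apply: filterS => //; exact: (ae_filter_ringOfSetsType lebesgue_measure).
Qed.

(** * Increments of the energy density *)

Section EnergyGap.
Variables (R : realType) (p q : R) (F : R -> R).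
Notation mu := (@lebesgue_measure R).
Hypothesis cF : continuous F.
Implicit Types (w dw phi : R -> R) (a b r : R).

Lemma energy_density_measurable w dw a b : 0 < a ->
  measurable_fun `[a, b] w -> measurable_fun `[a, b] dw ->
  measurable_fun `[a, b] (energy_density p q F w dw).
Proof.
move=> a0 mw mdw.
have mX (s : R) : measurable_fun `[a, b] (fun r => r `^ s).
  by apply: cont_measurable => r ar _; apply: cont_powR; exact: lt_le_trans ar.
have mP : measurable_fun `[a, b] (potential F \o w).
  apply: measurableT_comp mw; apply: continuous_measurable_fun => t.
  exact: is_derive_continuous (dpotential t cF).
apply: (@measurable_funD _ _ R `[a, b]
  (fun r => r `^ p * `|dw r| ^+ 2 + q * r `^ (p - 2) * w r ^+ 2)
  (fun r => r `^ p * potential F (w r))); last exact: (measurable_funM (mX p) mP).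
apply: (@measurable_funD _ _ R `[a, b] (fun r => r `^ p * `|dw r| ^+ 2)
  (fun r => q * r `^ (p - 2) * w r ^+ 2)).
  apply: (measurable_funM (mX p)).
  apply: (@measurable_funX _ _ _ _ (fun r => `|dw r|) 2%N).
  exact: (measurableT_comp (@normr_measurable R setT) mdw).
apply: (@measurable_funM _ _ _ _ (fun r => q * r `^ (p - 2)) (fun r => w r ^+ 2)).
  exact: (measurable_funM (measurable_cst q) (mX (p - 2))).
exact: measurable_funX.
Qed.

Definition gap w dw phi (phi1 : R -> R) r : R :=
  energy_density p q F (w \+ phi) (dw \+ phi1) r - energy_density p q F w dw r.

(** The square of [dw] cancels: the increment is affine in [dw] with continuous coefficients, so it
    is integrable as soon as [dw] is. *)
Lemma gapE w dw phi (phi1 : R -> R) r : 0 < r ->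
  gap w dw phi phi1 r = 2 * (r `^ p * phi1 r) * dw r +
   (r `^ p * phi1 r ^+ 2 + r `^ p * (q / r ^+ 2 * (phi r * (2 * w r + phi r)) +
    (potential F (w r + phi r) - potential F (w r)))).
Proof. by move=> r0; rewrite /gap !energy_densityE //=; field; rewrite gt_eqF. Qed.

Lemma gap_integrable w dw phi (phi1 : R -> R) a b : 0 < a ->
  mu.-integrable `[a, b] (EFin \o dw) ->
  (forall r, a <= r -> r <= b -> {for r, continuous w}) ->
  (forall r, a <= r -> r <= b -> {for r, continuous phi}) ->
  (forall r, a <= r -> r <= b -> {for r, continuous phi1}) ->
  mu.-integrable `[a, b] (EFin \o gap w dw phi phi1).
Proof.
move=> a0 idw cw cphi cphi1.
have cX r : a <= r -> {for r, continuous (fun r => r `^ p)}.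
  by move=> ar; apply: cont_powR; exact: lt_le_trans ar.
have i1 : mu.-integrable `[a, b] (EFin \o (fun r => 2 * (r `^ p * phi1 r) * dw r)).
  apply: integrable_contM => // r ar rb.
  by apply: continuousM; [exact: cvg_cst|apply: continuousM; [exact: cX|exact: cphi1]].
have cP r : a <= r -> r <= b ->
    {for r, continuous (fun r => potential F (w r + phi r) - potential F (w r))}.
  move=> ar rb; have cp t : {for t, continuous (potential F)}.
    exact: is_derive_continuous (dpotential t cF).
  apply: continuousB.
    apply: (@continuous_comp _ _ _ (fun r => w r + phi r) (potential F)) => //.
    by apply: continuousD; [exact: cw|exact: cphi].
  by apply: (@continuous_comp _ _ _ w (potential F)) => //; exact: cw.
have i2 : mu.-integrable `[a, b] (EFin \o (fun r =>
   (r `^ p * phi1 r ^+ 2 + r `^ p * (q / r ^+ 2 * (phi r * (2 * w r + phi r)) +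
    (potential F (w r + phi r) - potential F (w r)))))).
  apply: cont_integrable => r ar rb.
  apply: (@continuousD _ _ _ (fun r : R => r `^ p * phi1 r ^+ 2) (fun r => r `^ p *
    (q / r ^+ 2 * (phi r * (2 * w r + phi r)) +
    (potential F (w r + phi r) - potential F (w r))))).
    apply: (@continuousM _ _ (fun r : R => r `^ p) (fun r => phi1 r ^+ 2)); first exact: cX.
    by apply: cont_sq; exact: cphi1.
  apply: (@continuousM _ _ (fun r : R => r `^ p) _); first exact: cX.
  apply: (@continuousD _ _ _ (fun r : R => q / r ^+ 2 * (phi r * (2 * w r + phi r)))); last exact: cP.
  apply: (@continuousM _ _ (fun r : R => q / r ^+ 2)).
    by apply: cont_divsq; exact: lt_le_trans ar.
  apply: (@continuousM _ _ phi); first exact: cphi.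
  apply: (@continuousD _ _ _ (fun r : R => 2 * w r)); last exact: cphi.
  by apply: (@continuousM _ _ (fun=> 2)); [exact: cvg_cst|exact: cw].
have := integrableD _ i1 i2; move=> /(_ (measurable_itv _)).
apply: eq_integrable => // r; rewrite inE /= in_itv /= => /andP[ar _].
by rewrite -EFinD gapE //; exact: lt_le_trans ar.
Qed.

End EnergyGap.

(** * Weak Euler-Lagrange equation *)

Section EulerLagrange.
Variables (R : realType) (Rad : \bar R) (p q : R) (F u du v : R -> R).
Notation mu := (@lebesgue_measure R).
Local Notation I := (interval0 Rad).
Hypothesis hF : class_C1 F.
Hypotheses (hu : L2loc I u) (hdu : L2loc I du) (wd : weak_derivative I u du).
Hypothesis cv : forall r, I r -> {for r, continuous v}.
Hypothesis uv : ae_eq mu I u v.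
Hypothesis hmin : forall a b : R, I a -> a <= b -> I b ->
  mu.-integrable `[a, b] (EFin \o energy_density p q F u du) /\
  forall phi : R -> R, test_function `]a, b[ phi ->
    (energy p q F u du `[a, b] <=
     energy p q F (u \+ phi)%R (du \+ phi^`()%classic)%R `[a, b])%E.

Let cF : continuous F.
Proof. by move=> x; exact: (is_derive_continuous (derive1P (proj1 hF x))). Qed.

Let cvi a b : I a -> I b -> forall r, a <= r -> r <= b -> {for r, continuous v}.
Proof. by move=> Ia Ib r ar rb; apply: cv; exact: interval0_conv Ia Ib ar rb. Qed.

Lemma gap_minimizer_integrable (phi : R -> R) (a b : R) : I a -> I b -> smooth phi ->
  mu.-integrable `[a, b] (EFin \o gap p q F v du phi phi^`()%classic).
Proof.
move=> Ia Ib sphi; apply: gap_integrable => //.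
- exact: interval0_pos Ia.
- exact: (L2loc_integrable hdu).
- exact: cvi.
- by move=> r _ _; exact: smooth_cont.
- by move=> r _ _; exact: smooth_cont (smooth_derive1 sphi) _.
Qed.

Lemma gap_minimizer_ge0 (phi : R -> R) (a b : R) : I a -> a <= b -> I b -> smooth phi ->
  test_function `]a, b[ phi ->
  0 <= \int[mu]_(r in `[a, b]) gap p q F v du phi phi^`()%classic r.
Proof.
move=> Ia ab Ib sphi tphi; have [ie /(_ _ tphi)] := hmin Ia ab Ib.
have a0 := interval0_pos Ia.
have ig := gap_minimizer_integrable Ia Ib sphi.
have mphi : measurable_fun `[a, b] phi.
  by apply: cont_measurable => r _ _; exact: smooth_cont.
have mphi1 : measurable_fun `[a, b] phi^`()%classic.
  by apply: cont_measurable => r _ _; exact: smooth_cont (smooth_derive1 sphi) _.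
have mu_ := L2loc_measurable hu Ia Ib; have mdu := L2loc_measurable hdu Ia Ib.
have ieg : mu.-integrable `[a, b] (EFin \o
    (fun r => energy_density p q F u du r + gap p q F v du phi phi^`()%classic r)).
  exact: (integrableD _ ie ig).
have E : (\int[mu]_(r in `[a, b])
      (energy_density p q F (u \+ phi) (du \+ phi^`()%classic) r)%:E =
    \int[mu]_(r in `[a, b])
      (energy_density p q F u du r + gap p q F v du phi phi^`()%classic r)%:E)%E.
  apply: ae_eq_integral => //.
  - apply/measurable_EFinP; apply: energy_density_measurable => //.
      exact: measurable_funD.
    exact: measurable_funD.
  - exact: measurable_int ieg.
  - move: (ae_eq_itv uv Ia Ib); apply: ae_imp.
    by move=> r + rab => /(_ rab) E; rewrite /gap /energy_density /= E [in RHS]addrC subrK.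
rewrite /energy E (integral_EFin ieg) (integral_EFin ie) -!EFinM lee_fin.
rewrite RintegralD // mulrDr lerDl pmulr_rge0 //.
Qed.

Local Notation force r := (r `^ p * (q / r ^+ 2 * v r + F (v r))).

Lemma cont_force a b : I a -> I b -> forall r, a <= r -> r <= b ->
  {for r, continuous (fun r => force r)}.
Proof.
move=> Ia Ib r ar rb; have r0 : 0 < r by exact: lt_le_trans (interval0_pos Ia) ar.
have cvr := cvi Ia Ib ar rb.
apply: (@continuousM _ _ (fun r : R => r `^ p) (fun r => q / r ^+ 2 * v r + F (v r))).
  exact: cont_powR.
apply: (@continuousD _ _ _ (fun r : R => q / r ^+ 2 * v r) (fun r : R => F (v r))).
  by apply: (@continuousM _ _ (fun r : R => q / r ^+ 2) v) => //; exact: cont_divsq.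
by apply: (@continuous_comp _ _ _ v F) => //; exact: cF.
Qed.

(** For [|t| <= 1] the increment due to [t * phi] is at most [2 t] times this integral plus a
    multiple of [t^2], and it is nonnegative; [quadratic_stationary] concludes. *)
Lemma euler_lagrange_weak (phi : R -> R) (a b a' b' : R) : I a -> I b -> a < a' -> a' <= b' ->
  b' < b -> smooth phi -> (forall x, ~~ (a' <= x <= b') -> phi x = 0) ->
  \int[mu]_(r in `[a, b]) (r `^ p * phi^`()%classic r * du r + force r * phi r) = 0.
Proof.
move=> Ia Ib aa ab' bb sphi phi0; set phi1 := phi^`()%classic.
have ab : a <= b by arith.
have a0 := interval0_pos Ia.
have cphi : continuous phi by exact: smooth_cont.
have cphi1 : continuous phi1 by exact: smooth_cont (smooth_derive1 sphi).
have cX r : a <= r -> {for r, continuous (fun r => r `^ p)}.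
  by move=> ar; apply: cont_powR; exact: lt_le_trans ar.
have [V V0 HV] := cont_bounded (cvi Ia Ib).
have [B B0 HB] := @cont_bounded R phi a b (fun x _ _ => @cphi x).
have [L L0 HL] := C1_lipschitz (- (V + B)) (V + B) hF.
(* [t^2 C] bounds the part of the increment due to [t * phi] that is beyond first order. *)
pose C r := r `^ p * phi1 r ^+ 2 + r `^ p * ((q / r ^+ 2 + 2 * L) * phi r ^+ 2).
have il : mu.-integrable `[a, b] (EFin \o (fun r => r `^ p * phi1 r * du r + force r * phi r)).
  have l1 : mu.-integrable `[a, b] (EFin \o (fun r => r `^ p * phi1 r * du r)).
    apply: integrable_contM; last exact: (L2loc_integrable hdu).
    by move=> r ar rb; apply: continuousM; [exact: cX|exact: cphi1].
  have l2 : mu.-integrable `[a, b] (EFin \o (fun r => force r * phi r)).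
    apply: cont_integrable => r ar rb.
    by apply: (@continuousM _ _ (fun r : R => force r) phi); [exact: (cont_force Ia Ib)|exact: cphi].
  exact: (integrableD _ l1 l2).
have iC : mu.-integrable `[a, b] (EFin \o C).
  apply: cont_integrable => r ar rb.
  apply: (@continuousD _ _ _ (fun r : R => r `^ p * phi1 r ^+ 2)).
    apply: (@continuousM _ _ (fun r : R => r `^ p) (fun r => phi1 r ^+ 2)); first exact: cX.
    by apply: cont_sq; exact: cphi1.
  apply: (@continuousM _ _ (fun r : R => r `^ p)); first exact: cX.
  apply: (@continuousM _ _ (fun r : R => q / r ^+ 2 + 2 * L) (fun r => phi r ^+ 2)); last first.
    by apply: cont_sq; exact: cphi.
  apply: (@continuousD _ _ _ (fun r : R => q / r ^+ 2)); last exact: cvg_cst.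
  by apply: cont_divsq; exact: lt_le_trans ar.
apply: (@quadratic_stationary _ _ (\int[mu]_(r in `[a, b]) C r)) => t t1.
have stphi : smooth (fun x => t * phi x).
  have := @smooth_lin R t 0 _ _ sphi sphi; congr smooth.
  by apply/funext => x; rewrite mul0r addr0.
have dtphi x : (fun x => t * phi x)^`()%classic x = t * phi1 x.
  apply: is_derive_derive1.
  eapply derE; [eapply dM; [exact: dcst|exact: (smooth_der x sphi)]|].
  by rewrite /= mul0r add0r.
have ttphi : test_function `]a, b[ (fun x => t * phi x).
  apply: (smooth_test_function (a := a') (b := b') stphi).
    by move=> x /=; rewrite !in_itv /= => /andP[? ?]; apply/andP; split; arith.
  by move=> x /phi0 ->; rewrite mulr0.
have := gap_minimizer_ge0 Ia ab Ib stphi ttphi.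
have ig := gap_minimizer_integrable Ia Ib stphi.
have i1 : mu.-integrable `[a, b]
    (EFin \o (fun r => 2 * t * (r `^ p * phi1 r * du r + force r * phi r))).
  by apply: integrable_contM => // r _ _; exact: cvg_cst.
have i2 : mu.-integrable `[a, b] (EFin \o (fun r => t ^+ 2 * C r)).
  by apply: integrable_contM => // r _ _; exact: cvg_cst.
move=> /le_trans; apply.
have -> : 2 * t * \int[mu]_(r in `[a, b]) (r `^ p * phi1 r * du r + force r * phi r) +
    t ^+ 2 * \int[mu]_(r in `[a, b]) C r =
    \int[mu]_(r in `[a, b]) (2 * t * (r `^ p * phi1 r * du r + force r * phi r) + t ^+ 2 * C r).
  by rewrite [RHS]RintegralD // !RintegralZl.
apply: Rint_le => //; first exact: (integrableD _ i1 i2).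
move=> r ar rb; have r0 : 0 < r by exact: lt_le_trans ar.
rewrite gapE // dtphi /C.
have Vr := HV r ar rb; have Br := HB r ar rb.
have tB : `|t * phi r| <= B.
  by rewrite normrM -[B]mul1r; exact: ler_pM.
have vM : `|v r| <= V + B by arith.
have vtM : `|v r + t * phi r| <= V + B by apply: le_trans (ler_normD _ _) _; arith.
have := potential_quad cF (ltW L0) HL vM vtM.
move: (potential F _ - potential F _) (powR_ge0 r p) => P X0 HP.
rewrite -subr_ge0; move: (du r) (phi1 r) (F (v r)) HP => d f Fv HP.
have -> : 2 * t * (r `^ p * f * d + r `^ p * (q / r ^+ 2 * v r + Fv) * phi r) +
  t ^+ 2 * (r `^ p * f ^+ 2 + r `^ p * ((q / r ^+ 2 + 2 * L) * phi r ^+ 2)) -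
  (2 * (r `^ p * (t * f)) * d + (r `^ p * (t * f) ^+ 2 +
   r `^ p * (q / r ^+ 2 * (t * phi r * (2 * v r + t * phi r)) + P))) =
  r `^ p * (2 * Fv * (t * phi r) + 2 * L * (t * phi r) ^+ 2 - P) by ring.
by rewrite mulr_ge0 // subr_ge0.
Qed.

End EulerLagrange.

(** * The du Bois-Reymond lemma *)

Section DuBoisReymond.
Variable R : realType.
Notation mu := (@lebesgue_measure R).
Implicit Types a b x y s t h : R.

Let csigma : continuous (@sigma R) := smooth_cont (@sigma_smooth R).

Lemma prim_sigma_le0 s : s <= 0 -> prim (@sigma R) s = 0.
Proof.
move=> s0; have D y : s <= y -> y <= 0 -> is_derive y 1 (prim (@sigma R)) 0.
  by move=> _ y0; have := dprim y csigma; rewrite sigma_le0.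
have h1 := nondecr_der s0 D (fun _ _ _ => lexx _).
have h2 := nonincr_der s0 D (fun _ _ _ => lexx _).
by apply/eqP; rewrite eq_le -(prim0 (@sigma R)) h1.
Qed.

Lemma prim_sigma_ge1 s : 1 <= s -> prim (@sigma R) s = prim (@sigma R) 1 + (s - 1).
Proof.
move=> s1; have D y : 1 <= y -> y <= s ->
    is_derive y 1 (fun t => prim (@sigma R) t - t) 0.
  move=> y1 _; have := dprim y csigma; rewrite sigma_ge1 // => Dp.
  by eapply derE; [eapply dD; [exact: Dp|eapply dN; exact: did]|exact: subrr].
have h1 := nondecr_der s1 D (fun _ _ _ => lexx _).
have h2 := nonincr_der s1 D (fun _ _ _ => lexx _).
by move: h1 h2 => /=; arith.
Qed.

(** Primitive of the smoothed Heaviside function at [x]; a difference of two ramps is constant from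
    some point on. *)
Definition ramp x h t : R := h * prim (@sigma R) ((t - x) / h).

Lemma ramp_smooth x h : smooth (ramp x h).
Proof.
have s := smooth_affine (a := x) (b := h) (smooth_prim (@sigma_smooth R)).
have := @smooth_lin R h 0 _ _ s s.
by congr smooth; apply/funext => t; rewrite /ramp mul0r addr0.
Qed.

Lemma dramp x h t : 0 < h -> is_derive t 1 (ramp x h) (sigma ((t - x) / h)).
Proof.
move=> h0; have D2 := dprim ((t - x) / h) csigma.
have D3 : is_derive t 1 (fun t => (t - x) / h) h^-1.
  by eapply derE; [eapply dM; [eapply dD; [exact: did|exact: dcst]|exact: dcst]|cbv beta; ring].
have D4 := dcomp (f := prim (@sigma R)) (g := fun t => (t - x) / h) D2 D3.
by eapply derE; [eapply dM; [exact: dcst|exact: D4]|cbv beta; field; rewrite gt_eqF].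
Qed.

Lemma ramp_left x h t : 0 < h -> t <= x -> ramp x h t = 0.
Proof.
move=> h0 tx; rewrite /ramp prim_sigma_le0 ?mulr0 //.
by rewrite mulr_le0_ge0 ?subr_le0 // invr_ge0 ltW.
Qed.

Lemma ramp_right x y h t : 0 < h -> x + h <= t -> y + h <= t ->
  ramp x h t - ramp y h t = y - x.
Proof.
move=> h0 tx ty; rewrite /ramp (prim_sigma_ge1 (s := (t - x) / h)); last first.
  by rewrite ler_pdivlMr // mul1r; arith.
rewrite (prim_sigma_ge1 (s := (t - y) / h)); last first.
  by rewrite ler_pdivlMr // mul1r; arith.
by field; rewrite gt_eqF.
Qed.

(* Testing with the primitive of a difference of two normalized smooth steps shows that
   [f] has the same average on any two intervals. *)
Lemma du_bois_reymond (f : R -> R) a b : a < b -> mu.-integrable `[a, b] (EFin \o f) ->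
  (forall (phi : R -> R) a' b', a < a' -> a' <= b' -> b' < b -> smooth phi ->
    (forall x, ~~ (a' <= x <= b') -> phi x = 0) ->
    \int[mu]_(x in `[a, b]) (phi^`()%classic x * f x) = 0) ->
  exists C : R, forall x y, a < x -> x < y -> y < b ->
    {ae mu, forall t, `]x, y[%classic t -> f t = C}.
Proof.
move=> ab fi H.
have avg x y s t : a < x -> x < y -> y < b -> a < s -> s < t -> t < b ->
    (\int[mu]_(r in `[x, y]) f r) / (y - x) = (\int[mu]_(r in `[s, t]) f r) / (t - s).
  move=> ax xy yb as_ st tb; apply/eqP; rewrite -subr_eq0 -normr_le0.
  apply/ler_addgt0Pr => e e0; rewrite add0r.
  have yx0 : 0 < y - x by rewrite subr_gt0.
  have ts0 : 0 < t - s by rewrite subr_gt0.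
  pose e1 := e / 2 * (y - x); pose e2 := e / 2 * (t - s).
  have e10 : 0 < e1 by rewrite /e1 !mulr_gt0.
  have e20 : 0 < e2 by rewrite /e2 !mulr_gt0.
  have [d1 d10 H1] := step_limit (ltW ax) xy yb e10 fi.
  have [d2 d20 H2] := step_limit (ltW as_) st tb e20 fi.
  pose m := Num.min (Num.min d1 d2) (Num.min (b - y) (b - t)).
  have m0 : 0 < m by rewrite !lt_min d10 d20 !subr_gt0 yb tb.
  pose h := m / 2; have h0 : 0 < h by rewrite divr_gt0.
  have hm : h < m by rewrite /h; arith.
  move: (hm); rewrite /m !lt_min => /andP[/andP[h1 h2] /andP[hy ht]].
  (* The factors give both differences of ramps the final value 1, so that they cancel and [phi] has
     compact support. *)
  pose phi r := (y - x)^-1 * (1 * ramp x h r + (-1) * ramp y h r) +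
    (- (t - s)^-1) * (1 * ramp s h r + (-1) * ramp t h r).
  have sphi : smooth phi.
    by apply: smooth_lin; apply: smooth_lin; exact: ramp_smooth.
  have dphi r : phi^`()%classic r = (y - x)^-1 * step x y h r - (t - s)^-1 * step s t h r.
    have D z := @dramp z h r h0.
    apply: is_derive_derive1; rewrite /phi.
    eapply derE; first by eapply dD; (eapply dM; [exact: dcst|
      eapply dD; (eapply dM; [exact: dcst|exact: D])]).
    by rewrite /step /=; ring.
  have phi0 r : ~~ (Num.min x s <= r <= Num.max y t + h) -> phi r = 0.
    rewrite negb_and -!ltNge lt_min => /orP[/andP[rx rs]|].
      by rewrite /phi !ramp_left ?mulr0 ?addr0 //; arith.
    rewrite -ltrBrDr gt_max => /andP[ry rt].
    have E1 : ramp x h r - ramp y h r = y - x by apply: ramp_right => //; arith.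
    have E2 : ramp s h r - ramp t h r = t - s by apply: ramp_right => //; arith.
    by rewrite /phi !mul1r !mulN1r E1 E2 mulNr !mulVf ?subrr // gt_eqF.
  have := H phi (Num.min x s) (Num.max y t + h).
  rewrite lt_min ax as_ => /(_ isT).
  have -> : Num.min x s <= Num.max y t + h.
    by rewrite ge_min; apply/orP; left; have : y <= Num.max y t by [rewrite le_max lexx]; arith.
  have -> : Num.max y t + h < b by rewrite -ltrBrDr gt_max; apply/andP; split; arith.
  move=> /(_ isT isT sphi phi0).
  have cs z w := @step_cont R z w h.
  have i1 : mu.-integrable `[a, b] (EFin \o (fun r => step x y h r * f r)).
    by apply: integrable_contM => // r _ _; exact: cs.
  have i2 : mu.-integrable `[a, b] (EFin \o (fun r => step s t h r * f r)).
    by apply: integrable_contM => // r _ _; exact: cs.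
  have i3 : mu.-integrable `[a, b] (EFin \o (fun r => (y - x)^-1 * (step x y h r * f r))).
    by apply: integrable_contM => // r _ _; exact: cvg_cst.
  have i4 : mu.-integrable `[a, b] (EFin \o (fun r => (t - s)^-1 * (step s t h r * f r))).
    by apply: integrable_contM => // r _ _; exact: cvg_cst.
  have -> : \int[mu]_(r in `[a, b]) (phi^`()%classic r * f r) =
      \int[mu]_(r in `[a, b]) ((y - x)^-1 * (step x y h r * f r) - (t - s)^-1 * (step s t h r * f r)).
    by apply: eq_Rint => r _ _; rewrite dphi; ring.
  rewrite RintegralB // !RintegralZl //.
  move: (H1 h h0 h1) (H2 h h0 h2).
  move: (\int[mu]_(r in `[a, b]) (step x y h r * f r)) (\int[mu]_(r in `[a, b]) (step s t h r * f r))
    (\int[mu]_(r in `[x, y]) f r) (\int[mu]_(r in `[s, t]) f r) => A B X S.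
  move=> hA hB E.
  have -> : X / (y - x) - S / (t - s) = (B - S) / (t - s) - (A - X) / (y - x).
    have : A / (y - x) = B / (t - s).
      by apply/eqP; rewrite -subr_eq0 -[A / _]mulrC -[B / _]mulrC E.
    by rewrite !mulrBl => ->; ring.
  apply: le_trans (ler_normB _ _) _.
  have -> : e = e / 2 + e / 2 by arith.
  apply: lerD; rewrite normrM normfV.
    by rewrite (gtr0_norm ts0) ler_pdivrMr.
  by rewrite (gtr0_norm yx0) ler_pdivrMr.
(* A fixed reference interval inside []a, b[]; the average of [f] over it is the constant. *)
pose c1 := (2 * a + b) / 3; pose c2 := (a + 2 * b) / 3.
pose C := \int[mu]_(r in `[c1, c2]) f r / (c2 - c1).
exists C => x y ax xy yb.
have fxy : mu.-integrable `[x, y] (EFin \o f).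
  by apply: integrable_itvS fi; exact: ltW.
have icst z : mu.-integrable `[x, z] (EFin \o (fun=> C)).
  by apply: cont_integrable => r _ _; exact: cvg_cst.
have iz : mu.-integrable `[x, y] (EFin \o (fun r => f r - C)).
  exact: (integrableB _ fxy (icst y)).
have : {ae mu, forall t, `]x, y[%classic t -> f t - C = 0}.
  apply: (ae_zero iz) => z xz zy; move: xz; rewrite le_eqVlt => /predU1P[<-|xz].
    by rewrite set_itv1 Rintegral_set1.
  have fxz : mu.-integrable `[x, z] (EFin \o f).
    by apply: integrable_itvS fi; [exact: ltW|arith].
  rewrite RintegralB // Rint_cst; last exact: ltW.
  have z0 : z - x != 0 by rewrite subr_eq0 gt_eqF.
  have : (\int[mu]_(r in `[x, z]) f r) / (z - x) = C.
    by apply: avg => //; rewrite /c1 /c2; arith.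
  by move=> <-; rewrite divfK // subrr.
by apply: ae_imp => t h /h/eqP; rewrite subr_eq0 => /eqP.
Qed.

End DuBoisReymond.

(** * The minimizer solves the equation *)

Section MinimizerOde.
Variables (R : realType) (Rad : \bar R) (p q : R) (F u du v : R -> R).
Notation mu := (@lebesgue_measure R).
Local Notation I := (interval0 Rad).
Hypothesis hF : class_C1 F.
Hypotheses (hu : L2loc I u) (hdu : L2loc I du) (wd : weak_derivative I u du).
Hypothesis cv : forall r, I r -> {for r, continuous v}.
Hypothesis uv : ae_eq mu I u v.
Hypothesis hmin : forall a b : R, I a -> a <= b -> I b ->
  mu.-integrable `[a, b] (EFin \o energy_density p q F u du) /\
  forall phi : R -> R, test_function `]a, b[ phi ->
    (energy p q F u du `[a, b] <=
     energy p q F (u \+ phi)%R (du \+ phi^`()%classic)%R `[a, b])%E.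

Let cF : continuous F.
Proof. by move=> x; exact: (is_derive_continuous (derive1P (proj1 hF x))). Qed.

Local Notation force r := (r `^ p * (q / r ^+ 2 * v r + F (v r))).

(** With a primitive [P] of the force, integration by parts turns the weak equation into the
    hypothesis of [du_bois_reymond] for [r^p du - P]. Hence [du] is almost everywhere
    [W = (P + C) / r^p], which is differentiable. *)
Lemma minimizer_local a b : I a -> I b -> a < b -> exists W : R -> R,
  (forall x, a < x -> x < b -> is_derive x 1 W (q / x ^+ 2 * v x - p / x * W x + F (v x))) /\
  (forall x y, a < x -> x < y -> y < b -> ae_eq mu `[x, y] du W).
Proof.
move=> Ia Ib ab; have a0 := interval0_pos Ia.
have cf r : a <= r -> r <= b -> {for r, continuous (fun r => force r)}.
  exact: (cont_force hF cv Ia Ib).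
have [P dP] := local_primitive (ltW ab) cf.
have cP r (ar : a <= r) (rb : r <= b) := is_derive_continuous (dP r ar rb).
have cX r : a <= r -> {for r, continuous (fun r => r `^ p)}.
  by move=> ar; apply: cont_powR; exact: lt_le_trans ar.
have idu := L2loc_integrable hdu Ia Ib.
have iP : mu.-integrable `[a, b] (EFin \o P) by exact: cont_integrable.
have iX : mu.-integrable `[a, b] (EFin \o (fun r => r `^ p * du r)).
  by apply: integrable_contM => // r ar _; exact: cX.
have fi : mu.-integrable `[a, b] (EFin \o (fun r => r `^ p * du r - P r)).
  exact: (integrableB _ iX iP).
have [|C HC] := du_bois_reymond ab fi.
  move=> phi a' b' aa ab' bb sphi phi0.
  have EL := euler_lagrange_weak hF hu hdu cv uv hmin Ia Ib aa ab' bb sphi phi0.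
  have cphi1 : continuous phi^`()%classic by exact: smooth_cont (smooth_derive1 sphi).
  have D r : a <= r -> r <= b -> is_derive r 1 (fun r => P r * phi r)
      (P r * phi^`()%classic r + force r * phi r).
    move=> ar rb; have D1 := dP r ar rb; have D2 := smooth_der r sphi.
    eapply derE; first by eapply dM; [exact: D1|exact: D2].
    by cbv beta; ring.
  have cD r : a <= r -> r <= b ->
      {for r, continuous (fun r => P r * phi^`()%classic r + force r * phi r)}.
    move=> ar rb.
    apply: (@continuousD _ _ _ (fun r : R => P r * phi^`()%classic r)
      (fun r : R => force r * phi r)).
      by apply: (@continuousM _ _ P); [exact: cP|exact: cphi1].
    by apply: (@continuousM _ _ (fun r : R => force r)); [exact: cf|exact: smooth_cont].
  have := ftc2 (ltW ab) D cD.
  rewrite (phi0 a); last by rewrite negb_and -!ltNge aa.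
  rewrite (phi0 b); last by rewrite negb_and -!ltNge bb orbT.
  rewrite !mulr0 subrr => EP.
  have i1 : mu.-integrable `[a, b]
      (EFin \o (fun r => r `^ p * phi^`()%classic r * du r + force r * phi r)).
    have l1 : mu.-integrable `[a, b] (EFin \o (fun r => r `^ p * phi^`()%classic r * du r)).
      apply: integrable_contM idu => r ar rb.
      by apply: (@continuousM _ _ (fun r : R => r `^ p)); [exact: cX|exact: cphi1].
    have l2 : mu.-integrable `[a, b] (EFin \o (fun r => force r * phi r)).
      apply: cont_integrable => r ar rb.
      by apply: (@continuousM _ _ (fun r : R => force r)); [exact: cf|exact: smooth_cont].
    exact: (integrableD _ l1 l2).
  have i2 := cont_integrable cD.
  rewrite -[RHS](subrr (0 : R)) -{1}EL -EP -RintegralB //.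
  by apply: eq_Rint => r _ _; ring.
exists (fun r => (P r + C) / r `^ p); split.
  move=> x ax xb; have D1 := dP x (ltW ax) (ltW xb).
  have x0 : 0 < x by exact: lt_trans ax.
  have X0 : x `^ p != 0 by rewrite gt_eqF // powR_gt0.
  have D2 := dV (f := fun y : R => y `^ p) X0 (dpow p x0).
  eapply derE; first by eapply dM; [eapply dD; [exact: D1|exact: dcst]|exact: D2].
  by cbv beta; field; rewrite X0 gt_eqF.
move=> x y ax xy yb.
(* A larger open interval is used in order to cover the closed [[x, y]]. *)
have : {ae mu, forall t, `](a + x) / 2, (y + b) / 2[%classic t -> t `^ p * du t - P t = C}.
  by apply: HC; arith.
apply: ae_imp => t; rewrite /= !in_itv /= => H /andP[xt ty].
have t0 : 0 < t by arith.
rewrite -H; last by apply/andP; split; arith.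
by field; rewrite gt_eqF // powR_gt0.
Qed.

(** By [weak_derivative_ftc], [v] is up to a constant the integral of [du], hence that of the
    continuous function [W]. *)
Lemma minimizer_derive a b (W : R -> R) : I a -> I b ->
  (forall x, a < x -> x < b -> {for x, continuous W}) ->
  (forall x y, a < x -> x < y -> y < b -> ae_eq mu `[x, y] du W) ->
  forall x, a < x -> x < b -> is_derive x 1 v (W x).
Proof.
move=> Ia Ib cW duW x ax xb.
pose x1 := (a + x) / 2; pose x2 := (x + b) / 2.
have ax1 : a < x1 by rewrite /x1; arith.
have x1x : x1 < x by rewrite /x1; arith.
have xx2 : x < x2 by rewrite /x2; arith.
have x2b : x2 < b by rewrite /x2; arith.
have Iab r : a < r -> r < b -> I r.
  by move=> ar rb; exact: interval0_conv Ia Ib (ltW ar) (ltW rb).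
have cW' r : x1 <= r -> r <= x2 -> {for r, continuous W}.
  by move=> h1 h2; apply: cW; [exact: lt_le_trans ax1 h1|exact: le_lt_trans x2b].
have [Q dQ] := local_primitive (ltW (lt_trans x1x xx2)) cW'.
have E y : x1 < y -> y < x2 -> Q y + (v x1 - Q x1) = v y.
  move=> h1 h2; have yb : y < b by exact: lt_trans x2b.
  have ay : a < y by exact: lt_trans h1.
  have I1 : I x1 by apply: Iab => //; exact: lt_trans h1 yb.
  have Iy : I y by exact: Iab.
  have := weak_derivative_ftc hu hdu wd cv uv I1 Iy h1.
  have -> : \int[mu]_(t in `[x1, y]) du t = \int[mu]_(t in `[x1, y]) W t.
    apply: Rint_ae; [exact: (L2loc_measurable hdu)| |exact: duW].
    by apply: cont_measurable => r r1 r2; apply: cW'; arith.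
  rewrite (ftc2 (ltW h1) (fun r r1 r2 => dQ r r1 (le_trans r2 (ltW h2)))); first by arith.
  by move=> r r1 r2; apply: cW'; arith.
have D : is_derive x 1 (fun y => Q y + (v x1 - Q x1)) (W x).
  eapply derE; first by eapply dD; [exact: (dQ x (ltW x1x) (ltW xx2))|exact: dcst].
  by rewrite addr0.
apply: near_eq_is_derive D.
have n1 : \forall y \near x, x1 < y by exact: lt_nbhsr.
have n2 : \forall y \near x, y < x2 by exact: lt_nbhsl.
by apply: filterS2 n1 n2 => y; exact: E.
Qed.

(** The function [W] depends on the interval but equals the derivative of [v] on it, so the local
    equations fit together. *)
Lemma minimizer_ode : ode Rad p q F v v^`()%classic /\
  forall a b, I a -> I b -> ae_eq mu `[a, b] du v^`()%classic.
Proof.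
have key a b : I a -> I b -> a < b -> exists W : R -> R,
   (forall x, a < x -> x < b -> [/\ is_derive x 1 v (W x), v^`()%classic x = W x &
     is_derive x 1 W (q / x ^+ 2 * v x - p / x * W x + F (v x))]) /\
   (forall x y, a < x -> x < y -> y < b -> ae_eq mu `[x, y] du W).
  move=> Ia Ib ab; have [W [dW duW]] := minimizer_local Ia Ib ab.
  exists W; split=> // x ax xb.
  have cW y (ay : a < y) (yb : y < b) := is_derive_continuous (dW y ay yb).
  have D := minimizer_derive Ia Ib cW duW ax xb.
  by split; [exact: D|exact: is_derive_derive1 D|exact: dW].
split.
- move=> r Ir; have r0 := interval0_pos Ir.
  have Ia : I (r / 2) by apply: (interval0_left Ir); lra.
  have [b Ib rb] := interval0_right Ir.
  have ar : r / 2 < r by lra.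
  have [W [dW _]] := key _ b Ia Ib (lt_trans ar rb).
  have [D1 E D2] := dW r ar rb; rewrite E; split=> //.
  apply: near_eq_is_derive D2.
  have n1 : \forall y \near r, r / 2 < y by exact: lt_nbhsr.
  have n2 : \forall y \near r, y < b by exact: lt_nbhsl.
  by apply: filterS2 n1 n2 => y ay yb; have [_ ->] := dW y ay yb.
- move=> a b Ia Ib; have [ba|ab] := ltP b a.
    by rewrite set_itv_ge; [exact: aeW|rewrite bnd_simp -ltNge].
  have a0 := interval0_pos Ia.
  have Ia' : I (a / 2) by apply: (interval0_left Ia); lra.
  have [b' Ib' bb] := interval0_right Ib; have [b2 Ib2 bb2] := interval0_right Ib'.
  have aa : a / 2 < a by lra.
  have [W [dW duW]] := key _ b2 Ia' Ib2 (ltac:(lra)).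
  have := duW a b' aa (ltac:(lra)) bb2; apply: ae_imp => t H; move: (H).
  rewrite /= !in_itv /= => H' /andP[at_ tb].
  have [_ -> _] := dW t (ltac:(lra)) (ltac:(lra)).
  by apply: H'; apply/andP; split; lra.
Qed.

End MinimizerOde.

(** * Minimality against competitors with Lipschitz derivative *)

Section Competitors.
Variables (R : realType) (Rad : \bar R) (p q : R) (F u du v : R -> R).
Notation mu := (@lebesgue_measure R).
Local Notation I := (interval0 Rad).
Local Notation v1 := (v^`()%classic).
Hypothesis hF : class_C1 F.
Hypotheses (hu : L2loc I u) (hdu : L2loc I du) (wd : weak_derivative I u du).
Hypothesis cv : forall r, I r -> {for r, continuous v}.
Hypothesis uv : ae_eq mu I u v.
Hypothesis hmin : forall a b : R, I a -> a <= b -> I b ->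
  mu.-integrable `[a, b] (EFin \o energy_density p q F u du) /\
  forall phi : R -> R, test_function `]a, b[ phi ->
    (energy p q F u du `[a, b] <=
     energy p q F (u \+ phi)%R (du \+ phi^`()%classic)%R `[a, b])%E.

Let cF : continuous F.
Proof. by move=> x; exact: (is_derive_continuous (derive1P (proj1 hF x))). Qed.

(** Pointwise in the values [s] and [t] of a perturbation and of its derivative, hence the constant
    functions, which are not derivatives of one another. *)
Lemma gap_small (w dw : R -> R) (a b : R) : 0 < a ->
  (forall r, a <= r -> r <= b -> {for r, continuous w}) ->
  (forall r, a <= r -> r <= b -> {for r, continuous dw}) ->
  exists2 K : R, 0 < K & forall (e s t r : R), e <= 1 -> a <= r -> r <= b ->
    `|s| <= e -> `|t| <= e -> gap p q F w dw (fun=> s) (fun=> t) r <= K * e.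
Proof.
move=> a0 cw cdw.
have [B1 B10 HB1] := cont_bounded cw; have [B2 B20 HB2] := cont_bounded cdw.
have [m [M [m0 M0 HM]]] := powR_bounds p b a0.
have [L L0 HL] := C1_lipschitz (- (B1 + 1)) (B1 + 1) hF.
have [H H0 HH] : exists2 H : R, 0 < H & forall x, - B1 <= x -> x <= B1 -> `|F x| <= H.
  by apply: cont_bounded => x _ _; exact: cF.
pose Q := `|q| / a ^+ 2.
have Q0 : 0 <= Q by rewrite divr_ge0 // exprn_ge0 // ltW.
exists (M * ((2 * B2 + 1) + Q * (2 * B1 + 1) + (2 * H + 2 * L))).
  have Q1 : 0 <= Q * (2 * B1 + 1) by apply: mulr_ge0 => //; arith.
  by apply: mulr_gt0 => //; arith.
move=> e s t r e1 ar rb se te; have r0 : 0 < r by exact: lt_le_trans ar.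
have e0 : 0 <= e by exact: le_trans (normr_ge0 s) se.
have [_ XM] := HM r ar rb; have w1 := HB1 r ar rb; have w2 := HB2 r ar rb.
have X0 := powR_ge0 r p.
rewrite gapE //.
have -> : 2 * (r `^ p * t) * dw r + (r `^ p * t ^+ 2 + r `^ p *
   (q / r ^+ 2 * (s * (2 * w r + s)) + (potential F (w r + s) - potential F (w r)))) =
  r `^ p * (t * (2 * dw r + t) + q / r ^+ 2 * (s * (2 * w r + s)) +
    (potential F (w r + s) - potential F (w r))) by ring.
have h1 : t * (2 * dw r + t) <= (2 * B2 + 1) * e.
  apply: le_trans (ler_norm _) _; rewrite normrM mulrC; apply: ler_pM => //.
  by apply: le_trans (ler_normD _ _) _; rewrite normrM ger0_norm //; arith.
have h2 : q / r ^+ 2 * (s * (2 * w r + s)) <= Q * (2 * B1 + 1) * e.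
  apply: le_trans (ler_norm _) _; rewrite normrM -mulrA; apply: ler_pM => //.
    rewrite normrM normfV [X in _ / X]ger0_norm ?sqr_ge0 //.
    exact: le_divXn.
  rewrite normrM mulrC; apply: ler_pM => //.
  by apply: le_trans (ler_normD _ _) _; rewrite normrM ger0_norm //; arith.
have h3 : potential F (w r + s) - potential F (w r) <= (2 * H + 2 * L) * e.
  have c1 : `|w r| <= B1 + 1 by arith.
  have c2 : `|w r + s| <= B1 + 1 by apply: le_trans (ler_normD _ _) _; arith.
  apply: le_trans (potential_quad cF (ltW L0) HL c1 c2) _.
  have k1 : 2 * F (w r) * s <= 2 * H * e.
    apply: le_trans (ler_norm _) _; rewrite normrM; apply: ler_pM => //.
    rewrite normrM ger0_norm // ler_pM2l //.
    by move: w1; rewrite ler_norml => /andP[? ?]; exact: HH.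
  have k2 : 2 * L * s ^+ 2 <= 2 * L * e.
    rewrite ler_pM2l; last arith.
    rewrite -real_normK ?num_real // expr2 -[e]mul1r; apply: ler_pM => //.
    exact: le_trans e1.
  by arith.
apply: (@le_trans _ _ (r `^ p * (((2 * B2 + 1) + Q * (2 * B1 + 1) + (2 * H + 2 * L)) * e))).
  by apply: ler_wpM2l => //; arith.
rewrite -mulrA; apply: ler_wpM2r => //.
have Q1 : 0 <= Q * (2 * B1 + 1) by apply: mulr_ge0 => //; arith.
by apply: mulr_ge0 => //; arith.
Qed.

Lemma gap_shift (w dw eta eta1 phi phi1 : R -> R) r :
  gap p q F w dw phi phi1 r = gap p q F w dw eta eta1 r +
  gap p q F (w \+ eta) (dw \+ eta1) (fun=> phi r - eta r) (fun=> phi1 r - eta1 r) r.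
Proof.
rewrite /gap.
have -> : energy_density p q F ((w \+ eta) \+ (fun=> phi r - eta r))
    ((dw \+ eta1) \+ (fun=> phi1 r - eta1 r)) r =
    energy_density p q F (w \+ phi) (dw \+ phi1) r.
  have E (x y z : R) : x + y + (z - y) = x + z by ring.
  by rewrite /energy_density /= !E.
move: (energy_density _ _ _ _ _ _) (energy_density _ _ _ _ _ _) (energy_density _ _ _ _ _ _).
by move=> x y z; ring.
Qed.

(** [eta] is approximated together with its derivative by test functions. By [gap_shift] and
    [gap_small] the increment of energy changes by as little as desired. *)
Lemma minimizer_gap_ge0 (eta eta1 : R -> R) (a b L : R) : I a -> I b -> a < b ->
  (forall x : R, is_derive x 1 eta (eta1 x)) ->
  (forall x, ~~ (a < x < b) -> eta x = 0 /\ eta1 x = 0) ->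
  (forall x y, a <= x -> x <= b -> a <= y -> y <= b -> `|eta1 x - eta1 y| <= L * `|x - y|) ->
  continuous eta1 ->
  0 <= \int[mu]_(r in `[a, b]) gap p q F v v1 eta eta1 r.
Proof.
move=> Ia Ib ab deta eta0 etaL ceta1.
have [hode duv] := minimizer_ode hF hu hdu wd cv uv hmin.
have a0 := interval0_pos Ia.
(* The support of the approximation may touch [a] and [b], so it is a test function only on a
   slightly larger open interval. *)
have Ia' : I (a / 2) by apply: (interval0_left Ia); arith.
have [b' Ib' bb] := interval0_right Ib.
set a' := a / 2 in Ia'; have aa : a' < a by rewrite /a'; arith.
have a'0 := interval0_pos Ia'.
have ab' : a' <= b' by arith.
have cv' r : a' <= r -> r <= b' -> {for r, continuous v}.
  by move=> ar rb; apply: cv; exact: interval0_conv Ia' Ib' ar rb.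
have cv1 r : a' <= r -> r <= b' -> {for r, continuous v1}.
  by move=> ar rb; apply: (ode_cont1 hode); exact: interval0_conv Ia' Ib' ar rb.
have ceta r : {for r, continuous eta} by exact: is_derive_continuous (deta r).
have cw r : a' <= r -> r <= b' -> {for r, continuous (v \+ eta)}.
  by move=> ar rb; apply: continuousD; [exact: cv'|exact: ceta].
have cdw r : a' <= r -> r <= b' -> {for r, continuous (v1 \+ eta1)}.
  by move=> ar rb; apply: continuousD; [exact: cv1|exact: ceta1].
have [K K0 HK] := gap_small a'0 cw cdw.
have iv1 := cont_integrable cv1.
have ieta : mu.-integrable `[a', b'] (EFin \o gap p q F v v1 eta eta1).
  by apply: gap_integrable => // r _ _; exact: ceta1.
have abab : `[a, b] `<=` (`[a', b'] : set R).
  by move=> x /=; rewrite !in_itv /= => /andP[? ?]; apply/andP; split; arith.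
have -> : \int[mu]_(r in `[a, b]) gap p q F v v1 eta eta1 r =
    \int[mu]_(r in `[a', b']) gap p q F v v1 eta eta1 r.
  rewrite (Rint_support _ abab) // => x _ h.
  have [] := eta0 x; first by apply: contra h => /andP[h1 h2]; rewrite !ltW.
  by rewrite /gap /energy_density /= => -> ->; rewrite !addr0 subrr.
apply/ler_addgt0Pr => d d0.
have C0 : 0 < K * (b' - a') by rewrite mulr_gt0 //; arith.
pose e := Num.min 1 (d / (K * (b' - a'))).
have e0 : 0 < e by rewrite lt_min ltr01 divr_gt0.
have e1 : e <= 1 by rewrite ge_min lexx.
have ed : K * e * (b' - a') <= d.
  have : e <= d / (K * (b' - a')) by rewrite ge_min lexx orbT.
  by rewrite ler_pdivlMr // => h; arith.
have [phi [sphi phi0 phi_eta phi1_eta]] := test_function_approx ab e0 deta eta0 etaL.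
have tphi : test_function `]a', b'[ phi.
  apply: (smooth_test_function (a := a) (b := b) sphi).
    by move=> x /=; rewrite !in_itv /= => /andP[? ?]; apply/andP; split; arith.
  by move=> x h; apply: phi0; apply: contra h => /andP[h1 h2]; rewrite !ltW.
have := gap_minimizer_ge0 hF hu hdu cv uv hmin Ia' ab' Ib' sphi tphi.
have ig := gap_minimizer_integrable p q hF hdu cv Ia' Ib' sphi.
have ig1 : mu.-integrable `[a', b'] (EFin \o gap p q F v v1 phi phi^`()%classic).
  apply: (gap_integrable p q cF a'0 iv1 cv') => r _ _; first exact: smooth_cont.
  exact: smooth_cont (smooth_derive1 sphi) _.
have -> : \int[mu]_(r in `[a', b']) gap p q F v du phi phi^`()%classic r =
    \int[mu]_(r in `[a', b']) gap p q F v v1 phi phi^`()%classic r.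
  apply: Rint_ae.
  - by apply/measurable_EFinP; exact: measurable_int ig.
  - by apply/measurable_EFinP; exact: measurable_int ig1.
  - move: (duv a' b' Ia' Ib'); apply: ae_imp => r + rab => /(_ rab) E.
    by rewrite /gap /energy_density /= E.
have icst : mu.-integrable `[a', b'] (EFin \o (fun=> K * e)).
  by apply: cont_integrable => r _ _; exact: cvg_cst.
have is2 : mu.-integrable `[a', b'] (EFin \o (fun r => gap p q F v v1 eta eta1 r + K * e)).
  exact: (integrableD _ ieta icst).
have le : \int[mu]_(r in `[a', b']) gap p q F v v1 phi phi^`()%classic r <=
    \int[mu]_(r in `[a', b']) (gap p q F v v1 eta eta1 r + K * e).
  apply: Rint_le => // r ar rb.
  have := HK e (phi r - eta r) (phi^`()%classic r - eta1 r) r e1 ar rb (phi_eta r) (phi1_eta r).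
  have -> : gap p q F v v1 phi phi^`()%classic r = gap p q F v v1 eta eta1 r +
     gap p q F (v \+ eta) (v1 \+ eta1) (fun=> phi r - eta r)
       (fun=> phi^`()%classic r - eta1 r) r.
    exact: gap_shift.
  by arith.
move=> /le_trans/(_ le); rewrite RintegralD // Rint_cst //.
by move=> /le_trans; apply; rewrite lerD2l.
Qed.

End Competitors.

(** * Exchange of two solutions across a cutoff *)

Section Pointwise.
Variables (R : realType) (p q : R) (F : R -> R).
Hypothesis cF : continuous F.
Implicit Types v w th : R -> R.

(* Where [th = 1], the competitors [v - th (v - w)] and [w + th (v - w)] are [v] and [w]
   exchanged. *)
Definition exchange_gap v (v1 : R -> R) w (w1 : R -> R) th (th1 : R -> R) (r : R) : R :=
  gap p q F v v1 (fun x => - (th x * (v x - w x)))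
    (fun x => - (th1 x * (v x - w x) + th x * (v1 x - w1 x))) r +
  gap p q F w w1 (fun x => th x * (v x - w x))
    (fun x => th1 x * (v x - w x) + th x * (v1 x - w1 x)) r.

Lemma exchange_gap_one v (v1 : R -> R) w (w1 : R -> R) th (th1 : R -> R) r :
  th r = 1 -> th1 r = 0 -> exchange_gap v v1 w w1 th th1 r = 0.
Proof.
move=> h1 h2; rewrite /exchange_gap /gap /energy_density /= h1 h2.
have E1 (x y : R) : x - 1 * (x - y) = y by ring.
have E2 (x y : R) : y + 1 * (x - y) = x by ring.
have E3 (x y z : R) : x - (0 * z + 1 * (x - y)) = y by ring.
have E4 (x y z : R) : y + (0 * z + 1 * (x - y)) = x by ring.
rewrite !E1 !E2 !E3 !E4.
have E5 (x y : R) : x - y + (y - x) = 0 by ring.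
exact: E5.
Qed.

Lemma totalE v (v1 : R -> R) w (w1 : R -> R) th (th1 : R -> R) r : 0 < r ->
  let d := v r - w r in let d1 := v1 r - w1 r in let z := v r - th r * d in
  let y := w r + th r * d in
  exchange_gap v v1 w w1 th th1 r = r `^ p *
    (((v1 r - (th1 r * d + th r * d1)) ^+ 2 + q / r ^+ 2 * z ^+ 2 + potential F z) +
     ((w1 r + (th1 r * d + th r * d1)) ^+ 2 + q / r ^+ 2 * y ^+ 2 + potential F y) -
     (v1 r ^+ 2 + q / r ^+ 2 * v r ^+ 2 + potential F (v r)) -
     (w1 r ^+ 2 + q / r ^+ 2 * w r ^+ 2 + potential F (w r))).
Proof.
move=> r0 d d1 z y; rewrite /exchange_gap /gap !energy_densityE //= -/d -/d1 -/z -/y.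
by move: (potential F z) (potential F y) (potential F (v r)) (potential F (w r)) => *; ring.
Qed.

(** The derivative of the potential is [2 F], so convexity follows from its tangent at the
    intermediate point [m], which lies below the graph on [[a, b]]. *)
Lemma potential_convex (a b t x y : R) :
  (forall s u, a <= s -> s <= u -> u <= b -> F s <= F u) ->
  a <= x -> x <= b -> a <= y -> y <= b -> 0 <= t -> t <= 1 ->
  potential F (x - t * (x - y)) <= (1 - t) * potential F x + t * potential F y.
Proof.
move=> Fm ax xb ay yb t0 t1; set m := x - t * (x - y).
have D (s : R) : is_derive s 1 (potential F) (2 * F s) by exact: dpotential.
have am : a <= m.
  have : 0 <= (1 - t) * (x - a) + t * (y - a) by rewrite addr_ge0 // mulr_ge0 // subr_ge0.
  by rewrite /m; arith.
have mb : m <= b.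
  have : 0 <= (1 - t) * (b - x) + t * (b - y) by rewrite addr_ge0 // mulr_ge0 // subr_ge0.
  by rewrite /m; arith.
have tang s : a <= s -> s <= b -> potential F m + 2 * F m * (s - m) <= potential F s.
  move=> as_ sb; have [sm|ms|->] := ltgtP s m; last by rewrite subrr mulr0 addr0.
    have [c [sc cm E]] := mvt sm (fun x _ _ => D x).
    have Fc : F c <= F m by apply: Fm; arith.
    have : 0 <= (F m - F c) * (m - s) by rewrite mulr_ge0; arith.
    by move: E; arith.
  have [c [mc cs E]] := mvt ms (fun x _ _ => D x).
  have Fc : F m <= F c by apply: Fm; arith.
  have : 0 <= (F c - F m) * (s - m) by rewrite mulr_ge0; arith.
  by move: E; arith.
have hx : 0 <= (1 - t) * (potential F x - (potential F m + 2 * F m * (x - m))).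
  by apply: mulr_ge0; [arith|rewrite subr_ge0; exact: tang].
have hy : 0 <= t * (potential F y - (potential F m + 2 * F m * (y - m))).
  by apply: mulr_ge0 => //; rewrite subr_ge0; exact: tang.
rewrite -subr_ge0; move: (addr_ge0 hx hy).
move: (potential F x) (potential F y) (potential F m) (F m) => X Y M f.
have -> : (1 - t) * (X - (M + 2 * f * (x - m))) + t * (Y - (M + 2 * f * (y - m))) =
  (1 - t) * X + t * Y - M by rewrite /m; ring.
by [].
Qed.

(** The new pair consists of the convex combinations of [v] and [w] with weights [th] and [1 - th]
    in both orders. Each convex term of the energy decreases in total, and only terms containing
    [th1] can be positive. *)
Lemma exchange_gap_convex v (v1 : R -> R) w (w1 : R -> R) th (th1 : R -> R) a b r : 0 < r -> 0 <= q ->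
  (forall s u, a <= s -> s <= u -> u <= b -> F s <= F u) ->
  a <= v r -> v r <= b -> a <= w r -> w r <= b -> 0 <= th r -> th r <= 1 ->
  exchange_gap v v1 w w1 th th1 r <= 2 * r `^ p *
    ((th1 r * (v r - w r)) ^+ 2 + `|th1 r * (v r - w r)| * `|v1 r - w1 r|).
Proof.
move=> r0 q0 Fm av vb aw wb t0 t1; rewrite totalE //=.
have h1 := potential_convex Fm av vb aw wb t0 t1.
have h2 := potential_convex Fm aw wb av vb t0 t1.
have E : w r + th r * (v r - w r) = w r - th r * (w r - v r) by ring.
rewrite {2}E in h2 *; rewrite -E in h2 *.
set P := potential F (v r - _) in h1 *; set Q := potential F (w r + _) in h2 *.
set g := th1 r * (v r - w r); set d1 := v1 r - w1 r.
have -> (X Y : R) : 2 * X * Y = X * (2 * Y) by ring.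
apply: ler_wpM2l; first exact: powR_ge0.
set t := th r in t0 t1 h1 h2 *; set s := q / r ^+ 2.
have s0 : 0 <= s by rewrite divr_ge0 // sqr_ge0.
have tt : 0 <= t * (1 - t) by rewrite mulr_ge0 // subr_ge0.
have k1 : 0 <= t * (1 - t) * s * (v r - w r) ^+ 2.
  by apply: mulr_ge0; [exact: mulr_ge0|exact: sqr_ge0].
have k2 : 0 <= t * (1 - t) * d1 ^+ 2 by apply: mulr_ge0 => //; exact: sqr_ge0.
have k3 : (2 * t - 1) * (g * d1) <= `|g| * `|d1|.
  apply: le_trans (ler_norm _) _; rewrite normrM normrM ler_piMl ?mulr_ge0 //.
  by rewrite ler_norml; apply/andP; split; arith.
have -> : (v1 r - (g + t * d1)) ^+ 2 + s * (v r - t * (v r - w r)) ^+ 2 + P +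
  ((w1 r + (g + t * d1)) ^+ 2 + s * (w r + t * (v r - w r)) ^+ 2 + Q) -
  (v1 r ^+ 2 + s * v r ^+ 2 + potential F (v r)) -
  (w1 r ^+ 2 + s * w r ^+ 2 + potential F (w r)) =
  2 * (g ^+ 2 + (2 * t - 1) * (g * d1)) - 2 * (t * (1 - t) * d1 ^+ 2) -
  2 * (t * (1 - t) * s * (v r - w r) ^+ 2) +
  (P + Q - potential F (v r) - potential F (w r)) by rewrite /d1; ring.
have hPQ : P + Q - potential F (v r) - potential F (w r) <= 0 by arith.
arith.
Qed.

Lemma sqr_sum3 (x y z : R) : (x + y + z) ^+ 2 <= 3 * (x ^+ 2 + y ^+ 2 + z ^+ 2).
Proof.
have -> : 3 * (x ^+ 2 + y ^+ 2 + z ^+ 2) =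
  (x + y + z) ^+ 2 + ((x - y) ^+ 2 + (y - z) ^+ 2 + (x - z) ^+ 2) by ring.
by rewrite lerDl !addr_ge0 // sqr_ge0.
Qed.

Lemma sqr_contract (t x : R) : 0 <= t -> t <= 1 -> (t * x) ^+ 2 <= x ^+ 2.
Proof.
move=> t0 t1; rewrite exprMn ler_piMl ?sqr_ge0 // expr_le1 //.
Qed.

(** Arithmetic of [exchange_gap_singular]: [A] and [B] are the squared derivatives of the two
    functions, [b] half of their singular terms, [G] the square of the term with [th1], [c = k / q],
    and [sv], [hv] the singular term and the potential of [v]. *)
Lemma singular_bound (X1 S H A B G b c hv sv : R) :
  X1 <= 3 * (A + B + G) -> G <= 4 * (c * b) -> S <= 4 * b -> H <= 2 * b \/ H <= hv ->
  0 <= A -> 0 <= B -> 0 <= b -> 0 <= c -> 0 <= sv + hv -> 0 <= sv ->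
  X1 + S + H <= (9 + 12 * c) * (A + B + b) + (A + sv + hv).
Proof.
move=> h1 h2 h3 h4 A0 B0 b0 c0 E0 s0.
have cA : 0 <= c * A by exact: mulr_ge0.
have cB : 0 <= c * B by exact: mulr_ge0.
have -> : (9 + 12 * c) * (A + B + b) = 9 * (A + B + b) + 12 * (c * A) + 12 * (c * B) +
  12 * (c * b) by ring.
by case: h4 => h4; arith.
Qed.

Lemma exchange_gap_bound (X Y EV EW M N : R) : X <= M * N + EV -> Y <= M * N + EV ->
  M * N <= M * (EV + EW) -> 0 <= EW -> X + Y - EV - EW <= (2 * M + 1) * (EV + EW).
Proof.
have -> : (2 * M + 1) * (EV + EW) = 2 * (M * (EV + EW)) + EV + EW by ring.
by move=> *; arith.
Qed.

(** Since [L <= q / (2 r^2)], each energy density controls the squared derivative and half of the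
    singular term, and these control the slope term [th1 (v - w)] as [th1^2 <= k / r^2]. The
    potential of a competitor is either quadratically small or below that of [v], which may be
    unbounded. *)
Lemma exchange_gap_singular v (v1 : R -> R) w (w1 : R -> R) th (th1 : R -> R) (k L r : R) :
  0 < r -> 0 < q -> 0 <= k -> L * r ^+ 2 <= q / 2 ->
  0 <= th r -> th r <= 1 -> th1 r ^+ 2 <= k / r ^+ 2 ->
  (forall t, - (L * t ^+ 2) <= potential F t) ->
  (forall t, 0 <= t -> t <= 1 -> let z := v r - t * (v r - w r) in
    potential F z <= L * z ^+ 2 \/ potential F z <= potential F (v r)) ->
  exchange_gap v v1 w w1 th th1 r <= (2 * (3 + 6 * (2 * k + q) / q) + 1) *
    (energy_density p q F v v1 r + energy_density p q F w w1 r).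
Proof.
move=> r0 q0 k0 Lr t0 t1 hk lo up; rewrite totalE //= !energy_densityE //.
rewrite -mulrDr [leRHS]mulrCA; apply: ler_wpM2l; first exact: powR_ge0.
have s0' : 0 <= 1 - th r by rewrite subr_ge0.
have s1' : 1 - th r <= 1 by rewrite gerBl.
have r2 : 0 < r ^+ 2 by rewrite exprn_gt0.
set s := q / r ^+ 2; have s0 : 0 < s by rewrite divr_gt0.
have Ls : L <= s / 2 by rewrite /s mulrAC ler_pdivlMr.
have ks : th1 r ^+ 2 <= k / q * s by rewrite /s mulrA divfK ?gt_eqF.
(* The second competitor [w + th (v - w)] is [v - (1 - th) (v - w)], so the hypothesis on the
   segment serves for both. *)
have upt := up (th r) t0 t1.
have upt' := up (1 - th r) s0' s1'.
have Ey : v r - (1 - th r) * (v r - w r) = w r + th r * (v r - w r) by ring.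
rewrite /= in upt upt'; rewrite Ey in upt'.
have lov := lo (v r); have low := lo (w r).
set g := th1 r * (v r - w r).
set V2 := v r ^+ 2 in lov *; set W2 := w r ^+ 2 in low *.
have V0 : 0 <= V2 by exact: sqr_ge0.
have W0 : 0 <= W2 by exact: sqr_ge0.
have dd : (v r - w r) ^+ 2 <= 2 * V2 + 2 * W2.
  have -> : 2 * V2 + 2 * W2 = (v r - w r) ^+ 2 + (v r + w r) ^+ 2 by rewrite /V2 /W2; ring.
  by rewrite lerDl sqr_ge0.
have gg : g ^+ 2 <= k / q * s * (2 * V2 + 2 * W2).
  by rewrite exprMn; apply: ler_pM => //; exact: sqr_ge0.
have z2 (t : R) : 0 <= t -> t <= 1 -> (v r - t * (v r - w r)) ^+ 2 <= 2 * V2 + 2 * W2.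
  move=> h0 h1.
  have h0' : 0 <= 1 - t by rewrite subr_ge0.
  have h1' : 1 - t <= 1 by rewrite gerBl.
  have e1 := sqr_contract (v r) h0' h1'.
  have e2 := sqr_contract (w r) h0 h1.
  have -> : v r - t * (v r - w r) = (1 - t) * v r + t * w r by ring.
  have := sqr_ge0 ((1 - t) * v r - t * w r); rewrite -/V2 -/W2 in e1 e2 *.
  have -> : ((1 - t) * v r + t * w r) ^+ 2 = 2 * ((1 - t) * v r) ^+ 2 + 2 * (t * w r) ^+ 2 -
    ((1 - t) * v r - t * w r) ^+ 2 by ring.
  by arith.
have y2 := z2 (1 - th r) s0' s1'; rewrite Ey in y2.
have {}z2 := z2 (th r) t0 t1.
have a1 : (v1 r - (g + th r * (v1 r - w1 r))) ^+ 2 <= 3 * (v1 r ^+ 2 + w1 r ^+ 2 + g ^+ 2).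
  have e1 := sqr_contract (v1 r) s0' s1'.
  have e2 := sqr_contract (w1 r) t0 t1.
  have -> : v1 r - (g + th r * (v1 r - w1 r)) =
    (1 - th r) * v1 r + th r * w1 r + (- g) by ring.
  apply: le_trans (sqr_sum3 _ _ _) _; rewrite sqrrN.
  by rewrite ler_pM2l // !lerD2r lerD.
have a2 : (w1 r + (g + th r * (v1 r - w1 r))) ^+ 2 <= 3 * (v1 r ^+ 2 + w1 r ^+ 2 + g ^+ 2).
  have e1 := sqr_contract (w1 r) s0' s1'.
  have e2 := sqr_contract (v1 r) t0 t1.
  have -> : w1 r + (g + th r * (v1 r - w1 r)) =
    (1 - th r) * w1 r + th r * v1 r + g by ring.
  apply: le_trans (sqr_sum3 _ _ _) _.
  by rewrite ler_pM2l // lerD2r addrC lerD.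
move: a1 a2 y2 z2 upt upt' lov low gg.
move: (v1 r - _) (w1 r + _) (v r - _) (w r + _) => z1 y1 z y a1 a2 y2 z2 upt upt' lov low gg.
set A := v1 r ^+ 2 in a1 a2 *; set B := w1 r ^+ 2 in a1 a2 *.
have A0 : 0 <= A by exact: sqr_ge0.
have B0 : 0 <= B by exact: sqr_ge0.
set N := A + B + s / 2 * (V2 + W2).
have half (X Y P : R) : - (L * Y) <= P -> L * Y <= s / 2 * Y -> X + s / 2 * Y <= X + s * Y + P.
  by clear; have -> : s / 2 * Y = s * Y / 2 by [ring]; arith.
have Ev : A + s / 2 * V2 <= A + s * V2 + potential F (v r).
  by apply: half => //; apply: ler_wpM2r.
have Ew : B + s / 2 * W2 <= B + s * W2 + potential F (w r).
  by apply: half => //; apply: ler_wpM2r.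
have s20 : 0 <= s / 2 by rewrite divr_ge0 // ltW.
have sV : 0 <= s / 2 * V2 by exact: mulr_ge0.
have sW : 0 <= s / 2 * W2 by exact: mulr_ge0.
have kin (x1 x : R) : x1 ^+ 2 <= 3 * (A + B + g ^+ 2) -> x ^+ 2 <= 2 * V2 + 2 * W2 ->
    potential F x <= L * x ^+ 2 \/ potential F x <= potential F (v r) ->
    x1 ^+ 2 + s * x ^+ 2 + potential F x <= (3 + 6 * (2 * k + q) / q) * N +
      (A + s * V2 + potential F (v r)).
  move=> hx1 hx hpot.
  have sx : s * x ^+ 2 <= s * (2 * V2 + 2 * W2) by apply: ler_wpM2l => //; exact: ltW.
  have Lx : L * x ^+ 2 <= s / 2 * (2 * V2 + 2 * W2).
    apply: (@le_trans _ _ (s / 2 * x ^+ 2)); first by apply: ler_wpM2r => //; exact: sqr_ge0.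
    by apply: ler_wpM2l.
  have -> : 3 + 6 * (2 * k + q) / q = 9 + 12 * (k / q) by field; rewrite gt_eqF.
  apply: (@singular_bound _ _ _ _ _ (g ^+ 2)) => //.
  - by apply: le_trans gg _; rewrite le_eqVlt; apply/orP; left; apply/eqP; field; rewrite gt_eqF.
  - by apply: le_trans sx _; rewrite le_eqVlt; apply/orP; left; apply/eqP; field.
  - case: hpot => hp; [left|by right]; apply: le_trans hp (le_trans Lx _).
    by rewrite le_eqVlt; apply/orP; left; apply/eqP; field.
  - by rewrite mulrDr addr_ge0.
  - by rewrite divr_ge0 // ltW.
  - by clear -Ev sV; arith.
  - by clear -sV; arith.
have H1 := kin z1 z a1 z2 upt; have H2 := kin y1 y a2 y2 upt'.
have NE : N <= A + s * V2 + potential F (v r) + (B + s * W2 + potential F (w r)).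
  rewrite /N mulrDr; apply: le_trans (lerD Ev Ew).
  by rewrite le_eqVlt; apply/orP; left; apply/eqP; ring.
set M := 3 + 6 * (2 * k + q) / q in H1 H2 *.
have M0 : 0 <= M.
  by rewrite /M addr_ge0 // divr_ge0 ?(ltW q0) // mulr_ge0 // addr_ge0 ?mulr_ge0 // ltW.
apply: exchange_gap_bound H1 H2 (ler_wpM2l M0 NE) _.
by apply: le_trans Ew; rewrite addr_ge0.
Qed.

End Pointwise.

(** * The cutoff and the perturbation it defines *)

Section Cutoff.
Variable R : realType.
Implicit Types a b c t : R.

(** Rises on [[a, 2 a]], where its slope is then of order [1 / t] like the square root of the
    singular coefficient, and falls on [[b, b + c]]. *)
Definition cutoff a b c t : R := sigma ((t - a) / a) - sigma ((t - b) / c).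
Definition dcutoff a b c t : R := kernel a a t - kernel b c t.

Lemma cutoff_smooth a b c : smooth (cutoff a b c).
Proof.
have s x h := smooth_affine (a := x) (b := h) (@sigma_smooth R).
have := @smooth_lin R 1 (-1) _ _ (s a a) (s b c).
by congr smooth; apply/funext => t; rewrite /cutoff; ring.
Qed.

Lemma dcutoffP a b c t : is_derive t 1 (cutoff a b c) (dcutoff a b c t).
Proof. by eapply dD; [exact: dsigma_affine|eapply dN; exact: dsigma_affine]. Qed.

Lemma cutoff_out a b c t : 0 < a -> 2 * a <= b -> 0 < c -> ~~ (a < t < b + c) ->
  cutoff a b c t = 0 /\ dcutoff a b c t = 0.
Proof.
move=> a0 ab c0; rewrite negb_and -!leNgt /cutoff /dcutoff => /orP[ta|bt].
  by rewrite !sigma_left ?kernel_left ?subrr //; arith.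
by rewrite !sigma_right ?kernel_right ?subrr //; arith.
Qed.

Lemma cutoff_in a b c t : 0 < a -> 0 < c -> 2 * a <= t -> t <= b ->
  cutoff a b c t = 1 /\ dcutoff a b c t = 0.
Proof.
move=> a0 c0 at_ tb; rewrite /cutoff /dcutoff.
rewrite [sigma ((t - a) / a)]sigma_right //; last by arith.
rewrite [sigma ((t - b) / c)]sigma_left // [kernel a a t]kernel_right //; last by arith.
by rewrite [kernel b c t]kernel_left // !subr0.
Qed.

Lemma cutoff_bounds a b c t : 0 < a -> 2 * a <= b -> 0 < c -> 0 <= cutoff a b c t <= 1.
Proof.
move=> a0 ab c0; rewrite /cutoff.
have s0 := sigma_ge0 ((t - a) / a); have s1 := sigma_le1 ((t - a) / a).
have s2 := sigma_ge0 ((t - b) / c); have s3 := sigma_le1 ((t - b) / c).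
have [tb|bt] := leP t b.
  by rewrite [sigma ((t - b) / c)]sigma_left // subr0 s0.
by rewrite [sigma ((t - a) / a)]sigma_right //; [apply/andP; split; arith|arith].
Qed.

Lemma dcutoff_bound : exists2 K : R, 0 < K & forall a b c t, 0 < a -> 2 * a <= b -> 0 < c ->
  (t <= 2 * a -> `|dcutoff a b c t| <= K / a) /\ (b <= t -> `|dcutoff a b c t| <= K / c).
Proof.
have [K K0 HK] := bump_bounded R; exists K => // a b c t a0 ab c0.
have k x h : 0 < h -> `|kernel x h t| <= K / h.
  by move=> h0; rewrite ger0_norm ?kernel_ge0 // /kernel ler_pM2r ?invr_gt0.
split=> ht; rewrite /dcutoff.
  by rewrite [kernel b c t]kernel_left ?subr0; [exact: k| |]; arith.
by rewrite [kernel a a t]kernel_right ?sub0r ?normrN; [exact: k| |]; arith.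
Qed.

End Cutoff.

Section CutoffCompetitor.
Variables (R : realType) (Rad : \bar R) (p q : R) (F v v1 w w1 : R -> R).
Local Notation I := (interval0 Rad).
Hypothesis cF : continuous F.
Hypotheses (hv : ode Rad p q F v v1) (hw : ode Rad p q F w w1).
Variables (a b c : R).
Hypotheses (a0 : 0 < a) (ab : 2 * a <= b) (c0 : 0 < c) (Ibc : I (b + c)).

Definition cut_diff (t : R) : R := cutoff a b c t * (v t - w t).
Definition dcut_diff (t : R) : R :=
  dcutoff a b c t * (v t - w t) + cutoff a b c t * (v1 t - w1 t).

Lemma cut_diff_out t : ~~ (a < t < b + c) -> cut_diff t = 0 /\ dcut_diff t = 0.
Proof.
move=> /(cutoff_out a0 ab c0)[h1 h2].
by rewrite /cut_diff /dcut_diff h1 h2 !mul0r addr0.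
Qed.

Lemma near_out t : ~ I t -> \forall y \near t, ~~ (a < y < b + c).
Proof.
move=> nI; have [ta|ta] := ltP t a.
  have : \forall y \near t, y < a by exact: lt_nbhsl.
  by apply: filterS => y ya; rewrite negb_and -leNgt ltW.
have [tb|tb] := ltP (b + c) t.
  have : \forall y \near t, b + c < y by exact: lt_nbhsr.
  by apply: filterS => y yb; rewrite negb_and -[~~ (y < b + c)]leNgt (ltW yb) orbT.
by case: nI; apply: (interval0_left Ibc) => //; exact: lt_le_trans ta.
Qed.

(** Nothing is known of [v] and [w] outside [I], but near such points the cutoff vanishes
    identically. *)
Lemma dcut_diffP (t : R) : is_derive t 1 cut_diff (dcut_diff t).
Proof.
have [It|nI] := pselect (I t).
  have [D1 _] := hv It; have [D2 _] := hw It; have D3 := dcutoffP a b c t.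
  eapply derE; first by eapply dM; [exact: D3|eapply dD; [exact: D1|eapply dN; exact: D2]].
  by cbv beta; rewrite /dcut_diff; ring.
have n := near_out nI.
have [_ ->] := cut_diff_out (nbhs_singleton n).
apply: near_eq_is_derive (dcst 0 t).
by apply: filterS n => y /cut_diff_out[-> _].
Qed.

Let d2cut_diff t := (dcutoff a b c)^`()%classic t * (v t - w t) +
  2 * (dcutoff a b c t * (v1 t - w1 t)) + cutoff a b c t *
  (q / t ^+ 2 * v t - p / t * v1 t + F (v t) - (q / t ^+ 2 * w t - p / t * w1 t + F (w t))).

Let dcutoffE : dcutoff a b c = (cutoff a b c)^`()%classic.
Proof. by apply/funext => t; rewrite (is_derive_derive1 (dcutoffP a b c t)). Qed.

Let d2cut_diffP (t : R) : I t -> is_derive t 1 dcut_diff (d2cut_diff t).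
Proof.
move=> It; have [D1 D11] := hv It; have [D2 D22] := hw It; have D3 := dcutoffP a b c t.
have D4 : is_derive t 1 (dcutoff a b c) ((dcutoff a b c)^`()%classic t).
  by rewrite dcutoffE; exact: (smooth_der t (smooth_derive1 (@cutoff_smooth R a b c))).
eapply derE; first by eapply dD; (eapply dM; [first [exact: D3|exact: D4]|
  eapply dD; [first [exact: D1|exact: D11]|eapply dN; first [exact: D2|exact: D22]]]).
by rewrite /d2cut_diff; cbv beta; ring.
Qed.

Lemma dcut_diff_cont : continuous dcut_diff.
Proof.
move=> t; have [It|nI] := pselect (I t).
  exact: is_derive_continuous (d2cut_diffP It).
have n := near_out nI.
have [_ z] := cut_diff_out (nbhs_singleton n).
apply: (@is_derive_continuous _ _ _ 0).
apply: near_eq_is_derive (dcst 0 t).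
by apply: filterS n => y /cut_diff_out[_ ->].
Qed.

(** The equations of [v] and [w] provide a continuous second derivative on the compact interval. *)
Lemma dcut_diff_lipschitz : exists L, forall x y, a <= x -> x <= b + c -> a <= y -> y <= b + c ->
  `|dcut_diff x - dcut_diff y| <= L * `|x - y|.
Proof.
have Iab t : a <= t -> t <= b + c -> I t.
  by move=> at_ tb; apply: (interval0_left Ibc) => //; exact: lt_le_trans at_.
have cd t : I t -> {for t, continuous d2cut_diff}.
  move=> It; have t0 := interval0_pos It.
  have cv := ode_cont hv It; have cw := ode_cont hw It.
  have cv1 := ode_cont1 hv It; have cw1 := ode_cont1 hw It.
  have cF2 f : {for t, continuous f} -> {for t, continuous (fun x => F (f x))}.
    by move=> cf; apply: (@continuous_comp _ _ _ f F) => //; exact: cF.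
  have cpt : {for t, continuous (fun x : R => p / x)}.
    have D := dV (f := fun y : R => y) (lt0r_neq0 t0) (did t).
    exact: (is_derive_continuous (dM (dcst p t) D)).
  have cdiff (f g : R -> R) : {for t, continuous f} -> {for t, continuous g} ->
      {for t, continuous (fun x => f x - g x)} by move=> *; exact: continuousB.
  have cmul (f g : R -> R) : {for t, continuous f} -> {for t, continuous g} ->
      {for t, continuous (fun x => f x * g x)} by move=> *; exact: continuousM.
  have cadd (f g : R -> R) : {for t, continuous f} -> {for t, continuous g} ->
      {for t, continuous (fun x => f x + g x)} by move=> *; exact: continuousD.
  have ccut : {for t, continuous (cutoff a b c)} by exact: smooth_cont (@cutoff_smooth R a b c) t.
  have cdcut : {for t, continuous (dcutoff a b c)}.
    by rewrite dcutoffE; exact: smooth_cont (smooth_derive1 (@cutoff_smooth R a b c)) t.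
  have cd2cut : {for t, continuous (dcutoff a b c)^`()%classic}.
    rewrite dcutoffE.
    exact: smooth_cont (smooth_derive1 (smooth_derive1 (@cutoff_smooth R a b c))) t.
  have cqt := @cont_divsq R q t t0.
  have crhs f (f1 : R -> R) : {for t, continuous f} -> {for t, continuous f1} ->
      {for t, continuous (fun x : R => q / x ^+ 2 * f x - p / x * f1 x + F (f x))}.
    move=> cf cf1; apply: (cadd (fun x : R => q / x ^+ 2 * f x - p / x * f1 x)); last exact: cF2.
    apply: (cdiff (fun x : R => q / x ^+ 2 * f x) (fun x : R => p / x * f1 x)).
      exact: (cmul (fun x : R => q / x ^+ 2)).
    exact: (cmul (fun x : R => p / x)).
  apply: (cadd (fun t => (dcutoff a b c)^`()%classic t * (v t - w t) +
    2 * (dcutoff a b c t * (v1 t - w1 t)))).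
    apply: (cadd (fun t => (dcutoff a b c)^`()%classic t * (v t - w t))).
      by apply: cmul => //; exact: cdiff.
    apply: (cmul (fun=> 2)); first exact: cvg_cst.
    by apply: (cmul (dcutoff a b c)) => //; exact: cdiff.
  apply: (cmul (cutoff a b c)) => //.
  by apply: cdiff; exact: crhs.
have [L L0 HL] := @cont_bounded R d2cut_diff a (b + c)
  (fun t at_ tb => cd t (Iab t at_ tb)).
exists L => x y; wlog xy : x y / y <= x => [W|].
  move=> ? ? ? ?; have [yx|/ltW xy] := leP y x; first exact: W.
  by rewrite distrC [in leRHS]distrC; exact: W.
move=> ax xb ay yb; move: xy; rewrite le_eqVlt => /predU1P[->|yx].
  by rewrite !subrr normr0 mulr0.
have [|t [yt tx ->]] := @mvt R dcut_diff d2cut_diff y x yx.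
  by move=> t yt tx; apply: d2cut_diffP; apply: Iab; arith.
by rewrite normrM ler_wpM2r // HL; arith.
Qed.

End CutoffCompetitor.

(** * Growth of the potential *)

Section PotentialGrowth.
Variables (R : realType) (sp : R) (F : R -> R).
Hypotheses (hsp : 0 < sp) (hF : class_C1 F) (hF0 : F 0 = 0).
Hypothesis hFpos : forall t, sp < t -> 0 <= F t.
Hypothesis hFsym : forall t, 0 <= t -> (F t + F (- t)) / 2 <= 0.
Implicit Types t x y z w : R.

Let cF : continuous F.
Proof. by move=> x; exact: (is_derive_continuous (derive1P (proj1 hF x))). Qed.

Let D t : is_derive t 1 (potential F) (2 * F t). Proof. exact: dpotential. Qed.

(** On [[- sp, sp]] the potential is quadratically small. Beyond, it grows with [|t|]: to the right
    because [F >= 0], to the left because [F (- t) <= - F t]. A point [z] between [y] and [w] that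
    lies outside [[- sp, sp]] is on the same side as [y] and no farther out, since [w] lies in
    [[0, sp]]. *)
Lemma potential_growth : exists2 L : R, 0 < L &
  (forall t, - (L * t ^+ 2) <= potential F t) /\
  (forall y w t, 0 <= w -> w <= sp -> 0 <= t -> t <= 1 ->
    let z := y - t * (y - w) in
    potential F z <= L * z ^+ 2 \/ potential F z <= potential F y).
Proof.
have [L L0 HL] := C1_lipschitz (- sp) sp hF.
have core t : - sp <= t -> t <= sp -> `|potential F t| <= 2 * L * t ^+ 2.
  move=> st ts.
  have Fc c : - sp <= c -> c <= sp -> `|c| <= `|t| -> `|2 * F c * t| <= 2 * L * t ^+ 2.
    move=> sc cs ct; rewrite !normrM (ger0_norm (ler0n _ _)) -!mulrA ler_pM2l //.
    rewrite -[t ^+ 2]real_normK ?num_real // expr2 mulrA; apply: ler_wpM2r => //.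
    have := HL c 0 sc cs (ltac:(have := hsp; lra)) (ltac:(have := hsp; lra)).
    rewrite hF0 !subr0 => /le_trans; apply.
    by apply: ler_wpM2l ct; exact: ltW.
  have [t0|t0|->] := ltgtP t 0; last by rewrite potential0 normr0 expr0n mulr0.
    have [c [c1 c2 E]] := mvt t0 (fun x _ _ => D x).
    have -> : potential F t = 2 * F c * t by move: E; rewrite potential0; arith.
    by apply: Fc; [arith|have := hsp; arith|rewrite !ltr0_norm; arith].
  have [c [c1 c2 E]] := mvt t0 (fun x _ _ => D x).
  have -> : potential F t = 2 * F c * t by move: E; rewrite potential0; arith.
  by apply: Fc; [have := hsp; arith|arith|rewrite !gtr0_norm; arith].
have right x y : sp <= x -> x <= y -> potential F x <= potential F y.
  move=> sx xy; apply: (nondecr_der xy (fun t _ _ => D t)) => t xt _.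
  by rewrite mulr_ge0 // hFpos // (le_lt_trans sx).
have left x y : x <= y -> y <= - sp -> potential F y <= potential F x.
  move=> xy ys; apply: (nonincr_der xy (fun t _ _ => D t)) => t _ ty.
  have t1 : sp < - t by arith.
  have := hFpos t1; have := hFsym (ltW (lt_trans hsp t1)); rewrite opprK; arith.
have L20 : 0 <= 2 * L by rewrite mulr_ge0 // ltW.
exists (2 * L); first by rewrite mulr_gt0.
split=> [t|y w t w0 ws t0 t1 z].
  have [st|st] := ltP sp t.
    apply: le_trans (right sp t (lexx _) (ltW st)).
    have := core sp (ltac:(have := hsp; lra)) (lexx _); rewrite ler_norml => /andP[h _].
    apply: le_trans h; rewrite lerN2; apply: ler_wpM2l => //.
    by apply: sqr_le; exact: ltW.
  have [ts|ts] := ltP t (- sp).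
    apply: le_trans (left t (- sp) (ltW ts) (lexx _)).
    have := core (- sp) (lexx _) (ltac:(have := hsp; lra)); rewrite ler_norml => /andP[h _].
    apply: le_trans h; rewrite lerN2; apply: ler_wpM2l => //.
    by rewrite sqrrN -[t ^+ 2]sqrrN; apply: sqr_le; [exact: ltW|arith].
  by have := core t ts st; rewrite ler_norml => /andP[].
have E1 : z - w = (1 - t) * (y - w) by rewrite /z; ring.
have E2 : y - z = t * (y - w) by rewrite /z; ring.
have [sz|zs] := ltP sp z.
  right; apply: right; first exact: ltW.
  rewrite -subr_ge0 E2 mulr_ge0 // leNgt; apply/negP => yw.
  have : z - w <= 0 by rewrite E1 mulr_ge0_le0 // ?subr_ge0 // ltW.
  by arith.
have [zs'|zs'] := ltP z (- sp).
  right; apply: left; last exact: ltW.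
  rewrite -subr_le0 E2 mulr_ge0_le0 // leNgt; apply/negP => yw.
  have : 0 <= z - w by rewrite E1 mulr_ge0 ?subr_ge0 // ltW // -subr_gt0.
  by have := hsp; arith.
left; have := core z zs' zs; rewrite ler_norml => /andP[_].
by [].
Qed.

End PotentialGrowth.

(** * Transition zone at the origin *)

Section Zones.
Variables (R : realType) (Rad : \bar R) (sp p q : R) (F v v1 w w1 : R -> R).
Notation mu := (@lebesgue_measure R).
Local Notation I := (interval0 Rad).
Hypotheses (hRad : (0 < Rad)%E) (hsp : 0 < sp) (hq : 0 < q) (hF : class_C1 F) (hF0 : F 0 = 0).
Hypothesis hFpos : forall t, sp < t -> 0 <= F t.
Hypothesis hFsym : forall t, 0 <= t -> (F t + F (- t)) / 2 <= 0.
Hypotheses (hv : ode Rad p q F v v1) (hw : ode Rad p q F w w1).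

Let cF : continuous F.
Proof. by move=> x; exact: (is_derive_continuous (derive1P (proj1 hF x))). Qed.

Local Notation tot a b c := (exchange_gap p q F v v1 w w1 (cutoff a b c) (dcutoff a b c)).

Lemma competitor_gap_integrable a b c : 0 < a -> 2 * a <= b -> 0 < c -> I (b + c) ->
  mu.-integrable `[a, b + c] (EFin \o gap p q F v v1
    (fun t => - cut_diff v w a b c t) (fun t => - dcut_diff v v1 w w1 a b c t)) /\
  mu.-integrable `[a, b + c] (EFin \o gap p q F w w1
    (cut_diff v w a b c) (dcut_diff v v1 w w1 a b c)).
Proof.
move=> a0 ab c0 Ibc.
have Iab t : a <= t -> t <= b + c -> I t.
  by move=> at_ tb; apply: (interval0_left Ibc) => //; exact: lt_le_trans at_.
have cd t : {for t, continuous (cut_diff v w a b c)}.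
  exact: is_derive_continuous (dcut_diffP hv hw a0 ab c0 Ibc t).
have cd1 t : {for t, continuous (dcut_diff v v1 w w1 a b c)}.
  exact: (dcut_diff_cont hv hw a0 ab c0 Ibc).
have int1 f (f1 : R -> R) : ode Rad p q F f f1 -> mu.-integrable `[a, b + c] (EFin \o f1).
  by move=> hf; apply: cont_integrable => t at_ tb; exact: (ode_cont1 hf (Iab t at_ tb)).
have cont f (f1 : R -> R) : ode Rad p q F f f1 ->
    forall t, a <= t -> t <= b + c -> {for t, continuous f}.
  by move=> hf t at_ tb; exact: (ode_cont hf (Iab t at_ tb)).
split.
  apply: (gap_integrable p q cF a0 (int1 _ _ hv) (cont _ _ hv)) => t _ _.
    by apply: continuousN; exact: cd.
  by apply: continuousN; exact: cd1.
by apply: (gap_integrable p q cF a0 (int1 _ _ hw) (cont _ _ hw)) => t _ _; [exact: cd|exact: cd1].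
Qed.

Lemma exchange_gap_integrable a b c : 0 < a -> 2 * a <= b -> 0 < c -> I (b + c) ->
  mu.-integrable `[a, b + c] (EFin \o tot a b c).
Proof.
move=> a0 ab c0 Ibc; have [i1 i2] := competitor_gap_integrable a0 ab c0 Ibc.
exact: (integrableD _ i1 i2).
Qed.

(** The exchange costs at most a multiple of both energies over [[a, 2 a]], and these tend to 0 by
    absolute continuity of the integral. [f] will be the density of the minimizer [u], given as
    integrable up to 0, while [v] is only its continuous representative. *)
Lemma left_zone (f g : R -> R) (b0 e : R) : 0 < e -> I b0 ->
  (forall r, I r -> 0 <= w r) -> (forall r, I r -> w r <= sp) ->
  mu.-integrable `[0, b0] (EFin \o f) -> mu.-integrable `[0, b0] (EFin \o g) ->
  (forall a, 0 < a -> 2 * a <= b0 ->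
    \int[mu]_(r in `[a, 2 * a]) energy_density p q F v v1 r = \int[mu]_(r in `[a, 2 * a]) f r /\
    \int[mu]_(r in `[a, 2 * a]) energy_density p q F w w1 r = \int[mu]_(r in `[a, 2 * a]) g r) ->
  exists2 d : R, 0 < d & forall a b c, 0 < a -> a < d -> 2 * a <= b -> 0 < c -> I (b + c) ->
    \int[mu]_(r in `[a, 2 * a]) tot a b c r <= e.
Proof.
move=> e0 Ib0 w0 ws fi gi fg; have b00 := interval0_pos Ib0.
have [L L0 [lo up]] := potential_growth hsp hF hF0 hFpos hFsym.
have [K K0 HK] := dcutoff_bound R.
(* On [[a, 2 a]] the slope [K / a] is at most [2 K / r], whose square is [k / r^2]; [M] is the
   constant of [exchange_gap_singular]. *)
pose k := 4 * K ^+ 2; pose M := 2 * (3 + 6 * (2 * k + q) / q) + 1.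
have k0 : 0 <= k by rewrite /k mulr_ge0 // sqr_ge0.
have M0 : 0 < M.
  rewrite /M; have : 0 <= 6 * (2 * k + q) / q; last by arith.
  by rewrite divr_ge0 ?ltW // mulr_gt0 // ltr_wpDl // mulr_ge0.
have e20 : 0 < e / 2 / M by rewrite !divr_gt0.
have [d1 d10 H1] := Rint_near b00 e20 fi.
have [d2 d20 H2] := Rint_near b00 e20 gi.
(* Below [s] one has [L r^2 <= q / 2]. *)
pose s := Num.sqrt (q / 2 / L).
have s0 : 0 < s by rewrite sqrtr_gt0 !divr_gt0.
exists (Num.min (Num.min d1 d2) (Num.min b0 s) / 2).
  by rewrite divr_gt0 // !lt_min d10 d20 b00.
move=> a b c a0; rewrite ltr_pdivlMr // !lt_min => /andP[/andP[h1 h2] /andP[h3 h4]] ab c0 Ibc.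
have aa : a <= 2 * a by arith.
have Iab t : a <= t -> t <= b0 -> I t.
  by move=> at_ tb; apply: (interval0_left Ib0) => //; exact: lt_le_trans at_.
have ab0 : 2 * a <= b0 by arith.
have ie (y y1 : R -> R) : ode Rad p q F y y1 ->
    mu.-integrable `[a, 2 * a] (EFin \o energy_density p q F y y1).
  move=> hy; apply: cont_integrable => r ar rb.
  have Ir : I r by apply: Iab => //; exact: le_trans ab0.
  apply: energy_density_continuous => //; [exact: interval0_pos Ir|exact: (ode_cont hy)|].
  exact: (ode_cont1 hy).
have i1 := ie v v1 hv; have i2 := ie w w1 hw.
have it : mu.-integrable `[a, 2 * a] (EFin \o tot a b c).
  by apply: integrable_itvS (exchange_gap_integrable a0 ab c0 Ibc) => //; arith.
have is2 : mu.-integrable `[a, 2 * a]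
    (EFin \o (fun r => energy_density p q F v v1 r + energy_density p q F w w1 r)).
  exact: (integrableD _ i1 i2).
have iM : mu.-integrable `[a, 2 * a]
    (EFin \o (fun r => M * (energy_density p q F v v1 r + energy_density p q F w w1 r))).
  by apply: integrable_contM => // r _ _; exact: cvg_cst.
apply: (@le_trans _ _ (\int[mu]_(r in `[a, 2 * a])
    (M * (energy_density p q F v v1 r + energy_density p q F w w1 r)))).
  apply: Rint_le => // r ar rb; have r0 : 0 < r by exact: lt_le_trans ar.
  have Ir : I r by apply: Iab => //; exact: le_trans ab0.
  have /andP[c1 c2] := @cutoff_bounds R a b c r a0 ab c0.
  apply: (@exchange_gap_singular R p q F v v1 w w1 _ _ k L) => //.
  - have r2 : r ^+ 2 <= q / 2 / L.
      rewrite -[leRHS]sqr_sqrtr; last by rewrite ltW // !divr_gt0.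
      by apply: sqr_le; [exact: ltW|rewrite -/s; arith].
    by rewrite mulrC -ler_pdivlMr.
  - have [hk _] := HK a b c r a0 ab c0; have {}hk := hk rb.
    have hk2 : `|dcutoff a b c r| <= 2 * K / r.
      apply: le_trans hk _; rewrite ler_pdivlMr // mulrAC ler_pdivrMr // -mulrA mulrCA.
      by rewrite ler_pM2l // mulrC.
    rewrite -[dcutoff _ _ _ _ ^+ 2]real_normK ?num_real //.
    apply: le_trans (sqr_le (normr_ge0 _) hk2) _.
    by rewrite /k le_eqVlt; apply/orP; left; apply/eqP; field; rewrite gt_eqF.
  - by move=> t t0 t1; apply: up => //; [exact: w0|exact: ws].
rewrite RintegralZl // RintegralD //.
have [-> ->] := fg a a0 ab0.
have small (h : R -> R) (d : R) : mu.-integrable `[0, b0] (EFin \o h) ->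
    (forall c, 0 <= c -> c < 0 + d -> \int[mu]_(x in `[0, c]) `|h x| < e / 2 / M) ->
    a * 2 < d -> \int[mu]_(r in `[a, 2 * a]) h r <= e / 2 / M.
  move=> hi Hd ad; have a20 : 0 <= 2 * a by rewrite mulr_ge0 // ltW.
  have a2d : 2 * a < 0 + d by rewrite add0r mulrC.
  have := Hd (2 * a) a20 a2d.
  have hi' : mu.-integrable `[0, 2 * a] (EFin \o h) by exact: integrable_itvS hi.
  have ha := integrable_abs hi'.
  have hi2 : mu.-integrable `[a, 2 * a] (EFin \o h) by apply: integrable_itvS hi'; [exact: ltW|].
  rewrite (Rint_split (ltW a0) aa ha) => hl.
  apply: (@le_trans _ _ (\int[mu]_(x in `[a, 2 * a]) `|h x|)).
    by apply: Rint_le => //; [exact: integrable_abs|move=> x _ _; exact: ler_norm].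
  apply: le_trans (ltW hl); rewrite lerDr; apply: Rintegral_ge0 => // x _; exact: normr_ge0.
have f1 := small f d1 fi H1 h1; have g1 := small g d2 gi H2 h2.
have : M * (e / 2 / M + e / 2 / M) = e by field; rewrite gt_eqF.
by move=> <-; rewrite ler_pM2l // lerD.
Qed.

End Zones.

(** * Transition zone at the right end *)

Section RightZone.
Variables (R : realType) (Rad : \bar R) (sp p q : R) (F v v1 w w1 : R -> R).
Notation mu := (@lebesgue_measure R).
Local Notation I := (interval0 Rad).
Hypotheses (hRad : (0 < Rad)%E) (hq : 0 < q) (hF : class_C1 F).
Hypothesis hdF : 0 < F^`()%classic sp.
Hypotheses (hv : ode Rad p q F v v1) (hw : ode Rad p q F w w1).
Hypotheses (ev : end_value Rad v sp) (ew : end_value Rad w sp).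

Let cF : continuous F.
Proof. by move=> x; exact: (is_derive_continuous (derive1P (proj1 hF x))). Qed.

Local Notation tot a b c := (exchange_gap p q F v v1 w w1 (cutoff a b c) (dcutoff a b c)).
Let d r := v r - w r.
Let d1 r := v1 r - w1 r.

Lemma strictly_monotone_near : exists k c0 : R, [/\ 0 < k, 0 < c0 &
  forall s u, sp - k <= s -> s <= u -> u <= sp + k -> c0 * (u - s) <= F u - F s].
Proof.
have c20 : 0 < F^`()%classic sp / 2 by rewrite divr_gt0.
have [e e0 He] := cont_near c20 (proj2 hF sp).
exists (e / 2), (F^`()%classic sp / 2); split=> //; first by rewrite divr_gt0.
move=> s u hs; rewrite le_eqVlt => /predU1P[->|su] hu; first by rewrite !subrr mulr0.
have [c [sc cu ->]] := mvt su (fun x _ _ => derive1P (proj1 hF x)).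
apply: ler_wpM2r; first by rewrite subr_ge0 ltW.
have : `|c - sp| < e by rewrite ltr_norml; apply/andP; split; arith.
by move=> /He; rewrite ltr_norml => /andP[h _]; arith.
Qed.

Let maxI x y : I x -> I y -> I (Num.max x y).
Proof. by case: (leP x y). Qed.

Lemma both_near N (k : R) : I N -> 0 < k -> exists2 N', I N' & N <= N' /\
  forall r, I r -> N' <= r -> `|v r - sp| < k /\ `|w r - sp| < k.
Proof.
move=> IN k0; have [x1 I1 H1] := end_valueP hRad ev k0.
have [x2 I2 H2] := end_valueP hRad ew k0.
exists (Num.max N (Num.max x1 x2)); first exact: maxI IN (maxI I1 I2).
split=> [|r Ir]; first by rewrite le_max lexx.
by rewrite !ge_max => /andP[_ /andP[h1 h2]]; split; [exact: H1|exact: H2].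
Qed.

Let dd r : I r -> is_derive r 1 d (d1 r).
Proof.
move=> Ir; have [D1 _] := hv Ir; have [D2 _] := hw Ir.
by eapply derE; [eapply dD; [exact: D1|eapply dN; exact: D2]|].
Qed.

Let zone_bound N k c0 a b c r :
  (forall s u, sp - k <= s -> s <= u -> u <= sp + k -> c0 * (u - s) <= F u - F s) ->
  0 <= c0 -> (forall r, I r -> N <= r -> `|v r - sp| < k /\ `|w r - sp| < k) ->
  0 < a -> 2 * a <= b -> 0 < c -> I r -> N <= r ->
  tot a b c r <= 2 * r `^ p * ((dcutoff a b c r * d r) ^+ 2 + `|dcutoff a b c r * d r| * `|d1 r|).
Proof.
move=> Fm c00 near a0 ab c_0 Ir Nr; have [n1 n2] := near r Ir Nr.
move: n1 n2; rewrite !ltr_norml => /andP[? ?] /andP[? ?].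
have /andP[b1 b2] := @cutoff_bounds R a b c r a0 ab c_0.
apply: (@exchange_gap_convex R p q F cF v v1 w w1 _ _ (sp - k) (sp + k) r
  (interval0_pos Ir) (ltW hq)) => //; try arith.
move=> s u ss su us; have := Fm s u ss su us.
by have := mulr_ge0 c00 (ltac:(lra) : 0 <= u - s); arith.
Qed.

(** Bounded derivatives and equal end values give [|d r| <= C (B - r)], which compensates the steep
    slope of the cutoff. *)
Lemma right_zone_finite (B N e : R) : Rad = B%:E -> I N -> 0 < e ->
  exists b c, [/\ N <= b, 0 < c, I (b + c) & forall a, 0 < a -> 2 * a <= N ->
    \int[mu]_(r in `[b, b + c]) tot a b c r <= e].
Proof.
move=> RB IN e0; have [k [c0 [k0 c00 Fm]]] := strictly_monotone_near.
have [N' IN' [NN' near]] := both_near IN k0.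
have N'0 := interval0_pos IN'.
have IB r : N' <= r -> r < B -> I r.
  by move=> Nr rB; split; [exact: lt_le_trans Nr|rewrite RB lte_fin].
have N'B : N' < B by case: IN' => _; rewrite RB lte_fin.
have BR : (B%:E <= Rad)%E by rewrite RB lexx.
have bnd (y : R) : `|y - sp| < k -> `|y| <= `|sp| + k.
  move=> h; have -> : y = sp + (y - sp) by ring.
  by apply: le_trans (ler_normD _ _) _; rewrite lerD2l ltW.
have [C1 C10 HC1] := ode_der_bounded cF hv IN' BR
  (fun r Nr rB => bnd _ (proj1 (near r (IB r Nr rB) Nr))).
have [C2 C20 HC2] := ode_der_bounded cF hw IN' BR
  (fun r Nr rB => bnd _ (proj2 (near r (IB r Nr rB) Nr))).
pose C := C1 + C2; have C0 : 0 < C by exact: addr_gt0.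
have d1C r : N' <= r -> r < B -> `|d1 r| <= C.
  move=> Nr rB; apply: le_trans (ler_normB _ _) _.
  by apply: lerD; [exact: HC1|exact: HC2].
have dC r : N' <= r -> r < B -> `|d r| <= C * (B - r).
  move=> Nr rB; apply/ler_addgt0Pr => x x0; have x20 : 0 < x / 2 by rewrite divr_gt0.
  have [y Iy [ry nr]] := both_near (IB r Nr rB) x20.
  have [] := nr y Iy (lexx _) => h1 h2.
  have yB : y < B by case: Iy => _; rewrite RB lte_fin.
  have dy : `|d y| <= x.
    have -> : d y = (v y - sp) - (w y - sp) by rewrite /d; ring.
    by apply: le_trans (ler_normB _ _) _; arith.
  have dry : `|d y - d r| <= C * (B - r).
    move: ry; rewrite le_eqVlt => /predU1P[<-|ry].
      by rewrite subrr normr0 mulr_ge0 ?ltW // subr_gt0.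
    have [|t [rt ty ->]] := @mvt R d d1 r y ry.
      by move=> t rt ty; apply/dd/IB; arith.
    rewrite normrM; apply: ler_pM => //; first by apply: d1C; arith.
    by rewrite gtr0_norm; arith.
  have -> : d r = d y - (d y - d r) by ring.
  by apply: le_trans (ler_normB _ _) _; rewrite addrC lerD.
have [m [M [m0 M0 HM]]] := powR_bounds p B N'0.
have [K K0 HK] := dcutoff_bound R.
(* On [[B - 2 c, B - c]] the slope is at most [K / c] and [|d|] at most [2 C c]. The integrand is
   then bounded by [D] whatever [c] is, and the zone has length [c]. *)
pose G := 2 * K * C; have G0 : 0 < G by rewrite !mulr_gt0.
pose D := 2 * M * (G ^+ 2 + G * C).
have D0 : 0 < D.
  by rewrite mulr_gt0 ?(mulr_gt0 _ M0) // ltr_wpDl ?sqr_ge0 // mulr_gt0.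
pose c := Num.min ((B - N') / 2) (e / D).
have c_0 : 0 < c by rewrite lt_min !divr_gt0 // subr_gt0.
have cN : c <= (B - N') / 2 by rewrite ge_min lexx.
have cD : D * c <= e.
  by rewrite mulrC -ler_pdivlMr // ge_min lexx orbT.
pose b := B - 2 * c; have N'b : N' <= b by rewrite /b; arith.
have bcB : b + c < B by rewrite /b; arith.
have Ibc : I (b + c) by apply: IB => //; arith.
exists b, c; split=> //; first exact: le_trans N'b.
move=> a a0 aN; have ab : 2 * a <= b by arith.
have it : mu.-integrable `[b, b + c] (EFin \o tot a b c).
  by apply: integrable_itvS (exchange_gap_integrable hF hv hw a0 ab c_0 Ibc) => //; arith.
have iD : mu.-integrable `[b, b + c] (EFin \o (fun=> D)).
  by apply: cont_integrable => r _ _; exact: cvg_cst.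
apply: le_trans cD; have -> : D * c = D * (b + c - b) by congr (_ * _); ring.
rewrite -Rint_cst; last by arith.
apply: Rint_le => // r br rc.
have Nr : N' <= r by exact: le_trans br.
have rB : r < B by exact: le_lt_trans bcB.
apply: le_trans (zone_bound Fm (ltW c00) near a0 ab c_0 (IB r Nr rB) Nr) _.
have [_ XM] := HM r Nr (ltW rB).
have gG : `|dcutoff a b c r * d r| <= G.
  have [_ hk] := HK a b c r a0 ab c_0; have {}hk := hk br.
  have -> : G = K / c * (C * (2 * c)) by rewrite /G; field; rewrite gt_eqF.
  rewrite normrM; apply: ler_pM => //; apply: le_trans (dC r Nr rB) _.
  by rewrite ler_pM2l // /b; move: br; rewrite /b; arith.
have X0 := powR_ge0 r p.
apply: ler_pM.
- by rewrite mulr_ge0.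
- by rewrite addr_ge0 ?sqr_ge0 // mulr_ge0.
- by rewrite ler_pM2l.
- apply: lerD; last by apply: ler_pM => //; exact: d1C.
  by rewrite -[leLHS]real_normK ?num_real //; exact: sqr_le.
Qed.

(* The flux [Y = r^p d d'] is nondecreasing and nonpositive, hence has small increments,
   and [Y'] dominates the density to be integrated. *)
Lemma right_zone_infinite (N e : R) : Rad = +oo%E -> I N -> 0 < e ->
  exists b c, [/\ N <= b, 0 < c, I (b + c) & forall a, 0 < a -> 2 * a <= N ->
    \int[mu]_(r in `[b, b + c]) tot a b c r <= e].
Proof.
move=> Roo IN e0; have [k [c0 [k0 c00 Fm]]] := strictly_monotone_near.
have [N' IN' [NN' near]] := both_near IN k0.
have N'0 := interval0_pos IN'.
have Ir r : N' <= r -> I r by move=> Nr; split; [exact: lt_le_trans Nr|rewrite Roo ltry].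
pose Y r := d r * (r `^ p * v1 r - r `^ p * w1 r).
pose dY r := r `^ p * (d1 r ^+ 2 + d r * (q / r ^+ 2 * d r + (F (v r) - F (w r)))).
have DY r : N' <= r -> is_derive r 1 Y (dY r).
  move=> Nr; have D1 := dd (Ir r Nr).
  have D2 := ode_flux hv (Ir r Nr); have D3 := ode_flux hw (Ir r Nr).
  eapply derE; first by eapply dM; [exact: D1|eapply dD; [exact: D2|eapply dN; exact: D3]].
  by rewrite /dY /d /d1; cbv beta; ring.
have dYlb r : N' <= r -> r `^ p * (d1 r ^+ 2 + c0 * d r ^+ 2) <= dY r.
  move=> Nr; have [n1 n2] := near r (Ir r Nr) Nr.
  move: n1 n2; rewrite !ltr_norml => /andP[? ?] /andP[? ?].
  apply: ler_wpM2l; first exact: powR_ge0.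
  rewrite lerD2l mulrDr.
  have h1 : 0 <= d r * (q / r ^+ 2 * d r).
    by rewrite mulrCA mulr_ge0 ?divr_ge0 ?sqr_ge0 ?(ltW hq) // -expr2 sqr_ge0.
  have h2 : c0 * d r ^+ 2 <= d r * (F (v r) - F (w r)).
    have [wv|vw] := leP (w r) (v r).
      have := Fm (w r) (v r) (ltac:(lra)) wv (ltac:(lra)); rewrite -/(d r) => h.
      have -> : c0 * d r ^+ 2 = d r * (c0 * d r) by ring.
      by apply: ler_wpM2l => //; rewrite subr_ge0.
    have := Fm (v r) (w r) (ltac:(lra)) (ltW vw) (ltac:(lra)) => h.
    have -> : c0 * d r ^+ 2 = (w r - v r) * (c0 * (w r - v r)) by rewrite /d; ring.
    have -> : d r * (F (v r) - F (w r)) = (w r - v r) * (F (w r) - F (v r)).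
      by rewrite /d; ring.
    by apply: ler_wpM2l => //; rewrite subr_ge0 ltW.
  by move: h1 h2; move: (d r * _) (d r * _) (c0 * _) => x y z ? ?; arith.
have dY0 r : N' <= r -> 0 <= dY r.
  move=> Nr; apply: le_trans (dYlb r Nr); apply: mulr_ge0.
    exact: powR_ge0.
  apply: addr_ge0; first exact: sqr_ge0.
  by apply: mulr_ge0; [exact: ltW|exact: sqr_ge0].
have Ymono x y : N' <= x -> x <= y -> Y x <= Y y.
  move=> Nx xy; apply: (nondecr_der xy (fun t xt _ => DY t (le_trans Nx xt))).
  by move=> t xt _; apply: dY0; exact: le_trans (ltW xt).
have YE r : Y r = r `^ p * (d r * d1 r) by rewrite /Y /d1; ring.
(* If [Y r > 0], then [d d' > 0] from [r] on, so [d^2] would be nondecreasing from a positive value,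
   although [d] tends to 0. *)
have Yneg r : N' <= r -> Y r <= 0.
  move=> Nr; rewrite leNgt; apply/negP => Yr.
  have dr0 : d r != 0 by apply/eqP => z; move: Yr; rewrite YE z mul0r mulr0 ltxx.
  have x0 : 0 < `|d r| / 2 by rewrite divr_gt0 // normr_gt0.
  have [y Iy [ry nr]] := both_near (Ir r Nr) x0.
  have [h1 h2] := nr y Iy (lexx _).
  have dy : `|d y| < `|d r|.
    have -> : d y = (v y - sp) - (w y - sp) by rewrite /d; ring.
    by apply: le_lt_trans (ler_normB _ _) _; arith.
  have Dsq t : r <= t -> t <= y -> is_derive t 1 (fun t => d t ^+ 2) (2 * (d t * d1 t)).
    move=> rt _; have D1 := dd (Ir t (le_trans Nr rt)).
    by eapply derE; [eapply (@dX _ _ 1); exact: D1|cbv beta; rewrite expr1; ring].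
  have hsq : d r ^+ 2 <= d y ^+ 2.
    apply: (nondecr_der ry Dsq) => t rt _; apply: mulr_ge0 => //.
    have : 0 < Y t by apply: lt_le_trans Yr _; apply: Ymono => //; exact: ltW.
    rewrite YE pmulr_rgt0; first exact: ltW.
    by apply: powR_gt0; apply: (lt_le_trans N'0); exact: le_trans Nr (ltW rt).
  have : `|d y| ^+ 2 < `|d r| ^+ 2 by apply: ltrXn2r.
  by rewrite !real_normK ?num_real // ltNge hsq.
have [K K0 HK] := dcutoff_bound R.
(* The zone has length 1, so the cutoff has slope at most [K], and [d'^2 + d^2] is at most
   [(1 + 1 / c0) (d'^2 + c0 d^2)]. *)
pose G := 2 * (K ^+ 2 + K) * (1 + c0^-1).
have G0 : 0 < G.
  by rewrite !mulr_gt0 // ltr_wpDl ?sqr_ge0 ?ler01 // invr_gt0.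
(* If every unit increment exceeded [e / G], then [Y] would become positive. *)
have [n Hn] : exists n : nat, Y (N' + n%:R + 1) - Y (N' + n%:R) <= e / G.
  apply: contrapT => H; have eG : 0 < e / G by rewrite divr_gt0.
  have H' n : e / G < Y (N' + n%:R + 1) - Y (N' + n%:R).
    by rewrite ltNge; apply/negP => h; apply: H; exists n.
  have ind n : Y N' + n%:R * (e / G) <= Y (N' + n%:R).
    elim: n => [|n IH]; first by rewrite mul0r !addr0.
    by have := H' n; rewrite -natr1 addrA mulrDl mul1r; arith.
  pose n := Num.trunc (- Y N' / (e / G)).
  have : - Y N' / (e / G) < n.+1%:R by exact: truncnS_gt.
  rewrite ltr_pdivrMr // => h.
  have Nn : N' <= N' + n.+1%:R by rewrite lerDl ler0n.
  have := ind n.+1; have := Yneg _ Nn.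
  by move: h; arith.
pose b := N' + n%:R; have N'b : N' <= b by rewrite lerDl ler0n.
have Ib1 : I (b + 1) by apply: Ir; arith.
exists b, 1; split=> //; first exact: le_trans N'b.
move=> a a0 aN; have ab : 2 * a <= b by arith.
have it : mu.-integrable `[b, b + 1] (EFin \o tot a b 1).
  by apply: integrable_itvS (exchange_gap_integrable hF hv hw a0 ab ltr01 Ib1) => //; arith.
have cdY r : b <= r -> r <= b + 1 -> {for r, continuous dY}.
  move=> br _; have Irr := Ir r (le_trans N'b br); have r0 := interval0_pos Irr.
  have cd : {for r, continuous d} by exact: is_derive_continuous (dd Irr).
  have cv := ode_cont hv Irr; have cw := ode_cont hw Irr.
  have cd1 : {for r, continuous d1}.
    by apply: continuousB; [exact: (ode_cont1 hv Irr)|exact: (ode_cont1 hw Irr)].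
  have cF2 f : {for r, continuous f} -> {for r, continuous (fun x => F (f x))}.
    by move=> cf; apply: (@continuous_comp _ _ _ f F) => //; exact: cF.
  apply: (@continuousM _ _ (fun r : R => r `^ p)); first exact: cont_powR.
  apply: (@continuousD _ _ _ (fun r => d1 r ^+ 2)); first exact: cont_sq.
  apply: (@continuousM _ _ d) => //.
  apply: (@continuousD _ _ _ (fun r : R => q / r ^+ 2 * d r)).
    by apply: (@continuousM _ _ (fun r : R => q / r ^+ 2)) => //; exact: cont_divsq.
  by apply: (@continuousB _ _ _ (fun r => F (v r))); exact: cF2.
have iG : mu.-integrable `[b, b + 1] (EFin \o (fun r => G * dY r)).
  by apply: integrable_contM (cont_integrable cdY) => r _ _; exact: cvg_cst.
have b1 : b <= b + 1 by arith.
apply: (@le_trans _ _ (\int[mu]_(r in `[b, b + 1]) (G * dY r))).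
  apply: Rint_le => // r br rb; have Nr := le_trans N'b br.
  apply: le_trans (zone_bound Fm (ltW c00) near a0 ab ltr01 (Ir r Nr) Nr) _.
  apply: (@le_trans _ _ (G * (r `^ p * (d1 r ^+ 2 + c0 * d r ^+ 2)))); last first.
    by rewrite ler_pM2l //; exact: dYlb.
  have -> (X Z T : R) : G * (X * (Z + T)) = 2 * X * ((K ^+ 2 + K) * ((1 + c0^-1) * (Z + T))).
    by rewrite /G; ring.
  apply: ler_wpM2l; first by rewrite mulr_ge0 ?powR_ge0.
  have [_ hk] := HK a b 1 r a0 ab ltr01; have {}hk := hk br; rewrite divr1 in hk.
  have h1 : (dcutoff a b 1 r * d r) ^+ 2 <= K ^+ 2 * d r ^+ 2.
    rewrite exprMn; apply: ler_wpM2r; first exact: sqr_ge0.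
    by rewrite -[leLHS]real_normK ?num_real //; exact: sqr_le.
  have h2 : `|dcutoff a b 1 r * d r| * `|d1 r| <= K * (d1 r ^+ 2 + d r ^+ 2).
    rewrite normrM -mulrA; apply: ler_pM => //.
    rewrite -[d1 r ^+ 2]real_normK ?num_real // -[d r ^+ 2]real_normK ?num_real //.
    have := sqr_ge0 (`|d r| - `|d1 r|); have := mulr_ge0 (normr_ge0 (d r)) (normr_ge0 (d1 r)).
    by move: `|d r| `|d1 r| => x y *; arith.
  have h3 : d1 r ^+ 2 + d r ^+ 2 <= (1 + c0^-1) * (d1 r ^+ 2 + c0 * d r ^+ 2).
    have -> : (1 + c0^-1) * (d1 r ^+ 2 + c0 * d r ^+ 2) =
      d1 r ^+ 2 + d r ^+ 2 + (c0^-1 * d1 r ^+ 2 + c0 * d r ^+ 2) by field; rewrite gt_eqF.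
    rewrite lerDl; apply: addr_ge0; (apply: mulr_ge0; last exact: sqr_ge0).
      by rewrite invr_ge0 ltW.
    exact: ltW.
  apply: (@le_trans _ _ ((K ^+ 2 + K) * (d1 r ^+ 2 + d r ^+ 2))); last first.
    apply: ler_wpM2l => //; apply: addr_ge0; [exact: sqr_ge0|exact: ltW].
  have h4 : 0 <= K ^+ 2 * d1 r ^+ 2 by rewrite mulr_ge0 ?sqr_ge0.
  apply: le_trans (lerD h1 h2) _; rewrite -subr_ge0.
  suff -> : (K ^+ 2 + K) * (d1 r ^+ 2 + d r ^+ 2) -
    (K ^+ 2 * d r ^+ 2 + K * (d1 r ^+ 2 + d r ^+ 2)) = K ^+ 2 * d1 r ^+ 2 by [].
  by ring.
rewrite RintegralZl //; last exact: cont_integrable.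
rewrite (ftc2 b1 (fun r br _ => DY r (le_trans N'b br)) cdY).
by rewrite mulrC -ler_pdivlMr.
Qed.

Lemma right_zone (N e : R) : I N -> 0 < e ->
  exists b c, [/\ N <= b, 0 < c, I (b + c) & forall a, 0 < a -> 2 * a <= N ->
    \int[mu]_(r in `[b, b + c]) tot a b c r <= e].
Proof.
move=> IN e0; case E : Rad ev => [B||] // _.
- by rewrite -E; exact: right_zone_finite E IN e0.
- by rewrite -E; exact: right_zone_infinite E IN e0.
Qed.

End RightZone.

(** * Identification of the minimizer *)

Section Uniqueness.
Variables (R : realType) (Rad : \bar R) (sp p q : R) (F w : R -> R).
Notation mu := (@lebesgue_measure R).
Local Notation I := (interval0 Rad).
Hypotheses (hRad : (0 < Rad)%E) (hsp : 0 < sp) (hq : 0 < q) (hF : class_C1 F).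
Hypotheses (hF0 : F 0 = 0) (hFsp : F sp = 0) (hdF : 0 < F^`()%classic sp).
Hypothesis hFneg : forall t, 0 < t -> t < sp -> F t < 0.
Hypothesis hFpos : forall t, sp < t -> 0 <= F t.
Hypothesis hFsym : forall t, 0 <= t -> (F t + F (- t)) / 2 <= 0.
Hypothesis hw : nonneg_solution Rad sp p q F w.
Variables u v : R -> R.
Hypothesis hmin : locally_energy_minimizing Rad p q F u.
Hypothesis cv : forall r, I r -> {for r, continuous v}.
Hypothesis uv : ae_eq mu I u v.
Hypothesis ev : end_value Rad v sp.

Let cF : continuous F := class_C1_continuous hF.

(** A point where [|v| <> w] fixes a loss [dl] before any cutoff is chosen. The zones are then
    placed so that each contributes at most [dl / 3] to the exchange, which nevertheless costs at
    least [dl]. *)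
Lemma minimizer_abs r : I r -> `|v r| = w r.
Proof.
move=> Ir; apply/eqP; apply/negPn/negP => vw.
have [du [hu hdu wd min]] := hmin.
have min' (a b : R) : I a -> a <= b -> I b ->
    mu.-integrable `[a, b] (EFin \o energy_density p q F u du) /\
    forall phi : R -> R, test_function `]a, b[ phi ->
    (energy p q F u du `[a, b] <=
     energy p q F (u \+ phi)%R (du \+ phi^`()%classic)%R `[a, b])%E.
  by move=> [a0 _] ab [_ bR]; apply: min => //; exact: ltW.
have [hv duv] := minimizer_ode hF hu hdu wd cv uv min'.
set v1 := v^`()%classic in hv duv.
have hw' := nonneg_solution_ode hw.
set w1 := w^`()%classic in hw'.
have ew : end_value Rad w sp by case: hw.
have [c0 [e0 [s0 [dl [[Ic0 Ie0] Is0 ce dl0 Hgap]]]]] :=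
  nonneg_solution_gap hRad hsp hq hF hF0 hFsp hFneg hFpos hFsym hw Ir (cv Ir) vw.
have dl3 : 0 < dl / 3 by rewrite divr_gt0.
have w0 x : I x -> 0 <= w x.
  by move=> Ix; exact: ltW (nonneg_solution_gt0 hRad hsp hq hF hF0 hFsp hFneg hFpos hw Ix).
have ws x : I x -> w x <= sp.
  by move=> Ix; exact: ltW (nonneg_solution_lt hRad hsp hq hFsp hFpos hw Ix).
have c00 := interval0_pos Ic0.
have eu : mu.-integrable `[0, c0] (EFin \o energy_density p q F u du).
  by have [] := min 0 c0 (lexx _) (ltW c00) (ltW (proj2 Ic0)).
have iew : mu.-integrable `[0, c0] (EFin \o energy_density p q F w w1).
  exact: (nonneg_solution_energy_integrable hRad hsp hq hF hF0 hFsp hFneg hFpos hw (lexx _)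
    (ltW c00) (ltW (proj2 Ic0))).
have same a : 0 < a -> 2 * a <= c0 ->
    \int[mu]_(x in `[a, 2 * a]) energy_density p q F v v1 x =
      \int[mu]_(x in `[a, 2 * a]) energy_density p q F u du x /\
    \int[mu]_(x in `[a, 2 * a]) energy_density p q F w w1 x =
      \int[mu]_(x in `[a, 2 * a]) energy_density p q F w w1 x.
  move=> a0 ac; split; last by reflexivity.
  have Ia : I a by apply: (interval0_left Ic0); arith.
  have I2a : I (2 * a) by apply: (interval0_left Ic0); arith.
  have cvi x : a <= x -> x <= 2 * a -> {for x, continuous v}.
    by move=> ax xb; apply: cv; exact: interval0_conv Ia I2a ax xb.
  have cv1 x : a <= x -> x <= 2 * a -> {for x, continuous v1}.
    by move=> ax xb; apply: (ode_cont1 hv); exact: interval0_conv Ia I2a ax xb.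
  apply: Rint_ae.
  - by apply: (energy_density_measurable p q cF a0); exact: cont_measurable.
  - apply: (energy_density_measurable p q cF a0).
      exact: (L2loc_measurable hu).
    exact: (L2loc_measurable hdu).
  - have := @filterI _ (almost_everywhere mu) (ae_filter_ringOfSetsType mu) _ _
      (duv a (2 * a) Ia I2a) (ae_eq_itv uv Ia I2a).
    by apply: ae_imp => x [h1 h2] hx; rewrite /energy_density h1 // h2.
(* Each of the two zone estimates is uniform in the parameters of the other, so [b] and [c] may be
   fixed before [a]. *)
have [d d0 Hleft] := left_zone hsp hq hF hF0 hFpos hFsym hv hw' dl3 Ic0 w0 ws eu iew same.
have [N IN [Ne Ns]] : exists2 N, I N & e0 <= N /\ s0 <= N.
  exists (Num.max e0 s0); first by case: (leP e0 s0).
  by rewrite !le_max !lexx orbT.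
have [b [c [Nb c_0 Ibc Hright]]] := right_zone hRad hq hF hdF hv hw' ev ew IN dl3.
pose a := Num.min d c0 / 4.
have m0 : 0 < Num.min d c0 by rewrite lt_min d0.
have md : Num.min d c0 <= d by rewrite ge_min lexx.
have mc : Num.min d c0 <= c0 by rewrite ge_min lexx orbT.
have a0 : 0 < a by rewrite divr_gt0.
have ad : a < d by rewrite /a; arith.
have ac : 4 * a <= c0 by rewrite /a; arith.
have ab : 2 * a <= b by arith.
have abc : a < b + c by arith.
have a2c : 2 * a <= c0 by arith.
have aa : a <= 2 * a by arith.
have a2N : 2 * a <= N by arith.
have bbc : b <= b + c by arith.
have a2bc : 2 * a <= b + c by arith.
have acc : a <= c0 by arith.
have dl23 : dl / 3 + dl / 3 < dl by arith.
have eb : e0 <= b by exact: le_trans Nb.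
have ebc : e0 <= b + c by exact: le_trans bbc.
have sbc : s0 <= b + c by exact: le_trans Ns (le_trans Nb bbc).
have Ia : I a by apply: (interval0_left Ic0); arith.
have [L HL] := dcut_diff_lipschitz cF hv hw' a0 Ibc.
have [i1 i2] := competitor_gap_integrable hF hv hw' a0 ab c_0 Ibc.
set eta := cut_diff v w a b c in i1 i2.
set eta1 := dcut_diff v v1 w w1 a b c in i1 i2 HL.
have deta (t : R) : is_derive t 1 eta (eta1 t) by exact: (dcut_diffP hv hw' a0 ab c_0 Ibc).
have ceta1 : continuous eta1 by exact: (dcut_diff_cont hv hw' a0 ab c_0 Ibc).
have out t := @cut_diff_out R v v1 w w1 a b c a0 ab c_0 t.
have outN t : ~~ (a < t < b + c) -> - eta t = 0 /\ - eta1 t = 0.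
  by move=> /out[h1 h2]; rewrite /eta /eta1 h1 h2 oppr0.
have LN x y : a <= x -> x <= b + c -> a <= y -> y <= b + c ->
    `|- eta1 x - - eta1 y| <= L * `|x - y|.
  by move=> *; rewrite -opprD normrN; exact: HL.
have cN : continuous (fun t => - eta1 t) by move=> t; apply: continuousN; exact: ceta1.
have G1 := minimizer_gap_ge0 hF hu hdu wd cv uv min' Ia Ibc abc
  (fun t => dN (deta t)) outN LN cN.
have adm : admissible a (b + c) eta eta1.
  split; [by move=> t _ _; exact: deta|by move=> t _ _; exact: ceta1| |].
    by have [] := out a (ltac:(by rewrite ltxx)).
  by have [] := out (b + c) (ltac:(by rewrite ltxx andbF)).
have Iab t : a <= t -> t <= b + c -> I t.
  by move=> at_ tb; exact: interval0_conv Ia Ibc at_ tb.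
have iw : mu.-integrable `[a, b + c] (EFin \o energy_density p q F w w1).
  apply: cont_integrable => t at_ tb; have It := Iab t at_ tb.
  apply: energy_density_continuous; [exact: cF|exact: interval0_pos It| |].
    exact: (ode_cont hw').
  exact: (ode_cont1 hw').
have iw2 : mu.-integrable `[a, b + c] (EFin \o energy_density p q F (w \+ eta) (w1 \+ eta1)).
  apply: cont_integrable => t at_ tb; have It := Iab t at_ tb.
  apply: energy_density_continuous; [exact: cF|exact: interval0_pos It| |].
    apply: continuousD; first exact: (ode_cont hw').
    exact: is_derive_continuous (deta t).
  by apply: continuousD; [exact: (ode_cont1 hw')|exact: ceta1].
have G2 : dl <= \int[mu]_(t in `[a, b + c]) gap p q F w w1 eta eta1 t.
  rewrite /gap RintegralB //; apply: (Hgap _ _ _ _ a0 acc ebc sbc Ibc adm).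
  move=> t ct te; rewrite /eta /cut_diff.
  have [-> _] := @cutoff_in R a b c t a0 c_0 (le_trans a2c ct) (le_trans te eb).
  by rewrite mul1r.
pose tot := exchange_gap p q F v v1 w w1 (cutoff a b c) (dcutoff a b c).
have it : mu.-integrable `[a, b + c] (EFin \o tot).
  exact: (exchange_gap_integrable hF hv hw' a0 ab c_0 Ibc).
have : dl <= \int[mu]_(t in `[a, b + c]) tot t.
  have -> : \int[mu]_(t in `[a, b + c]) tot t =
      \int[mu]_(t in `[a, b + c]) gap p q F v v1 (fun t => - eta t) (fun t => - eta1 t) t +
      \int[mu]_(t in `[a, b + c]) gap p q F w w1 eta eta1 t by rewrite -RintegralD.
  by apply: le_trans G2 _; rewrite lerDr; exact: G1.
have i2a : mu.-integrable `[2 * a, b + c] (EFin \o tot) by exact: (integrable_itvS aa (lexx _) it).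
rewrite (Rint_split aa a2bc it).
rewrite (Rint_split ab bbc i2a).
have -> : \int[mu]_(t in `[2 * a, b]) tot t = 0.
  have E t : 2 * a <= t -> t <= b -> tot t = 0.
    move=> t1 t2; have [h1 h2] := @cutoff_in R a b c t a0 c_0 t1 t2.
    exact: exchange_gap_one.
  by rewrite (eq_Rint E) Rint_cst // mul0r.
have H1 := Hleft a b c a0 ad ab c_0 Ibc.
have H2 := Hright a a0 a2N.
rewrite add0r leNgt => /negP; apply; apply: le_lt_trans (lerD H1 H2) dl23.
Qed.

(** As [|v| = w > 0], the continuous function [v] has no zero; it is positive near the end, hence
    everywhere. *)
Lemma minimizer_unique : ae_eq mu I u w.
Proof.
have w_gt0 x : I x -> 0 < w x.
  exact: (nonneg_solution_gt0 hRad hsp hq hF hF0 hFsp hFneg hFpos hw).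
have cw x : I x -> {for x, continuous w} by exact: ode_cont (nonneg_solution_ode hw).
have [x0 I0 H0] := end_valueP hRad ev hsp.
have vpos x : I x -> 0 < v x.
  move=> Ix; rewrite ltNge; apply/negP => vx.
  have vx0 : v x < 0.
    rewrite lt_neqAle vx andbT; apply/eqP => z.
    by have := w_gt0 x Ix; rewrite -(minimizer_abs Ix) z normr0 ltxx.
  have xx0 : x <= x0.
    rewrite leNgt; apply/negP => h; have := H0 x Ix (ltW h).
    by rewrite ltr_norml => /andP[h1 _]; lra.
  have v0 : 0 <= v x0.
    by have := H0 x0 I0 (lexx _); rewrite ltr_norml => /andP[h1 _]; lra.
  have cvx y : x <= y -> y <= x0 -> {for y, continuous v}.
    by move=> h1 h2; apply: cv; exact: interval0_conv Ix I0 h1 h2.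
  have [y [xy yx0 vy _]] := first_hit cvx xx0 vx0 v0.
  have Iy : I y by exact: interval0_conv Ix I0 (ltW xy) yx0.
  by have := w_gt0 y Iy; rewrite -(minimizer_abs Iy) vy normr0 ltxx.
move: uv; apply: ae_imp => x + Ix => /(_ Ix) ->.
by rewrite -(minimizer_abs Ix) gtr0_norm //; exact: vpos.
Qed.

End Uniqueness.

Theorem corollary1p2 (R : realType) (Rad : \bar R) (sp p q : R) (F : R -> R)
    (hRad : (0 < Rad)%E) (hsp : 0 < sp) (hq : 0 < q)
    (hF : class_C1 F)
    (hF0 : F 0 = 0) (hFsp : F sp = 0) (hdF : 0 < F^`() sp)
    (hFneg : forall t, 0 < t -> t < sp -> F t < 0)
    (hFpos : forall t, sp < t -> 0 <= F t)
    (hFsym : forall t, 0 <= t -> (F t + F (- t)) / 2 <= 0)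
    (ustar : R -> R) (hustar : nonneg_solution Rad sp p q F ustar) :
  locally_energy_minimizing Rad p q F ustar /\
  (forall u : R -> R,
     H1loc (interval0 Rad) u ->
     locally_energy_minimizing Rad p q F u ->
     end_trace Rad u sp ->
     ae_eq (@lebesgue_measure R) (interval0 Rad) u ustar).
Proof.
split; first exact: (nonneg_solution_locally_minimizing hRad hsp hq hF hF0 hFsp hFneg hFpos
  hFsym hustar).
move=> u _ hmin [v [cv uv ev]].
exact: (minimizer_unique hRad hsp hq hF hF0 hFsp hdF hFneg hFpos hFsym hustar hmin cv uv ev).
Qed.
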